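(* Let $\Omega\subset\mathbb{R}^2$ be a bounded domain with smooth boundary, let $K$ be a positive integer, and suppose $I\in L^2(\Omega)$. Then for any parameters $\lambda,\alpha,\varepsilon>0$ there exists $(P^*,U^* )\in\mathrm{adm}_K$ such that $$E[P^*,U^*\mid I]\le E[P,U\mid I]\qquad\text{for all }(P,U)\in\mathrm{adm}_K.$$
   Context: A domain is a connected open set. $\Delta_{K-1}=\{(t_1,\dots,t_K)\in\mathbb{R}^K: t_i\ge 0,\ \sum_{i=1}^K t_i=1\}$ is the probability simplex. The admissible set is $$\mathrm{adm}_K=\{(P,U): P=(p_1,\dots,p_K),\ U=(u_1,\dots,u_K),\ p_i,u_i\in H^1(\Omega)\ (i=1,\dots,K),\ P(x)\in\Delta_{K-1}\text{ for a.e. }x\in\Omega\}.$$ All functions are real valued. The soft Mumford-Shah energy is $$E[P,U\mid I]=\lambda\sum_{i=1}^K\int_\Omega(u_i-I)^2p_i\,dx+\alpha\sum_{i=1}^K\int_\Omega|\nabla u_i|^2dx+\sum_{i=1}^K\int_\Omega\Big(9\varepsilon|\nabla p_i|^2+\frac{(p_i(1-p_i))^2}{\varepsilon}\Big)dx.$$ *)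

(* Defs.v *)
From HB Require Import structures.
From mathcomp Require Import all_boot all_order all_algebra.
From mathcomp Require Import all_classical all_reals all_analysis.

Set Implicit Arguments.
Unset Strict Implicit.
Unset Printing Implicit Defensive.

Import Order.TTheory GRing.Theory Num.Theory.
Import numFieldNormedType.Exports.

Local Open Scope classical_set_scope.
Local Open Scope ring_scope.

Section SoftMumfordShah.
Context {R : realType}.

(* C^oo: all iterated directional derivatives exist and are (Frechet)
   differentiable, hence continuous. *)
Definition smooth {V : normedModType R} (f : V -> R) : Prop :=
  forall (s : seq V) (x : V),
    differentiable (foldr (fun v g => 'D_v g : V -> R) f s) x.

Definition leb2 := ((@lebesgue_measure R) \x (@lebesgue_measure R))%E.

Definition e1 : R * R := (1, 0).
Definition e2 : R * R := (0, 1).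

Implicit Types (Om : set (R * R)) (f g phi : R * R -> R).

(* Relabelling ([sw]) and reorienting ([fl]) of the coordinate axes. *)
Definition relabel (sw fl : bool) (x : R * R) : R * R :=
  let y := if sw then (x.2, x.1) else x in (y.1, (-1) ^+ fl * y.2).

(* Near each boundary point, [Om] is the open region on one side of the graph of
   a smooth function, up to relabelling and reorienting the axes. *)
Definition smooth_boundary Om : Prop :=
  forall x0, (closure Om `\` Om°) x0 ->
    exists (r : R) (gam : R -> R) (sw fl : bool), [/\ 0 < r, smooth gam &
      forall x, ball x0 r x ->
        (Om x <-> gam (relabel sw fl x).1 < (relabel sw fl x).2)].

Definition domain Om : Prop := open Om /\ connected Om.

Definition L2 Om f : Prop := f \_ Om \in Lfun leb2 2%:E.

Definition test_function Om phi : Prop :=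
  [/\ smooth phi, compact (closure [set x | phi x != 0]) &
      closure [set x | phi x != 0] `<=` Om].

Definition weak_derivative Om (v : R * R) f g : Prop :=
  forall phi, test_function Om phi ->
    (\int[leb2]_(x in Om) (f x * 'D_v phi x)%:E =
     - \int[leb2]_(x in Om) (g x * phi x)%:E)%E.

Definition H1 Om f : Prop :=
  [/\ L2 Om f,
      exists2 g, L2 Om g & weak_derivative Om e1 f g &
      exists2 g, L2 Om g & weak_derivative Om e2 f g].

(* A square-integrable representative of the weak derivative of [f] along [v]
   (unique up to a null set); the zero function if there is none. *)
Definition wderive Om (v : R * R) f : R * R -> R :=
  xget (fun=> 0) [set g | L2 Om g /\ weak_derivative Om v f g].

Definition grad_sq Om f (x : R * R) : R :=
  wderive Om e1 f x ^+ 2 + wderive Om e2 f x ^+ 2.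

Definition simplex (K : nat) : set ('I_K -> R) :=
  [set t | (forall i, 0 <= t i) /\ \sum_(i < K) t i = 1].

Definition adm (K : nat) Om (P U : 'I_K -> R * R -> R) : Prop :=
  [/\ forall i, H1 Om (P i), forall i, H1 Om (U i) &
      {ae leb2, forall x, Om x -> simplex (fun i => P i x)}].

Definition energy (K : nat) Om (lam alpha eps : R) (I : R * R -> R)
    (P U : 'I_K -> R * R -> R) : \bar R :=
  (lam%:E * \sum_(i < K) \int[leb2]_(x in Om) ((U i x - I x) ^+ 2 * P i x)%:E
   + alpha%:E * \sum_(i < K) \int[leb2]_(x in Om) (grad_sq Om (U i) x)%:E
   + \sum_(i < K) \int[leb2]_(x in Om)
       (9 * eps * grad_sq Om (P i) x
        + (P i x * (1 - P i x)) ^+ 2 / eps)%:E)%E.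

End SoftMumfordShah.

(* Main.v *)
Require Import Defs.
From HB Require Import structures.
From mathcomp Require Import all_boot all_order all_algebra.
From mathcomp Require Import all_classical all_reals all_analysis.
From mathcomp Require Import measurable_realfun.
From mathcomp Require Import ring lra.
From mathcomp Require Import zify.

Set Implicit Arguments.
Unset Strict Implicit.
Unset Printing Implicit Defensive.

Import Order.TTheory GRing.Theory Num.Theory.
Import numFieldNormedType.Exports.

Local Open Scope classical_set_scope.
Local Open Scope ring_scope.

(** The direct method of the calculus of variations. Along a minimizing sequence
    [(P k, U k)] all terms of the energy stay bounded ([real_energy_bounds]), in particular
    the Dirichlet integrals. A subsequence converges, and every term is lower semicontinuous
    along it: the data and potential terms by Fatou's lemma, the Dirichlet integrals because
    a bounded sequence of gradients has a weak limit of no larger norm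
    ([weak_compactness]), which is the gradient of the limit ([weak_derivative_closed]).

    The energy does not control the averages of [U k i], because the data term sees
    [U k i] only through the weight [P k i]. Subtracting constants [c i k] bounds the
    averages over all boxes at once: by the Poincare inequality on boxes and the
    connectedness of the domain, the averages over any two boxes differ by a bounded amount
    ([averages_chain]). So [U k i - c i k] has a limit [v i]. If [c i k] converges, then so
    does [U k i]. Otherwise [c i k] may be taken to escape to infinity, and the bound on the
    data term forces the limit of [P k i] to vanish almost everywhere ([data_escape]); then
    the data term is zero whatever the [i]-th function is, and the limit of [U k i] is
    replaced by zero.

    Limits are constructed on the countably many boxes with rational corners. There,
    compactness comes from the Poincare inequality on the cells of a fine grid: up to a
    small error a function is determined by finitely many averages, and averages converge
    along a diagonal subsequence ([averages_compact]). The Poincare inequality itself rests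
    on [box_average_diff], which tests the weak derivative with a product of smooth
    functions of one variable, and on [dyadic_n2_le], which recovers a norm from averages
    over dyadic cells.

    A function found in this way is square-integrable on boxes only. That it is
    square-integrable on the whole domain uses the boundary: in a column above the graph
    that describes the boundary, the function is controlled by its values at a distance from
    the boundary and by its derivative along the column ([boundary_L2]). *)


(** * Square-integrable functions *)

Section SquareIntegrable.
Context d (T : measurableType d) (R : realType).
Variable mu : {measure set T -> \bar R}.
Implicit Types (A B : set T) (f g : T -> R).

(** The names stand for integrable, square-integrable and the square of the norm. *)
Definition ig A f := mu.-integrable A (EFin \o f).
Definition sqi A f := measurable_fun A f /\ ig A (fun x => f x ^+ 2).
Definition n2 A f : R := \int[mu]_(x in A) (f x ^+ 2).

Lemma igD A f g : measurable A -> ig A f -> ig A g -> ig A (fun x => f x + g x).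
Proof. by move=> mA ? ?; exact: (@integrableD _ _ _ mu A mA (EFin \o f) (EFin \o g)). Qed.

Lemma igZ A k f : measurable A -> ig A f -> ig A (fun x => k * f x).
Proof. by move=> mA ?; exact: (@integrableZl _ _ _ mu A mA k (EFin \o f)). Qed.

Lemma igB A f g : measurable A -> ig A f -> ig A g -> ig A (fun x => f x - g x).
Proof. by move=> mA ? ?; exact: (@integrableB _ _ _ mu A mA (EFin \o f) (EFin \o g)). Qed.

Lemma ig_meas A f : ig A f -> measurable_fun A f.
Proof. by move=> /measurable_int/measurable_EFinP. Qed.

Lemma ig_le A f g : measurable A -> measurable_fun A f ->
  (forall x, A x -> `|f x| <= g x) -> ig A g -> ig A f.
Proof.
move=> mA mf fg ig_g; apply: (@le_integrable _ _ _ mu A mA _ (EFin \o g)) => //.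
  exact/measurable_EFinP.
by move=> x Ax /=; rewrite lee_fin (le_trans (fg _ Ax))// ler_norm.
Qed.

Lemma eq_ig A f g : measurable A -> {in A, f =1 g} -> ig A f -> ig A g.
Proof. by move=> mA fg; apply: eq_integrable => // x xA /=; rewrite fg. Qed.

Lemma igS A B f : measurable A -> measurable B -> B `<=` A -> ig A f -> ig B f.
Proof. by move=> mA mB BA; exact: integrableS. Qed.

Lemma ig_norm A f : ig A f -> ig A (fun x => `|f x|).
Proof. exact: integrable_norm. Qed.

Lemma ig_fin A f : measurable A -> ig A f -> (\int[mu]_(x in A) (f x)%:E)%E = (\int[mu]_(x in A) f x)%:E.
Proof. by move=> mA h; rewrite /Rintegral fineK//; exact: integrable_fin_num. Qed.

Lemma ig_cst A k : measurable A -> (mu A < +oo)%E -> ig A (cst k).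
Proof.
move=> mA h; apply/integrableP; split; first exact/measurable_EFinP.
rewrite (eq_integral (fun=> `|k|%:E)%E); last by [].
by rewrite integral_cst// lte_mul_pinfty.
Qed.

Lemma measurable_sq A f : measurable_fun A f -> measurable_fun A (fun x => f x ^+ 2).
Proof. exact: measurable_funX. Qed.

Lemma sqi_ext A f g : measurable A -> {in A, f =1 g} -> sqi A f -> sqi A g.
Proof.
move=> mA fg [mf h]; split; first exact: eq_measurable_fun mf.
by apply: eq_ig h => // x xA; rewrite fg.
Qed.

Lemma sqi_le A f g : measurable A -> measurable_fun A f ->
  (forall x, A x -> f x ^+ 2 <= g x) -> ig A g -> sqi A f.
Proof.
move=> mA mf fg h; split => //; apply: ig_le h => //; first exact: measurable_sq.
by move=> x Ax; rewrite ger0_norm ?sqr_ge0// fg.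
Qed.

Lemma sqiM A f g : measurable A -> sqi A f -> sqi A g -> ig A (fun x => f x * g x).
Proof.
move=> mA [mf hf] [mg hg]; apply: ig_le (igD mA hf hg) => //.
  exact: measurable_funM.
move=> x _; have := sqr_ge0 (f x - g x); have := sqr_ge0 (f x + g x).
by rewrite ler_norml => ? ?; apply/andP; split; nra.
Qed.

Lemma sqiD A f g : measurable A -> sqi A f -> sqi A g -> sqi A (fun x => f x + g x).
Proof.
move=> mA hf hg.
apply: (@sqi_le _ _ (fun x => 2 * (f x ^+ 2 + g x ^+ 2))) => //.
- by case: hf => ? _; case: hg => ? _; exact: measurable_funD.
- by move=> x _; have := sqr_ge0 (f x - g x); nra.
- by apply: igZ => //; apply: igD => //; [case: hf|case: hg].
Qed.

Lemma sqiZ A k f : measurable A -> sqi A f -> sqi A (fun x => k * f x).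
Proof.
move=> mA [mf h]; split; first exact: measurable_funM.
by apply: eq_ig (igZ (k ^+ 2) mA h) => // x _ /=; rewrite exprMn.
Qed.

Lemma sqiB A f g : measurable A -> sqi A f -> sqi A g -> sqi A (fun x => f x - g x).
Proof.
move=> mA hf hg; apply: sqi_ext (sqiD mA hf (sqiZ (-1) mA hg)) => // x _ /=.
by rewrite mulN1r.
Qed.

Lemma sqiS A B f : measurable A -> measurable B -> B `<=` A -> sqi A f -> sqi B f.
Proof.
move=> mA mB BA [mf h]; split; [exact: measurable_funS mf|exact: igS h].
Qed.

Lemma sqi_cst A k : measurable A -> (mu A < +oo)%E -> sqi A (cst k).
Proof. by move=> mA h; split => //; exact: (ig_cst (k ^+ 2)). Qed.

Lemma sqi_ig A f : measurable A -> (mu A < +oo)%E -> sqi A f -> ig A f.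
Proof.
move=> mA h /(sqiM mA (sqi_cst 1 mA h)); apply: eq_ig => // x _.
by rewrite mul1r.
Qed.

Lemma n2_ge0 A f : 0 <= n2 A f.
Proof. by apply: Rintegral_ge0 => x _; exact: sqr_ge0. Qed.

Lemma eq_n2 A f g : {in A, f =1 g} -> n2 A f = n2 A g.
Proof. by move=> h; apply: eq_Rintegral => x xA; rewrite h. Qed.

Lemma n2_fin A f : measurable A -> sqi A f -> (\int[mu]_(x in A) (f x ^+ 2)%:E)%E = (n2 A f)%:E.
Proof. by move=> mA [_ h]; exact: ig_fin. Qed.

Lemma RintZ A k f : measurable A -> ig A f -> \int[mu]_(x in A) (k * f x) = k * \int[mu]_(x in A) f x.
Proof. by move=> mA h; rewrite RintegralZl. Qed.

Lemma n2D A f g : measurable A -> sqi A f -> sqi A g ->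
  n2 A (fun x => f x + g x) = n2 A f + 2 * \int[mu]_(x in A) (f x * g x) + n2 A g.
Proof.
move=> mA hf hg; have hfg := sqiM mA hf hg.
rewrite -(RintZ 2 mA hfg) /n2 -RintegralD//; [|by case: hf|exact: igZ].
rewrite -RintegralD//; [|by apply: igD => //; [case: hf|exact: igZ]|by case: hg].
by apply: eq_Rintegral => x _; ring.
Qed.

Lemma n2Z A k f : measurable A -> sqi A f -> n2 A (fun x => k * f x) = k ^+ 2 * n2 A f.
Proof.
move=> mA [_ h]; rewrite /n2 -RintZ//; apply: eq_Rintegral => x _; exact: exprMn.
Qed.

(** The parallelogram identity. *)
Lemma n2_half A f g : measurable A -> sqi A f -> sqi A g ->
  n2 A (fun x => f x - g x) = 2 * n2 A f + 2 * n2 A g - 4 * n2 A (fun x => 2^-1 * (f x + g x)).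
Proof.
move=> mA hf hg; rewrite n2Z//; last exact: sqiD.
rewrite [in RHS]n2D//.
rewrite [LHS](_ : _ = n2 A (fun x => f x + -1 * g x)); last first.
  by apply: eq_n2 => x _; rewrite mulN1r.
rewrite n2D//; last exact: sqiZ.
rewrite n2Z//.
have -> : \int[mu]_(x in A) (f x * (-1 * g x)) = - \int[mu]_(x in A) (f x * g x).
  rewrite -[RHS]mulN1r -RintZ//; last exact: sqiM.
  by apply: eq_Rintegral => x _; ring.
by field.
Qed.

Lemma n2D_le A f g : measurable A -> sqi A f -> sqi A g ->
  n2 A (fun x => f x + g x) <= 2 * n2 A f + 2 * n2 A g.
Proof.
move=> mA hf hg; have := n2_half mA hf hg.
rewrite n2Z//; last exact: sqiD.
by have := n2_ge0 A (fun x => f x - g x) => ? ?; lra.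
Qed.

Lemma n2B_le A f g : measurable A -> sqi A f -> sqi A g ->
  n2 A (fun x => f x - g x) <= 2 * n2 A f + 2 * n2 A g.
Proof.
move=> mA hf hg; have := n2_half mA hf hg.
by have := n2_ge0 A (fun x => 2^-1 * (f x + g x)) => ? ?; lra.
Qed.

Lemma n2C A f g : n2 A (fun x => f x - g x) = n2 A (fun x => g x - f x).
Proof. by apply: eq_Rintegral => x _; ring. Qed.

Lemma Rint_subset A B f : measurable A -> measurable B -> B `<=` A -> ig A f ->
  (forall x, A x -> 0 <= f x) -> \int[mu]_(x in B) f x <= \int[mu]_(x in A) f x.
Proof.
move=> mA mB BA h f0; rewrite -lee_fin -!ig_fin//; last exact: igS h.
apply: ge0_subset_integral => //; first exact: measurable_int h.
Qed.

Lemma n2_subset A B f : measurable A -> measurable B -> B `<=` A -> sqi A f -> n2 B f <= n2 A f.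
Proof. by move=> mA mB BA [_ h]; apply: Rint_subset => // x _; exact: sqr_ge0. Qed.

(** The discriminant of the nonnegative quadratic [t |-> n2 A (f + t g)]. *)
Lemma cauchy_schwarz A f g : measurable A -> sqi A f -> sqi A g ->
  (\int[mu]_(x in A) (f x * g x)) ^+ 2 <= n2 A f * n2 A g.
Proof.
move=> mA hf hg; set c := \int[mu]_(x in A) _.
have H t : 0 <= n2 A f + 2 * t * c + t ^+ 2 * n2 A g.
  have := n2_ge0 A (fun x => f x + t * g x).
  rewrite n2D//; last exact: sqiZ.
  rewrite n2Z//.
  have -> : \int[mu]_(x in A) (f x * (t * g x)) = t * c.
    rewrite /c -RintZ//; last exact: sqiM.
    by apply: eq_Rintegral => x _; ring.
  by rewrite mulrA.
have := n2_ge0 A g; rewrite le_eqVlt => /predU1P[g0|g0].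
  have := H (- (n2 A f + 1) / (2 * c)); rewrite -g0 !mulr0 addr0.
  have [->|c0] := eqVneq c 0; first by rewrite expr0n.
  have -> : 2 * (- (n2 A f + 1) / (2 * c)) * c = - (n2 A f + 1) by field.
  by move=> ?; exfalso; lra.
have := H (- c / n2 A g).
have -> : n2 A f + 2 * (- c / n2 A g) * c + (- c / n2 A g) ^+ 2 * n2 A g = (n2 A f * n2 A g - c ^+ 2) / n2 A g.
  by field; rewrite gt_eqF.
by rewrite pmulr_lge0 ?invr_gt0// subr_ge0.
Qed.

Lemma sq_Rint_le A f : measurable A -> (mu A < +oo)%E -> sqi A f ->
  (\int[mu]_(x in A) f x) ^+ 2 <= fine (mu A) * n2 A f.
Proof.
move=> mA h hf; have := cauchy_schwarz mA (sqi_cst 1 mA h) hf.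
have -> : n2 A (cst 1) = fine (mu A) by rewrite /n2 /= expr1n Rintegral_cst// mul1r.
by congr (_ ^+ 2 <= _); apply: eq_Rintegral => x _; rewrite mul1r.
Qed.

Lemma sqi_norm A f : measurable A -> sqi A f -> sqi A (fun x => `|f x|).
Proof.
move=> mA [mf h]; split; first exact: measurableT_comp.
by apply: eq_ig h => // x _; rewrite real_normK// num_real.
Qed.

Lemma n2_norm A f : n2 A (fun x => `|f x|) = n2 A f.
Proof. by apply: eq_Rintegral => x _; rewrite real_normK// num_real. Qed.

Lemma ae_n2_eq A f g : measurable A -> measurable_fun A f -> measurable_fun A g ->
  {ae mu, forall x, A x -> f x = g x} -> n2 A f = n2 A g.
Proof.
move=> mA mf mg fg; rewrite /n2 /Rintegral; congr fine.
apply: ge0_ae_eq_integral => //.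
- by apply/measurable_EFinP; exact: measurable_sq.
- by apply/measurable_EFinP; exact: measurable_sq.
- by move=> x _ /=; rewrite lee_fin sqr_ge0.
- by move=> x _ /=; rewrite lee_fin sqr_ge0.
by apply: filterS fg => x fg Ax /=; rewrite fg.
Qed.

(** Fatou's lemma; the integrals of the [h n] are taken in the extended reals, so that
    their integrability need not be known. *)
Lemma fatou_Rint A (h : nat -> T -> R) f L : measurable A ->
  (forall n, measurable_fun A (h n)) -> measurable_fun A f ->
  (forall n x, A x -> 0 <= h n x) -> (forall x, A x -> 0 <= f x) ->
  {ae mu, forall x, A x -> forall e : R, 0 < e -> exists N, forall n, (N <= n)%N -> f x <= h n x + e} ->
  (forall e : R, 0 < e -> exists N, forall n, (N <= n)%N ->
    (\int[mu]_(x in A) (h n x)%:E <= (L + e)%:E)%E) ->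
  ig A f /\ \int[mu]_(x in A) f x <= L.
Proof.
move=> mA mh mf h0 f0 fh hL.
suff H : (\int[mu]_(x in A) (f x)%:E <= L%:E)%E.
  have igf : ig A f.
    apply/integrableP; split; first exact/measurable_EFinP.
    rewrite (_ : (\int[mu]_(x in A) _)%E = (\int[mu]_(x in A) (f x)%:E)%E).
      by rewrite (le_lt_trans H)// ltry.
    by apply: eq_integral => x /set_mem Ax /=; rewrite ger0_norm// f0.
  by split => //; rewrite -lee_fin -ig_fin.
have : (\int[mu]_(x in A) (f x)%:E <= \int[mu]_(x in A) limn_einf (fun n => (h n x)%:E))%E.
  apply: ae_ge0_le_integral => //.
  - exact/measurable_EFinP.
  - move=> x Ax; rewrite limn_einf_lim; apply: lime_ge; first exact: is_cvg_einfs.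
    apply: nearW => n; apply: le_ereal_inf_tmp => _ [m /= _ <-].
    by rewrite lee_fin h0.
  - rewrite /limn_einf; apply: measurableT_comp => //.
    apply: measurable_fun_limn_esup => n; apply: measurableT_comp => //.
    exact/measurable_EFinP.
  apply: filterS fh => x fh Ax; apply/lee_addgt0Pr => e e0.
  have [N hN] := fh Ax e e0.
  rewrite -leeBlDr// [leRHS]limn_einf_lim; apply: lime_ge; first exact: is_cvg_einfs.
  exists N => // n /= Nn; apply: le_ereal_inf_tmp => _ [m /= nm <-].
  by rewrite -EFinD lee_fin lerBlDr hN// (leq_trans Nn).
move/le_trans; apply.
have := @fatou _ _ _ mu A mA (fun n x => (h n x)%:E) (fun n => (measurable_EFinP _ _).2 (mh n)) (fun n x Ax => h0 n x Ax).
move/le_trans; apply.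
apply/lee_addgt0Pr => e e0; have [N hN] := hL _ e0.
rewrite limn_einf_lim; apply: lime_le; first exact: is_cvg_einfs.
exists N => // n /= Nn; apply: le_trans (hN _ Nn).
by apply: ereal_inf_lbound; exists n => /=.
Qed.

End SquareIntegrable.

(** * Completeness and weak compactness *)

Section Completeness.
Context d (T : measurableType d) (R : realType).
Variable mu : {measure set T -> \bar R}.
Implicit Types (A B : set T) (f g : T -> R).
Local Notation sqi := (sqi mu).
Local Notation n2 := (n2 mu).
Local Notation ig := (ig mu).

Lemma geometric_cvg (v : nat -> R) (M : R) :
  (forall k, `|v k.+1 - v k| <= M * 2^-1 ^+ k) -> cvgn v.
Proof.
move=> hv; rewrite (_ : v = (fun n => v 0%N + series (telescope v) n)); last first.
  by apply/funext => n; rewrite -eq_sum_telescope.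
apply: is_cvgD; first exact: is_cvg_cst.
apply: normed_cvg; apply: (@series_le_cvg _ _ (geometric M 2^-1)) => //.
- by move=> n; exact: normr_ge0.
- by move=> n; exact: le_trans (normr_ge0 _) (hv n).
- by apply: is_cvg_geometric_series; rewrite ger0_norm// invf_lt1// ltr1n.
Qed.

(** Along a fast subsequence the increments are summable in the mean, hence almost
    everywhere; the threshold of step [k] only looks at the first [k] members of the
    family, so that one subsequence serves them all. *)
Lemma ae_cvg_subseq (F : nat -> nat -> T -> R) (Q : nat -> set T) :
  (forall j, measurable (Q j)) -> (forall j n, sqi (Q j) (F j n)) ->
  (forall j (e : R), 0 < e -> exists N, forall n m, (N <= n)%N -> (N <= m)%N ->
    n2 (Q j) (fun x => F j n x - F j m x) <= e) ->
  exists2 s : nat -> nat, (forall k, (k <= s k)%N) &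
    forall j, {ae mu, forall x, Q j x -> cvgn (fun k => F j (s k) x)}.
Proof.
move=> mQ hF cF.
have /choice[N hN] : forall k, exists N, forall j n m, (j <= k)%N -> (N <= n)%N -> (N <= m)%N ->
    n2 (Q j) (fun x => F j n x - F j m x) <= 8^-1 ^+ k.
  move=> k.
  have /choice[M hM] : forall j, exists N, forall n m, (N <= n)%N -> (N <= m)%N ->
      n2 (Q j) (fun x => F j n x - F j m x) <= 8^-1 ^+ k.
    by move=> j; apply: cF; rewrite exprn_gt0.
  exists (\max_(j < k.+1) M j)%N => j n m jk hn hm.
  apply: hM; [apply: leq_trans hn|apply: leq_trans hm];
    exact: (leq_bigmax (Ordinal (jk : (j < k.+1)%N))).
pose s k := (k + \max_(i < k.+1) N i)%N.
have sN i k : (i <= k)%N -> (N i <= s k)%N.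
  move=> ik; apply: leq_trans (leq_addl _ _).
  exact: (leq_bigmax (Ordinal (ik : (i < k.+1)%N))).
exists s; first by move=> k; exact: leq_addr.
move=> j.
pose D k x := F j (s (j + k).+1) x - F j (s (j + k)%N) x.
have sD k : sqi (Q j) (D k) by exact: sqiB.
have nD k : n2 (Q j) (D k) <= 8^-1 ^+ k.
  apply: (@le_trans _ _ (8^-1 ^+ (j + k))).
    by apply: hN; [exact: leq_addr|exact/sN/leqnSn|exact: sN].
  apply: ler_wiXn2l; rewrite ?invr_ge0// ?invf_le1 ?ler1n//.
  exact: leq_addl.
(* The weights 4^k against the bounds 8^-k leave a convergent geometric series, and
   where [g] is finite the increments decay like 2^-k. *)
pose g x := (\sum_(0 <= k <oo) (4 ^+ k * D k x ^+ 2)%:E)%E.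
have g0 k x : Q j x -> (0 <= (4 ^+ k * D k x ^+ 2)%:E)%E.
  by move=> _; rewrite lee_fin; apply: mulr_ge0; [exact: exprn_ge0|exact: sqr_ge0].
have mD k : measurable_fun (Q j) (fun x => (4 ^+ k * D k x ^+ 2)%:E).
  by apply/measurable_EFinP/measurable_funM => //; apply: measurable_sq; case: (sD k).
have ig_g : mu.-integrable (Q j) g.
  apply/integrableP; split; first by apply: (@ge0_emeasurable_sum _ _ _ _ _ xpredT) => // k x Qx _; exact: g0.
  rewrite (_ : (\int[mu]_(x in Q j) _)%E = (\int[mu]_(x in Q j) g x)%E); last first.
    by apply: eq_integral => x /set_mem Qx; rewrite gee0_abs//; apply: nneseries_ge0 => k _ _; exact: g0.
  rewrite /g integral_nneseries//.
  apply: (@le_lt_trans _ _ (\sum_(0 <= k <oo) (2^-1 ^+ k)%:E)%E).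
    apply: lee_nneseries => [k _ _|k _]; first by apply: integral_ge0 => x Qx; exact: g0.
    rewrite ig_fin//; last by apply: igZ => //; case: (sD k).
    rewrite lee_fin RintZ//; last by case: (sD k).
    have -> : 2^-1 ^+ k = 4 ^+ k * 8^-1 ^+ k :> R.
      by rewrite -exprMn; congr (_ ^+ k); field.
    by apply: ler_wpM2l; [exact: exprn_ge0|exact: nD].
  have := @is_cvg_geometric_series R 1 2^-1.
  rewrite ger0_norm// invf_lt1// ltr1n => /(_ isT) gc.
  rewrite (_ : (\sum_(0 <= k <oo) _)%E = (limn (series (geometric 1 (2^-1 : R))))%:E) ?ltry//.
  rewrite -EFin_lim//; congr (limn _); apply/funext => n /=.
  by rewrite /series /= -sumEFin; apply: eq_bigr => i _ /=; rewrite mul1r.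
apply: filterS (integrable_ae (mQ j) ig_g) => x /[swap] Qx /(_ Qx) gfin.
have bD k : 4 ^+ k * D k x ^+ 2 <= fine (g x).
  rewrite -lee_fin fineK//.
  apply: (@le_trans _ _ (\sum_(0 <= i < k.+1) (4 ^+ i * D i x ^+ 2)%:E)%E).
    by rewrite big_nat_recr//= leeDr//; apply: sume_ge0 => i _; exact: g0.
  by apply: nneseries_lim_ge => i _ _; exact: g0.
suff /cvg_ex[l hl] : cvgn (fun k => F j (s (k + j)%N) x).
  by apply/cvg_ex; exists l; rewrite -(cvg_shiftn j).
apply: (@geometric_cvg _ (Num.sqrt (fine (g x)))) => k /=.
rewrite -(@ler_pXn2r _ 2)// ?nnegrE ?mulr_ge0 ?sqrtr_ge0 ?exprn_ge0//.
rewrite real_normK ?num_real// exprMn sqr_sqrtr; last first.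
  by apply: le_trans (bD 0%N); apply: mulr_ge0; [exact: exprn_ge0|exact: sqr_ge0].
have := bD k; rewrite /D [(j + k)%N]addnC -addSn => h.
rewrite -exprM mulnC exprM exprVn.
rewrite (_ : 2 ^+ 2 = 4) ?exprVn; last by rewrite expr2; ring.
by rewrite ler_pdivlMr ?exprn_gt0// mulrC.
Qed.

(** The limit superior is measurable everywhere, and is the limit where there is one. *)
Definition limfun (F : nat -> T -> R) (x : T) : R :=
  fine (limn_esup (fun n => (F n x)%:E)).

Lemma limfunE (F : nat -> T -> R) x : cvgn (fun k => F k x) ->
  (fun k => F k x) @ \oo --> limfun F x.
Proof.
move=> cF.
have h : (fun n => (F n x)%:E) @ \oo --> (limn (fun k => F k x))%:E.
  by apply: cvg_EFin; [exact: nearW|exact: cF].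
rewrite /limfun is_cvg_limn_esupE; last by apply/cvg_ex; eexists; exact: h.
by rewrite (cvg_lim _ h).
Qed.

Lemma measurable_limfun A (F : nat -> T -> R) :
  (forall n, measurable_fun A (F n)) -> measurable_fun A (limfun F).
Proof.
move=> mF; apply: measurableT_comp => //.
by apply: measurable_fun_limn_esup => n; exact/measurable_EFinP.
Qed.

Lemma fatou_n2 A (h : nat -> T -> R) f L : measurable A ->
  (forall n, sqi A (h n)) -> measurable_fun A f ->
  {ae mu, forall x, A x -> (fun n => h n x) @ \oo --> f x} ->
  (forall e : R, 0 < e -> exists N, forall n, (N <= n)%N -> n2 A (h n) <= L + e) ->
  sqi A f /\ n2 A f <= L.
Proof.
move=> mA mh mf hf hL.
have [] := @fatou_Rint _ _ _ mu A (fun n x => h n x ^+ 2) (fun x => f x ^+ 2) L mA.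
- by move=> n; apply: measurable_sq; case: (mh n).
- exact: measurable_sq.
- by move=> n x _; exact: sqr_ge0.
- by move=> x _; exact: sqr_ge0.
- apply: filterS hf => x hf /hf {}hf e e0.
  have : (fun n => h n x ^+ 2) @ \oo --> f x ^+ 2 by exact: cvgM.
  move/cvgrPdist_le => /(_ _ e0) [N _ hN]; exists N => n /hN /=.
  by rewrite ler_norml => /andP[_]; lra.
- move=> e /hL[N hN]; exists N => n /hN.
  by rewrite n2_fin.
by move=> ? ?; split.
Qed.

(** Fatou's lemma in the second index of the Cauchy condition. *)
Lemma L2_limit A (F : nat -> T -> R) s f : measurable A -> (forall n, sqi A (F n)) ->
  measurable_fun A f ->
  (forall e : R, 0 < e -> exists N, forall n m, (N <= n)%N -> (N <= m)%N ->
    n2 A (fun x => F n x - F m x) <= e) ->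
  (forall k, (k <= s k)%N) ->
  {ae mu, forall x, A x -> (fun k => F (s k) x) @ \oo --> f x} ->
  sqi A f /\ (forall e : R, 0 < e -> exists N, forall n, (N <= n)%N ->
    n2 A (fun x => F n x - f x) <= e).
Proof.
move=> mA hF mf cF hs hf.
have H e : 0 < e -> exists N, forall n, (N <= n)%N -> sqi A (fun x => F n x - f x) /\
    n2 A (fun x => F n x - f x) <= e.
  move=> e0; have [N hN] := cF e e0; exists N => n Nn.
  apply: (@fatou_n2 A (fun k x => F n x - F (s k) x)) => //.
  - by move=> k; exact: sqiB.
  - by apply: measurable_funB => //; case: (hF n).
  - by apply: filterS hf => x hf /hf {}hf; apply: cvgB => //; exact: cvg_cst.
  - move=> e' e'0; exists N => k Nk; rewrite (le_trans (hN _ _ _ _)) ?lerDl ?(ltW e'0)//.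
    exact: leq_trans Nk (hs k).
split; last by move=> e /H[N hN]; exists N => n /hN[].
have [N /(_ N (leqnn _))[h _]] := H 1 ltr01.
by apply: sqi_ext (sqiB mA (hF N) h) => // x _ /=; ring.
Qed.

(** The convex hull of a tail, as far as repeated midpoints can see it. *)
Inductive mid (h : nat -> T -> R) (n : nat) : (T -> R) -> Prop :=
| mid_base k : (n <= k)%N -> mid h n (h k)
| mid_half f g : mid h n f -> mid h n g -> mid h n (fun x => 2^-1 * (f x + g x)).

Lemma midW h n m f : (n <= m)%N -> mid h m f -> mid h n f.
Proof.
move=> nm; elim=> [k mk|f1 f2 _ h1 _ h2]; first exact/mid_base/(leq_trans nm).
exact: mid_half.
Qed.

Lemma n2_mid_le A f g C : measurable A -> sqi A f -> sqi A g -> n2 A f <= C -> n2 A g <= C ->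
  n2 A (fun x => 2^-1 * (f x + g x)) <= C.
Proof.
move=> mA hf hg fC gC; have := n2_half mA hf hg.
have := n2_ge0 mu A (fun x => f x - g x) => ? ?; lra.
Qed.

(** Bounded sequences have weak cluster points, and the weak limit has no larger norm
    than the sequence. Elements of almost least norm in the hulls of the tails form a
    Cauchy sequence by the parallelogram identity, and its strong limit inherits every
    property of the tails that is stable under midpoints; so no weak topology is needed. *)
Lemma weak_compactness A (h : nat -> T -> R) L : measurable A ->
  (forall n, sqi A (h n)) ->
  (forall e : R, 0 < e -> exists N, forall n, (N <= n)%N -> n2 A (h n) <= L + e) ->
  exists v, [/\ sqi A v, n2 A v <= L &
    forall psi l, sqi A psi ->
      (fun n => \int[mu]_(x in A) (h n x * psi x)) @ \oo --> l ->
      \int[mu]_(x in A) (v x * psi x) = l].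
Proof.
move=> mA hh hL.
have mid_sqi n f : mid h n f -> sqi A f.
  by elim=> [k _|f1 f2 _ h1 _ h2]; [exact: hh|exact/sqiZ/sqiD].
have mid_L e : 0 < e -> exists N, forall n f, (N <= n)%N -> mid h n f -> n2 A f <= L + e.
  move=> /hL[N hN]; exists N => n f Nn; elim=> [k nk|f1 f2 m1 h1 m2 h2].
    by apply: hN; exact: leq_trans nk.
  by apply: n2_mid_le => //; [exact: mid_sqi m1|exact: mid_sqi m2].
pose S n := [set n2 A f | f in mid h n].
pose D n := inf (S n).
have S0 n : S n !=set0 by exists (n2 A (h n)), (h n) => //; exact: mid_base.
have lbS n : has_lbound (S n) by exists 0 => _ [f _ <-]; exact: n2_ge0.
have Dle n f : mid h n f -> D n <= n2 A f by move=> mf; apply: ge_inf => //; exists f.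
have Dmono n m : (n <= m)%N -> D n <= D m.
  move=> nm; apply: lb_le_inf => // _ [f mf <-]; apply: Dle; exact: midW mf.
have [N1 hN1] := mid_L 1 ltr01.
have DL n : D n <= L + 1.
  apply: (le_trans (Dmono _ _ (leq_maxl n N1))).
  have mb := mid_base h (leqnn (maxn n N1)).
  by apply: (le_trans (Dle _ _ mb)); apply: hN1 mb; exact: leq_maxr.
pose dd := sup (range D).
have Dd n : D n <= dd.
  apply: sup_upper_bound; last by exists n.
  by split; [exists (D 0%N), 0%N|exists (L + 1) => _ [k _ <-]].
have dD e : 0 < e -> exists N, forall n, (N <= n)%N -> dd - e < D n.
  move=> e0; have [|_ [N _ <-] hN] := @sup_adherent _ (range D) e e0.
    by split; [exists (D 0%N), 0%N|exists (L + 1) => _ [k _ <-]].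
  by exists N => n Nn; exact: lt_le_trans hN (Dmono _ _ Nn).
have /choice[w hw] : forall n, exists f, mid h n f /\ n2 A f <= D n + n.+1%:R^-1.
  move=> n; have n0 : 0 < n.+1%:R^-1 :> R by rewrite invr_gt0.
  have [_ [f mf <-] hf] := inf_adherent n0 (conj (S0 n) (lbS n)).
  by exists f; split => //; exact: ltW.
have sw n : sqi A (w n) by case: (hw n) => /mid_sqi.
have small e : 0 < e -> exists N, forall n, (N <= n)%N -> n.+1%:R^-1 < e :> R.
  move=> e0; have := near_infty_natSinv_lt (PosNum e0).
  by move=> [N _ hN]; exists N => n /hN.
have cauchy_le n m : (n <= m)%N -> n2 A (fun x => w n x - w m x) <=
    2 * (D m - D n) + 2 * n.+1%:R^-1 + 2 * m.+1%:R^-1.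
  move=> nm; rewrite n2_half//.
  have [mn hn] := hw n; have [mm hm] := hw m.
  have := Dle _ _ (mid_half mn (midW nm mm)).
  move: hn hm; set a := n2 A (w n); set b := n2 A (w m); set c := n2 A _.
  set p := n.+1%:R^-1; set q := m.+1%:R^-1; move=> *; lra.
have cw e : 0 < e -> exists N, forall n m, (N <= n)%N -> (N <= m)%N ->
    n2 A (fun x => w n x - w m x) <= e.
  move=> e0; have e6 : 0 < e / 6 by rewrite divr_gt0.
  have [N2 hN2] := dD _ e6; have [N3 hN3] := small _ e6.
  exists (maxn N2 N3).
  suff H n m : (maxn N2 N3 <= n)%N -> (n <= m)%N -> n2 A (fun x => w n x - w m x) <= e.
    move=> n m hn hm; have [nm|/ltnW nm] := leqP n m; first exact: H.
    by rewrite n2C; exact: H.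
  rewrite geq_max => /andP[h2 h3] nm; apply: (le_trans (cauchy_le _ _ nm)).
  have := hN2 _ h2; have := hN3 _ h3; have := hN3 _ (leq_trans h3 nm); have := Dd m.
  set p := n.+1%:R^-1; set q := m.+1%:R^-1; set u := D n; set v := D m; move: p q u v => p q u v *.
  lra.
have [s hs /(_ 0%N) aes] := @ae_cvg_subseq (fun=> w) (fun=> A) (fun=> mA) (fun=> sw) (fun=> cw).
pose v := limfun (fun k => w (s k)).
have mv : measurable_fun A v by apply: measurable_limfun => n; case: (sw (s n)).
have aev : {ae mu, forall x, A x -> (fun k => w (s k) x) @ \oo --> v x}.
  by apply: filterS aes => x hx /hx; exact: limfunE.
have [sv wv] := L2_limit mA sw mv cw hs aev.
exists v; split => //.
  have [] // := @fatou_n2 A (fun k => w (s k)) v L mA (fun k => sw (s k)) mv aev.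
  move=> e /mid_L[N hN]; exists N => n Nn; apply: hN (proj1 (hw _)).
  exact: leq_trans Nn (hs n).
move=> psi l hpsi hl.
have mid_l e : 0 < e -> exists N, forall n f, (N <= n)%N -> mid h n f ->
    `|\int[mu]_(x in A) (f x * psi x) - l| <= e.
  move: hl => /cvgrPdist_le hl /hl[N _ hN]; exists N => n f Nn.
  elim=> [k nk|f1 f2 m1 h1 m2 h2].
    by rewrite distrC; apply: hN => /=; exact: leq_trans nk.
  rewrite (_ : \int[mu]_(x in A) _ = 2^-1 * (\int[mu]_(x in A) (f1 x * psi x) + \int[mu]_(x in A) (f2 x * psi x))); last first.
    have s1 := sqiM mA (mid_sqi _ _ m1) hpsi; have s2 := sqiM mA (mid_sqi _ _ m2) hpsi.
    rewrite -RintegralD// -RintZ//; last exact: igD.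
    by apply: eq_Rintegral => x _; ring.
  by move: h1 h2; rewrite !ler_norml => /andP[? ?] /andP[? ?]; apply/andP; split; lra.
apply/eqP; rewrite -subr_eq0 -normr_le0; apply/ler_addgt0Pr => e e0; rewrite add0r.
have e2 : 0 < e / 2 by rewrite divr_gt0.
have [N hN] := mid_l _ e2.
have C0 : 0 < (e / 2) ^+ 2 / (1 + n2 A psi).
  by rewrite divr_gt0 ?exprn_gt0// ltr_pwDl// n2_ge0.
have [N' hN'] := wv _ C0.
pose n := maxn N N'.
have h1 := hN n (w n) (leq_maxl _ _) (proj1 (hw n)).
have h2 := hN' n (leq_maxr _ _).
have h3 := cauchy_schwarz mA (sqiB mA (sw n) sv) hpsi.
have E : \int[mu]_(x in A) ((w n x - v x) * psi x) =
   \int[mu]_(x in A) (w n x * psi x) - \int[mu]_(x in A) (v x * psi x).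
  rewrite -RintegralB//; [|exact: sqiM|exact: sqiM].
  by apply: eq_Rintegral => x _; rewrite mulrBl.
have h4 : `|\int[mu]_(x in A) ((w n x - v x) * psi x)| <= e / 2.
  rewrite -(@ler_pXn2r _ 2)// ?nnegrE ?(ltW e2)// real_normK ?num_real//.
  apply: (le_trans h3); apply: (le_trans (ler_wpM2r (n2_ge0 _ _ _) h2)).
  rewrite mulrAC ler_pdivrMr ?ltr_pwDl ?n2_ge0//.
  by rewrite ler_wpM2l ?exprn_ge0 ?(ltW e2)// lerDr.
move: h4 h1; rewrite E !ler_norml => /andP[? ?] /andP[? ?].
by apply/andP; split; lra.
Qed.

End Completeness.

(** * Half-open rectangles *)

Lemma RintegralT d (T : measurableType d) (R : realType) (mu : {measure set T -> \bar R})
  (D A : set T) (g : T -> R) :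
  \int[mu]_(x in D `&` A) g x = \int[mu]_(x in D) (g x * \1_A x).
Proof.
rewrite Rintegral_mkcondr; apply: eq_Rintegral => x _.
rewrite patchE indicE; case: ifPn => _; rewrite ?mulr1 ?mulr0 //.
Qed.

Lemma dct d (T : measurableType d) (R : realType) (mu : {measure set T -> \bar R})
  (D : set T) (f_ : nat -> T -> R) (f g : T -> R) :
  measurable D -> (forall n, measurable_fun D (f_ n)) -> measurable_fun D f ->
  {ae mu, forall x, D x -> (fun n => f_ n x) @ \oo --> f x} ->
  ig mu D g -> (forall n x, D x -> `|f_ n x| <= g x) ->
  (fun n => \int[mu]_(x in D) f_ n x) @ \oo --> \int[mu]_(x in D) f x.
Proof.
move=> mD mf_ mf ff igg fg.
have [] := @dominated_convergence _ _ _ mu D mD (fun n x => (f_ n x)%:E) (EFin \o f) (EFin \o g).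
- by move=> n; exact/measurable_EFinP.
- exact/measurable_EFinP.
- apply: filterS ff => x ff /ff h /=; apply: cvg_EFin; first exact: nearW.
  exact: h.
- exact: igg.
- by apply: aeW => x n Dx /=; rewrite lee_fin fg.
move=> igf _ h; rewrite /Rintegral.
apply: fine_cvg; rewrite fineK//; exact: integrable_fin_num.
Qed.

(** The sets over which an integrable function of zero total integral integrates to zero
    form a Dynkin system; it is transported along a map in order to treat the two factors
    of a product one at a time. *)
Lemma dynkin_zero_integral d (T : measurableType d) (R : realType)
  (mu : {measure set T -> \bar R}) d' (T' : measurableType d') (D : set T) (f : T -> T') g :
  measurable D -> measurable_fun setT f -> ig mu D g -> \int[mu]_(x in D) g x = 0 ->
  dynkin [set A | measurable A /\ \int[mu]_(x in D `&` f @^-1` A) g x = 0].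
Proof.
move=> mD mf igg g0.
have mpre A : measurable A -> measurable (f @^-1` A) by move=> mA; rewrite -[X in measurable X]setTI; exact: mf.
split.
- by rewrite /= preimage_setT setIT.
- move=> A [mA A0]; split; first exact: measurableC.
  have : \int[mu]_(x in (D `&` f @^-1` A) `|` (D `&` f @^-1` (~` A))) g x = 0.
    by rewrite -setIUr -preimage_setU setUv preimage_setT setIT.
  rewrite Rintegral_setU//; last 4 first.
  + by apply: measurableI => //; exact: mpre.
  + by apply: measurableI => //; exact/mpre/measurableC.
  + by rewrite -setIUr -preimage_setU setUv preimage_setT setIT.
  + by apply/disj_setPS => x [[_ ?] [_]].
  by rewrite A0 add0r.
- move=> F tF hF; split; first by apply: bigcup_measurable => k _; case: (hF k).
  have mDF k : measurable (D `&` f @^-1` (F k)) by apply: measurableI => //; apply: mpre; case: (hF k).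
  have igDF k : ig mu (D `&` f @^-1` (F k)) g by apply: igS igg.
  have E : D `&` f @^-1` (\bigcup_k F k) = \bigcup_k (D `&` f @^-1` (F k)).
    by rewrite preimage_bigcup setI_bigcupr.
  rewrite E /Rintegral integral_bigcup//.
  + by rewrite eseries0// => k _ _; rewrite (ig_fin (mDF k) (igDF k)); have [_ ->] := hF k.
  + move/trivIsetP : tF => tF; apply/trivIsetP => i j _ _ ij.
    have := tF i j Logic.I Logic.I ij; rewrite -!subset0 => h x [[_ /= ?] [_ /= ?]].
    by apply: (h (f x)).
  + rewrite -E; apply: igS igg => //; apply: measurableI => //; apply: mpre.
    by apply: bigcup_measurable => k _; case: (hF k).
Qed.

(** The plane with the measurable structure that carries [leb2]; the one inferred for
    [R * R] is convertible to it, but not syntactically equal. *)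
Notation plane R := (measurableTypeR R * measurableTypeR R)%type.
Notation pmeasurable := (@measurable _ (plane _)).

Section Rectangles.
Context {R : realType}.
Implicit Types (g : R * R -> R).

Definition rect (a b c d : R) : set (R * R) := `]a, b] `*` `]c, d].

Lemma rectP (a b c d : R) x : rect a b c d x <-> (a < x.1 <= b /\ c < x.2 <= d).
Proof. by rewrite /rect /=; split => -[]; rewrite ?in_itv. Qed.

Lemma measurable_rect a b c d : pmeasurable (rect a b c d).
Proof. by apply: measurableX; exact: (measurable_itv `]_, _]). Qed.
Hint Resolve measurable_rect : core.

Lemma leb2_rect a b c d : a <= b -> c <= d -> leb2 (rect a b c d) = ((b - a) * (d - c))%:E.
Proof.
move=> ab cd; rewrite /leb2 product_measure1E; [|exact: measurable_itv..].
rewrite [X in (X * _)%E](lebesgue_measure_itv `]a, b]) [X in (_ * X)%E](lebesgue_measure_itv `]c, d]) /= !lte_fin.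
move: ab cd; rewrite le_eqVlt => /predU1P[->|ab].
  by rewrite ltxx mul0e subrr mul0r.
rewrite le_eqVlt => /predU1P[->|cd].
  by rewrite ltxx mule0 subrr mulr0.
by rewrite ab cd -EFinB -EFinB -EFinM.
Qed.

Lemma rect_ge a b c d : (b <= a) || (d <= c) -> rect a b c d = set0.
Proof. by move=> /orP[]h; apply/seteqP; split => // x /rectP[]; lra. Qed.

Lemma leb2_rect_lty a b c d : (leb2 (rect a b c d) < +oo)%E.
Proof.
have [ab|ab] := leP a b; have [cd|cd] := leP c d.
- by rewrite leb2_rect// ltry.
all: rewrite rect_ge ?(ltW ab) ?(ltW cd) ?orbT// -(@rect_ge a a c c) ?lexx//.
all: by rewrite leb2_rect// ltry.
Qed.

Lemma rect_sub a b c d a' b' c' d' : a <= a' -> b' <= b -> c <= c' -> d' <= d ->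
  rect a' b' c' d' `<=` rect a b c d.
Proof. by move=> ? ? ? ? x /rectP[] ? ?; apply/rectP; split; lra. Qed.

Lemma rectI a b c d a' b' c' d' : rect a b c d `&` rect a' b' c' d' =
  rect (Num.max a a') (Num.min b b') (Num.max c c') (Num.min d d').
Proof.
apply/seteqP; split => x.
  move=> [/rectP[/andP[h1 h2] /andP[h3 h4]] /rectP[/andP[k1 k2] /andP[k3 k4]]].
  by apply/rectP; rewrite !gt_max !le_min h1 h2 h3 h4 k1 k2 k3 k4.
move/rectP; rewrite !gt_max !le_min => -[/andP[/andP[h1 k1] /andP[h2 k2]] /andP[/andP[h3 k3] /andP[h4 k4]]].
by split; apply/rectP; rewrite ?h1 ?h2 ?h3 ?h4 ?k1 ?k2 ?k3 ?k4.
Qed.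

Lemma measurable_fst : measurable_fun setT (fst : R * R -> R).
Proof. exact: measurable_fst. Qed.

(** The pi-lambda theorem, applied in each coordinate and then in the product, extends
    the vanishing of the integrals from rectangles to all measurable sets. *)
Lemma ae_zero_full (a b c d : R) g : a < b -> c < d -> ig leb2 (rect a b c d) g ->
  (forall a' b' c' d', a <= a' -> a' < b' -> b' <= b -> c <= c' -> c' < d' -> d' <= d ->
     \int[leb2]_(x in rect a' b' c' d') g x = 0) ->
  {ae leb2, forall x, rect a b c d x -> g x = 0}.
Proof.
move=> ab cd igg H; set D := rect a b c d in igg *.
have mD : pmeasurable D by exact: measurable_rect.
have HI a' b' c' d' : \int[leb2]_(x in D `&` rect a' b' c' d') g x = 0.
  rewrite rectI; have [h|] := boolP ((Num.min b b' <= Num.max a a') || (Num.min d d' <= Num.max c c')).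
    by rewrite rect_ge// Rintegral_set0.
  rewrite negb_or -!ltNge => /andP[h1 h2]; apply: H => //;
  by rewrite ?le_max ?ge_min lexx.
have D0 : \int[leb2]_(x in D) g x = 0 by rewrite -[D]setIid HI.
have gen1 (f : R * R -> R) (D' : set (R * R)) : measurable D' -> D' `<=` D ->
    measurable_fun setT f -> \int[leb2]_(x in D') g x = 0 ->
    (forall s t : R, \int[leb2]_(x in D' `&` f @^-1` `]s, t]) g x = 0) ->
    forall A, measurable A -> \int[leb2]_(x in D' `&` f @^-1` A) g x = 0.
  move=> mD' D'D mf D'0 h A mA.
  have igD' : ig leb2 D' g by apply: igS igg.
  have /dynkin_lambda_system L := @dynkin_zero_integral _ _ _ leb2 _ _ D' f g mD' mf igD' D'0.
  have := lambda_system_subset (@ocitvI R) L.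
  case/(_ _ _ A) => //.
  move=> _ [[s t] _ <-]; split => //.
have st1 c' d' A : measurable A -> \int[leb2]_(x in D `&` (A `*` `]c', d'])) g x = 0.
  move=> mA.
  have -> : D `&` (A `*` `]c', d']) = (D `&` snd @^-1` `]c', d']) `&` fst @^-1` A.
    by apply/seteqP; split => x; [move=> [? []]|move=> [[? ?] ?]]; repeat (split; try assumption).
  have E s t : (D `&` snd @^-1` `]c', d']) `&` fst @^-1` `]s, t] = D `&` rect s t c' d'.
    by apply/seteqP; split => x; [move=> [[? ?] ?]|move=> [? []]]; repeat (split; try assumption).
  apply: gen1 mA.
  - apply: measurableI => //; rewrite -[X in measurable X]setTI; exact: measurable_snd.
  - by move=> x [].
  - exact: measurable_fst.
  - rewrite (_ : D `&` _ = D `&` rect a b c' d') ?HI//.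
    by apply/seteqP; split => x [h k]; split => //; [case: h|case: k].
  - by move=> s t; rewrite E.
have st2 A B : measurable A -> measurable B -> \int[leb2]_(x in D `&` (A `*` B)) g x = 0.
  move=> mA mB.
  have -> : D `&` (A `*` B) = (D `&` fst @^-1` A) `&` snd @^-1` B.
    by apply/seteqP; split => x; [move=> [? []]|move=> [[? ?] ?]]; repeat (split; try assumption).
  apply: gen1 mB.
  - apply: measurableI => //; rewrite -[X in measurable X]setTI; exact: measurable_fst.
  - by move=> x [].
  - exact: measurable_snd.
  - rewrite (_ : D `&` _ = D `&` (A `*` `]c, d])) ?st1//.
    by apply/seteqP; split => x [h k]; split => //; [case: h|case: k].
  - move=> s t; rewrite (_ : _ `&` _ = D `&` (A `*` `]s, t])) ?st1//.
    by apply/seteqP; split => x; [move=> [[? ?] ?]|move=> [? []]]; repeat (split; try assumption).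
have st3 X : measurable X -> \int[leb2]_(x in D `&` X) g x = 0.
  have /dynkin_lambda_system L := @dynkin_zero_integral _ _ _ leb2 _ _ D id g (measurable_rect _ _ _ _) (@measurable_id _ _ _) igg D0.
  rewrite measurable_prod_measurableType => mX.
  have := lambda_system_subset _ L.
  move=> /(_ [set A `*` B | A in measurable & B in measurable]) h.
  have [] := h _ _ _ X mX => //.
  - move=> _ _ [A mA [B mB <-]] [A' mA' [B' mB' <-]].
    exists (A `&` A'); first exact: measurableI.
    by exists (B `&` B'); [exact: measurableI|rewrite setXI].
  - move=> _ [A mA [B mB <-]]; split; first exact: measurableX.
    exact: st2.
have : ae_eq leb2 D (EFin \o g) (cst 0%E).
  apply: integral_ae_eq => // E ED mE; rewrite integral0 ig_fin//; last by apply: igS igg.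
  by rewrite -(setIidr ED) st3.
by apply: filterS => x h' /h' [].
Qed.

(** Corners in a dense set of grid points suffice: approach each side of a rectangle
    from the right, and use dominated convergence. *)
Lemma ae_zero (D1 D2 : set R) (a b c d : R) g : a < b -> c < d -> ig leb2 (rect a b c d) g ->
  (forall s e, a <= s -> s <= b -> 0 < e -> exists p, [/\ D1 p, s <= p, p <= b & p <= s + e]) ->
  (forall s e, c <= s -> s <= d -> 0 < e -> exists p, [/\ D2 p, s <= p, p <= d & p <= s + e]) ->
  (forall p p' q q', D1 p -> D1 p' -> D2 q -> D2 q' -> a <= p -> p < p' -> p' <= b ->
     c <= q -> q < q' -> q' <= d -> \int[leb2]_(x in rect p p' q q') g x = 0) ->
  {ae leb2, forall x, rect a b c d x -> g x = 0}.
Proof.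
move=> ab cd igg d1 d2 H; apply: ae_zero_full => // a' b' c' d' aa ab' bb cc cd' dd.
have app (DD : set R) (l u s : R) : (forall s e, l <= s -> s <= u -> 0 < e ->
     exists p, [/\ DD p, s <= p, p <= u & p <= s + e]) -> l <= s -> s <= u ->
     exists p : nat -> R, [/\ forall n, DD (p n), forall n, s <= p n, forall n, p n <= u &
       p @ \oo --> s].
  move=> dn ls su.
  have /choice[p hp] : forall n, exists p, [/\ DD p, s <= p, p <= u & p <= s + n.+1%:R^-1].
    by move=> n; apply: dn => //; rewrite invr_gt0.
  exists p; split; [by move=> n; case: (hp n)..|].
  apply: (@squeeze_cvgr _ _ _ _ (fun=> s) (fun n => s + n.+1%:R^-1)).
  - by apply: nearW => n; case: (hp n) => _ -> _ ->.
  - exact: cvg_cst.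
  - rewrite -[X in _ --> X]addr0; apply: cvgD; first exact: cvg_cst.
    exact: cvg_harmonic.
have [pa [ha1 ha2 ha3 ha4]] := app D1 a b a' d1 aa (ltW (lt_le_trans ab' bb)).
have [pb [hb1 hb2 hb3 hb4]] := app D1 a b b' d1 (le_trans aa (ltW ab')) bb.
have [pc [hc1 hc2 hc3 hc4]] := app D2 c d c' d2 cc (ltW (lt_le_trans cd' dd)).
have [pd [hd1 hd2 hd3 hd4]] := app D2 c d d' d2 (le_trans cc (ltW cd')) dd.
pose D := rect a b c d; pose Rn n := rect (pa n) (pb n) (pc n) (pd n).
have RnD n : Rn n `<=` D.
  by apply: rect_sub => //; [exact: le_trans (ha2 n)|exact: le_trans (hc2 n)].
have RD : rect a' b' c' d' `<=` D by exact: rect_sub.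
have Rn0 n : \int[leb2]_(x in Rn n) g x = 0.
  have [h|] := boolP ((pb n <= pa n) || (pd n <= pc n)).
    by rewrite /Rn rect_ge// Rintegral_set0.
  rewrite negb_or -!ltNge => /andP[h1 h2]; apply: H => //.
  - exact: le_trans (ha2 n).
  - exact: le_trans (hc2 n).
have side (p : nat -> R) (s y : R) : (forall n, s <= p n) -> p @ \oo --> s ->
    \forall n \near \oo, (p n < y) = (s < y).
  move=> sp ps; have [sy|ys] := ltP s y.
    have e0 : 0 < y - s by rewrite subr_gt0.
    move: ps => /cvgrPdist_lt /(_ _ e0); apply: filterS => n.
    by rewrite ltr_norml => /andP[h _]; apply/idP; lra.
  by apply: nearW => n; apply/negbTE; rewrite -leNgt; exact: le_trans (sp n).
have : (fun n => \int[leb2]_(x in D) (g x * \1_(Rn n) x)) @ \oo -->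
    \int[leb2]_(x in D) (g x * \1_(rect a' b' c' d') x).
  have mg := ig_meas igg.
  apply: (@dct _ _ _ leb2 D _ _ (fun x => `|g x|)) => //.
  - exact: measurable_rect.
  - by move=> n; apply: measurable_funM => //; apply: measurable_indic; exact: measurable_rect.
  - by apply: measurable_funM => //; apply: measurable_indic; exact: measurable_rect.
  - apply: aeW => x Dx; apply: cvg_near_cst.
    have sa := side _ _ x.1 ha2 ha4; have sb := side _ _ x.1 hb2 hb4.
    have sc := side _ _ x.2 hc2 hc4; have sd := side _ _ x.2 hd2 hd4.
    near=> n; congr (_ * _); rewrite !indicE; congr ((_ : bool)%:R).
    have na : (pa n < x.1) = (a' < x.1) by near: n.
    have nb : (pb n < x.1) = (b' < x.1) by near: n.
    have nc : (pc n < x.2) = (c' < x.2) by near: n.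
    have nd : (pd n < x.2) = (d' < x.2) by near: n.
    apply/idP/idP => /set_mem/rectP h; apply/mem_set/rectP; move: h.
      by rewrite na nc ![_ <= pb n]leNgt ![_ <= pd n]leNgt nb nd -!leNgt.
    by rewrite -na -nc ![_ <= b']leNgt ![_ <= d']leNgt -nb -nd -!leNgt.
  - exact: ig_norm.
  - move=> n x _; rewrite normrM ler_piMr// indicE; by case: (_ \in _); rewrite ?normr1 ?normr0.
rewrite (_ : (fun n => _) = (fun=> 0)); last first.
  by apply/funext => n; rewrite -RintegralT (setIidr (RnD n)) Rn0.
rewrite -RintegralT (setIidr RD) => h.
have := cvg_unique _ h (cvg_cst 0); exact.
Unshelve. all: by end_near. Qed.

Lemma Rint_cst_rect (a b c d r : R) : a <= b -> c <= d ->
  \int[leb2]_(x in rect a b c d) r = r * ((b - a) * (d - c)).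
Proof.
move=> ab cd; transitivity (r * fine (leb2 (rect a b c d))).
  by apply: Rintegral_cst; exact: measurable_rect.
by rewrite leb2_rect.
Qed.

Lemma aeS (P P' : R * R -> Prop) : (forall x, P x -> P' x) ->
  {ae leb2, forall x, P x} -> {ae leb2, forall x, P' x}.
Proof. by move=> h [N [mN N0 sN]]; exists N; split => // x /= h'; apply: sN => /h. Qed.

End Rectangles.
#[global] Hint Resolve measurable_rect : core.

(** * Step functions on dyadic grids *)

Section Grids.
Context {R : realType}.
Implicit Types (u f g : R * R -> R).
Local Notation mu := (@leb2 R).

Lemma Rint_splitx a b e c d f : a <= b -> b <= e -> ig mu (rect a e c d) f ->
  \int[mu]_(x in rect a e c d) f x = \int[mu]_(x in rect a b c d) f x + \int[mu]_(x in rect b e c d) f x.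
Proof.
move=> ab be h.
have E : rect a e c d = rect a b c d `|` rect b e c d.
  apply/seteqP; split => x.
    move=> /rectP[h1 h2]; have [xb|xb] := leP x.1 b; [left|right]; apply/rectP; split => //; lra.
  by move=> [] /rectP[h1 h2]; apply/rectP; split => //; lra.
rewrite E Rintegral_setU; [by []|exact: measurable_rect|exact: measurable_rect|by rewrite -E|].
by apply/disj_setPS => x [/rectP[? _] /rectP[? _]]; lra.
Qed.

Lemma Rint_splity a b c e d f : c <= e -> e <= d -> ig mu (rect a b c d) f ->
  \int[mu]_(x in rect a b c d) f x = \int[mu]_(x in rect a b c e) f x + \int[mu]_(x in rect a b e d) f x.
Proof.
move=> ab be h.
have E : rect a b c d = rect a b c e `|` rect a b e d.
  apply/seteqP; split => x.
    move=> /rectP[h1 h2]; have [xb|xb] := leP x.2 e; [left|right]; apply/rectP; split => //; lra.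
  by move=> [] /rectP[h1 h2]; apply/rectP; split => //; lra.
rewrite E Rintegral_setU; [by []|exact: measurable_rect|exact: measurable_rect|by rewrite -E|].
by apply/disj_setPS => x [/rectP[_ ?] /rectP[_ ?]]; lra.
Qed.

Lemma ig_rect_sub a b c d a' b' c' d' f : a <= a' -> b' <= b -> c <= c' -> d' <= d ->
  ig mu (rect a b c d) f -> ig mu (rect a' b' c' d') f.
Proof. by move=> h1 h2 h3 h4 h; exact: (igS (measurable_rect _ _ _ _) (measurable_rect _ _ _ _) (rect_sub h1 h2 h3 h4) h). Qed.

Lemma homo_leS (p : nat -> R) : (forall i, p i <= p i.+1) -> forall i j, (i <= j)%N -> p i <= p j.
Proof.
move=> hp i; elim=> [|j IH]; first by rewrite leqn0 => /eqP ->.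
by rewrite leq_eqVlt => /predU1P[->//|/IH h]; exact: le_trans h (hp j).
Qed.

Lemma Rint_grid (p q : nat -> R) n m f : (forall i, p i <= p i.+1) -> (forall i, q i <= q i.+1) ->
  ig mu (rect (p 0%N) (p n) (q 0%N) (q m)) f ->
  \int[mu]_(x in rect (p 0%N) (p n) (q 0%N) (q m)) f x =
  \sum_(i < n) \sum_(j < m) \int[mu]_(x in rect (p i) (p i.+1) (q j) (q j.+1)) f x.
Proof.
move=> hp hq; have mp := homo_leS hp; have mq := homo_leS hq.
elim: n => [|n IH] h.
  by rewrite big_ord0 rect_ge ?lexx// Rintegral_set0.
rewrite big_ord_recr /= -IH; last by apply: ig_rect_sub h => //; exact: mp.
rewrite (Rint_splitx (mp _ _ (leq0n n)) (hp n) h).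
congr (_ + _).
have : ig mu (rect (p n) (p n.+1) (q 0%N) (q m)) f by apply: ig_rect_sub h => //; exact: mp.
elim: m {IH h} => [|m IH] h.
  by rewrite big_ord0 rect_ge ?lexx ?orbT// Rintegral_set0.
rewrite big_ord_recr /= -IH; last by apply: ig_rect_sub h => //; exact: mq.
by rewrite (Rint_splity (mq _ _ (leq0n m)) (hq m) h).
Qed.

Definition pt (a b : R) (k i : nat) : R := a + (b - a) * (i%:R / 2 ^+ k).

Lemma pt0 a b k : pt a b k 0 = a.
Proof. by rewrite /pt mul0r mulr0 addr0. Qed.

Lemma pt_max a b k : pt a b k (2 ^ k) = b.
Proof. by rewrite /pt natrX divff ?expf_neq0// mulr1 addrC subrK. Qed.

Lemma ptS a b k i : pt a b k i.+1 = pt a b k i + (b - a) / 2 ^+ k.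
Proof. by rewrite /pt -[i.+1%:R]natr1; ring. Qed.

Lemma pt_le a b k i j : a <= b -> (i <= j)%N -> pt a b k i <= pt a b k j.
Proof.
move=> ab ij; rewrite lerD2l ler_wpM2l ?subr_ge0// ler_wpM2r ?invr_ge0 ?exprn_ge0//.
by rewrite ler_nat.
Qed.

Lemma pt_lt a b k i j : a < b -> (pt a b k i < pt a b k j) = (i < j)%N.
Proof.
by move=> ab; rewrite ltrD2l ltr_pM2l ?subr_gt0// ltr_pM2r ?invr_gt0 ?exprn_gt0// ltr_nat.
Qed.

Lemma ptD a b k m i : pt a b (k + m) (i * 2 ^ m) = pt a b k i.
Proof. by rewrite /pt natrM natrX exprD -mulf_div divff ?expf_neq0// mulr1. Qed.

Lemma pt_double a b k i : pt a b k.+1 (i.*2) = pt a b k i.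
Proof. by rewrite -addn1 -muln2 -[X in (i * X)%N]expn1 ptD. Qed.

Variables (a b c d : R).
Hypotheses (ab : a < b) (cd : c < d).

Local Notation px := (pt a b).
Local Notation py := (pt c d).
Let Q := rect a b c d.
Let mQ : pmeasurable Q. Proof. exact: measurable_rect. Qed.
Let Qy : (leb2 Q < +oo)%E. Proof. exact: leb2_rect_lty. Qed.
Definition cell k i j := rect (px k i) (px k i.+1) (py k j) (py k j.+1).
Definition cell_area k : R := ((b - a) / 2 ^+ k) * ((d - c) / 2 ^+ k).
Definition step k u x : R :=
  \sum_(i < 2 ^ k) \sum_(j < 2 ^ k) (\int[mu]_(y in cell k i j) u y / cell_area k) * \1_(cell k i j) x.

Lemma cell_area_gt0 k : 0 < cell_area k.
Proof. by rewrite mulr_gt0 ?divr_gt0 ?subr_gt0 ?exprn_gt0. Qed.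

Lemma Rint_cst_cell k i j r : \int[mu]_(x in cell k i j) r = r * cell_area k.
Proof.
rewrite Rint_cst_rect ?pt_le ?(ltW ab) ?(ltW cd)//.
by congr (_ * _); rewrite !ptS /cell_area; congr (_ * _); ring.
Qed.

Lemma cell_sub k i j : (i < 2 ^ k)%N -> (j < 2 ^ k)%N -> cell k i j `<=` Q.
Proof.
move=> ik jk; apply: rect_sub.
- by rewrite -[leLHS](pt0 a b k) pt_le ?(ltW ab).
- by rewrite -[leRHS](pt_max a b k) pt_le ?(ltW ab).
- by rewrite -[leLHS](pt0 c d k) pt_le ?(ltW cd).
- by rewrite -[leRHS](pt_max c d k) pt_le ?(ltW cd).
Qed.

Lemma Rint_cells k f : ig mu Q f ->
  \int[mu]_(x in Q) f x = \sum_(i < 2 ^ k) \sum_(j < 2 ^ k) \int[mu]_(x in cell k i j) f x.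
Proof.
move=> h; have := @Rint_grid (px k) (py k) (2 ^ k) (2 ^ k) f.
rewrite !pt0 !pt_max; apply => // i; by rewrite pt_le ?(ltW ab) ?(ltW cd).
Qed.

Lemma step_cell k u (i j : 'I_(2 ^ k)) x : cell k i j x ->
  step k u x = \int[mu]_(y in cell k i j) u y / cell_area k.
Proof.
move=> cx; rewrite /step (bigD1 i)//= (bigD1 j)//= indicE mem_set// mulr1.
have lt_irr (p : nat -> R) (m n : nat) (y : R) : (forall m n, (m <= n)%N -> p m <= p n) ->
    p m < y <= p m.+1 -> p n < y <= p n.+1 -> m = n.
  move=> mp /andP[h1 h2] /andP[h3 h4]; apply/eqP; rewrite eqn_leq; apply/andP; split.
    by rewrite leqNgt; apply/negP => /mp h; lra.
  by rewrite leqNgt; apply/negP => /mp h; lra.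
have other (i' j' : 'I_(2 ^ k)) : (i' != i) || (j' != j) -> \1_(cell k i' j') x = 0 :> R.
  move=> ne; rewrite indicE memNset// => /rectP[h1 h2]; move/rectP: cx => [g1 g2].
  move: ne; rewrite -!val_eqE /=.
  rewrite (lt_irr _ _ _ _ _ h1 g1); last by move=> *; rewrite pt_le ?(ltW ab).
  by rewrite (lt_irr _ _ _ _ _ h2 g2) ?eqxx//; move=> *; rewrite pt_le ?(ltW cd).
rewrite [X in _ + X + _]big1 ?[X in _ + X]big1 ?addr0//.
  by move=> i' ne; apply: big1 => j' _; rewrite other ?ne// mulr0.
by move=> j' ne; rewrite other ?ne ?orbT// mulr0.
Qed.

Lemma sqi_sum A (I : Type) (r : seq I) (F : I -> R * R -> R) : pmeasurable A -> (mu A < +oo)%E ->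
  (forall i, sqi mu A (F i)) -> sqi mu A (fun x => \sum_(i <- r) F i x).
Proof.
move=> mA Ay h; elim: r => [|i r IH].
  by apply: sqi_ext (sqi_cst 0 mA Ay) => // x _; rewrite big_nil.
by apply: sqi_ext (sqiD mA (h i) IH) => // x _; rewrite big_cons.
Qed.

Lemma sqi_indic A B : pmeasurable A -> (mu A < +oo)%E -> pmeasurable B ->
  sqi mu A (\1_B : R * R -> R).
Proof.
move=> mA Ay mB; apply: (@sqi_le _ _ _ _ _ _ (cst 1)) => //; last exact: ig_cst.
by move=> x _; rewrite indicE; case: (_ \in _); rewrite ?expr1n ?expr0n.
Qed.

Lemma sqi_step k u : sqi mu Q (step k u).
Proof.
apply: sqi_sum => // i; apply: sqi_sum => // j.
by apply: sqiZ => //; apply: sqi_indic => //; exact: measurable_rect.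
Qed.

Lemma Rint_step_cell k u (i j : 'I_(2 ^ k)) :
  \int[mu]_(x in cell k i j) step k u x = \int[mu]_(x in cell k i j) u x.
Proof.
rewrite (@eq_Rintegral _ _ _ _ _ (cst (\int[mu]_(y in cell k i j) u y / cell_area k))); last first.
  by move=> x /set_mem /step_cell ->.
by rewrite Rint_cst_cell divfK// gt_eqF// cell_area_gt0.
Qed.

Lemma n2_step k u : n2 mu Q (step k u) =
  \sum_(i < 2 ^ k) \sum_(j < 2 ^ k) (\int[mu]_(x in cell k i j) u x) ^+ 2 / cell_area k.
Proof.
rewrite /n2 (@Rint_cells k); last by case: (sqi_step k u).
apply: eq_bigr => i _; apply: eq_bigr => j _.
rewrite (@eq_Rintegral _ _ _ _ _ (cst ((\int[mu]_(y in cell k i j) u y / cell_area k) ^+ 2))); last first.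
  by move=> x /set_mem /step_cell ->.
rewrite Rint_cst_cell.
by field; rewrite gt_eqF// cell_area_gt0.
Qed.

Lemma cell_split k i j f : (i < 2 ^ k)%N -> (j < 2 ^ k)%N -> ig mu Q f ->
  \int[mu]_(x in cell k i j) f x =
  \sum_(i' < 2) \sum_(j' < 2) \int[mu]_(x in cell k.+1 (i.*2 + i') (j.*2 + j')) f x.
Proof.
move=> ik jk h.
have := @Rint_grid (fun n => px k.+1 (i.*2 + n)) (fun n => py k.+1 (j.*2 + n)) 2 2 f.
rewrite /= !addn0 !addn2 -!doubleS !pt_double => -> //.
- by apply: eq_bigr => i' _; apply: eq_bigr => j' _; rewrite /cell !addnS.
- by move=> n; rewrite pt_le ?(ltW ab)// addnS.
- by move=> n; rewrite pt_le ?(ltW cd)// addnS.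
- by rewrite -[X in ig _ X]/(cell k i j); apply: (igS mQ _ _ h); [exact: measurable_rect|exact: cell_sub].
Qed.

(** By downward induction on the level: each cell is the union of four cells of the
    next level. *)
Lemma Rint_step_cell_le k m u : sqi mu Q u -> forall i j, (i < 2 ^ k)%N -> (j < 2 ^ k)%N ->
  \int[mu]_(x in cell k i j) step (k + m) u x = \int[mu]_(x in cell k i j) u x.
Proof.
move=> su; have iu : ig mu Q u by exact: sqi_ig su.
have is' n : ig mu Q (step n u) by exact: sqi_ig (sqi_step n u).
elim: m k => [|m IH] k i j ik jk.
  by rewrite addn0; exact: (Rint_step_cell u (Ordinal ik) (Ordinal jk)).
rewrite !cell_split//; apply: eq_bigr => i' _; apply: eq_bigr => j' _.
rewrite addnS -addSn IH// expnS; case: i' j' => [i' ?] [j' ?] /=; lia.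
Qed.

Lemma pt_dense (l r : R) s e : l < r -> l <= s -> s <= r -> 0 < e ->
  exists k i, [/\ (i <= 2 ^ k)%N, s <= pt l r k i & pt l r k i <= s + e].
Proof.
move=> lr ls sr e0.
have [k hk] : exists k, (r - l) / 2 ^+ k <= e.
  have [k hk] : exists k : nat, (r - l) / e < k%:R.
    by exists (Num.Def.archi_bound ((r - l) / e)); apply: archi_boundP; rewrite divr_ge0 ?subr_ge0 ?(ltW lr) ?(ltW e0).
  exists k; rewrite ler_pdivrMr ?exprn_gt0// mulrC -ler_pdivrMr//.
  by rewrite (le_trans (ltW hk))// -natrX ler_nat ltnW// ltn_expl.
have ex : exists i, s <= pt l r k i by exists (2 ^ k)%N; rewrite pt_max.
case: (ex_minnP ex) => i si imin; exists k, i; split => //.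
  by apply: imin; rewrite pt_max.
case: i si imin => [|i] si imin; first by rewrite pt0; lra.
have : ~~ (s <= pt l r k i) by apply/negP => /imin; rewrite ltnn.
by rewrite -ltNge ptS; lra.
Qed.

(** The step functions converge weakly to [u], so that [u] inherits a bound on their
    norms. *)
Lemma dyadic_n2_le u C : sqi mu Q u ->
  (forall k, \sum_(i < 2 ^ k) \sum_(j < 2 ^ k)
     (\int[mu]_(x in cell k i j) u x) ^+ 2 / cell_area k <= C) ->
  n2 mu Q u <= C.
Proof.
move=> su hC.
have [] := @weak_compactness _ _ _ mu Q (fun k => step k u) C mQ (fun k => sqi_step k u).
  by move=> e e0; exists 0%N => n _; rewrite n2_step (le_trans (hC n))// lerDl ltW.
move=> v [sv vC hv].
have iu : ig mu Q u by exact: sqi_ig su.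
have iv : ig mu Q v by exact: sqi_ig sv.
have eqc k i j : (i < 2 ^ k)%N -> (j < 2 ^ k)%N ->
    \int[mu]_(x in cell k i j) v x = \int[mu]_(x in cell k i j) u x.
  move=> ik jk; have cQ := cell_sub ik jk.
  rewrite -(setIidr cQ) RintegralT; apply: hv.
    by apply: sqi_indic => //; exact: measurable_rect.
  apply: cvg_near_cst; exists k => // n /= kn.
  rewrite -RintegralT (setIidr cQ) -(subnKC kn) Rint_step_cell_le//.
suff : {ae mu, forall x, Q x -> v x - u x = 0}.
  move=> ae0; rewrite (le_trans _ vC)// le_eqVlt; apply/orP; left; apply/eqP.
  apply: ae_n2_eq => //; [by case: su|by case: sv|].
  by apply: aeS ae0 => x h /h /eqP; rewrite subr_eq0 => /eqP.
pose DD (l r : R) := [set y | exists k i, (i <= 2 ^ k)%N /\ y = pt l r k i].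
apply: (@ae_zero _ (DD a b) (DD c d)) => //.
- exact: igB.
- move=> s e as_ sb e0; have [k [i [ik h1 h2]]] := pt_dense ab as_ sb e0.
  exists (px k i); split => //; first by exists k, i.
  by rewrite -[leRHS](pt_max a b k) pt_le// ltW.
- move=> s e as_ sb e0; have [k [i [ik h1 h2]]] := pt_dense cd as_ sb e0.
  exists (py k i); split => //; first by exists k, i.
  by rewrite -[leRHS](pt_max c d k) pt_le// ltW.
move=> _ _ _ _ [k1 [i1 [ik1 ->]]] [k2 [i2 [ik2 ->]]] [k3 [i3 [ik3 ->]]] [k4 [i4 [ik4 ->]]].
(* Corners of four different levels are grid points of a common finer level. *)
pose K := (k1 + k2 + k3 + k4)%N.
have lift l r k i : (k <= K)%N -> (i <= 2 ^ k)%N -> exists2 i', (i' <= 2 ^ K)%N & pt l r k i = pt l r K i'.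
  move=> kK ik; exists (i * 2 ^ (K - k))%N; last by rewrite -[in RHS](subnKC kK) addKn ptD.
  by rewrite -{2}(subnKC kK) expnD leq_mul2r ik orbT.
have [|j1 h1 ->] := lift a b _ _ _ ik1; first by rewrite /K; lia.
have [|j2 h2 ->] := lift a b _ _ _ ik2; first by rewrite /K; lia.
have [|j3 h3 ->] := lift c d _ _ _ ik3; first by rewrite /K; lia.
have [|j4 h4 ->] := lift c d _ _ _ ik4; first by rewrite /K; lia.
move=> _; rewrite pt_lt// => j12 _ _; rewrite pt_lt// => j34 _.
have iuv : ig mu Q (fun x => v x - u x) by exact: igB.
have sub : rect (px K j1) (px K j2) (py K j3) (py K j4) `<=` Q.
  apply: rect_sub.
  - by rewrite -[leLHS](pt0 a b K) pt_le ?(ltW ab).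
  - by rewrite -[leRHS](pt_max a b K) pt_le ?(ltW ab).
  - by rewrite -[leLHS](pt0 c d K) pt_le ?(ltW cd).
  - by rewrite -[leRHS](pt_max c d K) pt_le ?(ltW cd).
have := @Rint_grid (fun n => px K (j1 + n)) (fun n => py K (j3 + n)) (j2 - j1) (j4 - j3) (fun x => v x - u x).
rewrite /= !addn0 !subnKC ?(ltnW j12) ?(ltnW j34)// => -> //.
- apply: big1 => -[i /= hi] _; apply: big1 => -[j /= hj] _.
  rewrite !addnS -/(cell K (j1 + i) (j3 + j)).
  have c1 : (j1 + i < 2 ^ K)%N by rewrite ltn_subRL in hi; exact: leq_trans hi h2.
  have c2 : (j3 + j < 2 ^ K)%N by rewrite ltn_subRL in hj; exact: leq_trans hj h4.
  have cQ := cell_sub c1 c2.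
  have mc : pmeasurable (cell K (j1 + i) (j3 + j)) by exact: measurable_rect.
  by rewrite RintegralB ?eqc ?subrr//; [apply: igS iv|apply: igS iu].
- by move=> n; rewrite pt_le ?(ltW ab)// addnS.
- by move=> n; rewrite pt_le ?(ltW cd)// addnS.
- by apply: igS iuv => //; exact: measurable_rect.
Qed.

End Grids.

(** * Test functions *)

Section Smooth1.
Context {R : realType}.
Implicit Types (f g : R -> R).

Fixpoint Ck (n : nat) f : Prop :=
  (forall x, derivable f x 1) /\ (if n is m.+1 then Ck m (derive1 f) else True).

Definition smooth1 f := forall n, Ck n f.

Lemma smooth1_derivable f x : smooth1 f -> derivable f x 1.
Proof. by move=> /(_ 0%N)[]. Qed.

Lemma smooth1_derive f : smooth1 f -> smooth1 (derive1 f).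
Proof. by move=> h n; have [] := h n.+1. Qed.

Lemma smooth1_is_derive f (x : R) : smooth1 f -> is_derive x 1 f (derive1 f x).
Proof. by move=> h; apply: DeriveDef; [exact: smooth1_derivable|rewrite derive1E]. Qed.

Lemma is_derive_derive1 f (df : R -> R) : (forall x : R, is_derive x 1 f (df x)) -> derive1 f = df.
Proof. by move=> h; apply/funext => x; rewrite derive1E; have := h x; move=> ?; exact: derive_val. Qed.

Lemma smooth1_continuous f : smooth1 f -> continuous f.
Proof. by move=> h x; apply/differentiable_continuous/derivable1_diffP/smooth1_derivable. Qed.

Lemma CkS n f : Ck n.+1 f -> Ck n f.
Proof. by elim: n f => [|n IH] f [h1 h2]; split => //; exact: IH. Qed.

Lemma Ck_is_derive n f (df : R -> R) : (forall x : R, is_derive x 1 f (df x)) -> Ck n df -> Ck n.+1 f.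
Proof. by move=> h hdf; split => [x|]; [case: (h x)|rewrite (is_derive_derive1 h)]. Qed.

Lemma CkD n f g : Ck n f -> Ck n g -> Ck n (fun x => f x + g x).
Proof.
elim: n f g => [|n IH] f g [h1 h2] [k1 k2].
  by split; [move=> x; exact: (derivableD (h1 x) (k1 x))|].
apply: (@Ck_is_derive _ _ (fun x => derive1 f x + derive1 g x)); last exact: IH.
move=> x; rewrite !derive1E; apply: DeriveDef; first exact: (derivableD (h1 x) (k1 x)).
by rewrite (deriveD (h1 x) (k1 x)).
Qed.

Lemma CkM n f g : Ck n f -> Ck n g -> Ck n (fun x => f x * g x).
Proof.
elim: n f g => [|n IH] f g [h1 h2] [k1 k2].
  by split; [move=> x; exact: (derivableM (h1 x) (k1 x))|].
apply: (@Ck_is_derive _ _ (fun x => f x * derive1 g x + g x * derive1 f x)).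
  move=> x; rewrite !derive1E; apply: DeriveDef; first exact: (derivableM (h1 x) (k1 x)).
  by rewrite (deriveM (h1 x) (k1 x)).
by apply: CkD; apply: IH => //; apply: CkS; split.
Qed.

Lemma Ck_cst n (k : R) : Ck n (cst k).
Proof.
elim: n k => [|n IH] k; first by split => // x; exact: derivable_cst.
by apply: (@Ck_is_derive _ _ (cst 0)) => // x; exact: is_derive_cst.
Qed.

Lemma smooth1D f g : smooth1 f -> smooth1 g -> smooth1 (fun x => f x + g x).
Proof. by move=> h k n; exact: CkD. Qed.

Lemma smooth1M f g : smooth1 f -> smooth1 g -> smooth1 (fun x => f x * g x).
Proof. by move=> h k n; exact: CkM. Qed.

Lemma smooth1Z k f : smooth1 f -> smooth1 (fun x => k * f x).
Proof. by move=> h n; apply: CkM => //; exact: Ck_cst. Qed.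

Lemma Ck_affine n f (s t : R) : Ck n f -> Ck n (fun x => f (s * x + t)).
Proof.
have D (y : R) : is_derive y 1 (fun x => s * x + t) s.
  have h := @is_deriveD _ _ _ (s *: (id : R -> R)) (cst t) y 1 _ _
    (@is_deriveZ _ _ _ _ s y 1 _ (is_derive_id y 1)) (is_derive_cst t y 1).
  by apply: (is_derive_eq h); rewrite addr0 [s *: 1]mulr1.
elim: n f => [|n IH] f [h1 h2].
  split; [move=> x|by []]; have hd : is_derive (s * x + t) 1 f ('D_1 f (s * x + t)).
    by apply: DeriveDef.
  by case: (@is_derive1_comp _ f (fun x => s * x + t) x _ _ hd (D x)).
apply: (@Ck_is_derive _ _ (fun x => derive1 f (s * x + t) * s)).
  move=> x; have hd : is_derive (s * x + t) 1 f (derive1 f (s * x + t)).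
    by apply: DeriveDef; rewrite ?derive1E.
  exact: (@is_derive1_comp _ f (fun x => s * x + t) x _ _ hd (D x)).
by apply: CkM; [exact: IH|exact: Ck_cst].
Qed.

(** The derivatives of [x |-> exp (- c / x)] on the positive half-line are combinations
    of these functions. *)
Definition flat (c : R) (m : nat) (x : R) : R :=
  if 0 < x then (x^-1) ^+ m * expR (- (c * x^-1)) else 0.

Lemma flat_le c m x : 0 < c -> 0 < x -> flat c m x <= (m.+2`!)%:R / c ^+ m.+2 * x ^+ 2.
Proof.
move=> c0 x0; rewrite /flat x0 expRN.
set t := c * x^-1; have t0 : 0 < t by rewrite mulr_gt0 ?invr_gt0.
have := expR_ge1Dxn m.+1 (ltW t0) => h.
have h' : t ^+ m.+2 / (m.+2)`!%:R <= expR t by lra.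
rewrite ler_pdivrMr ?expR_gt0//.
have fp : 0 < (m.+2)`!%:R :> R by rewrite ltr0n fact_gt0.
apply: (@le_trans _ _ ((m.+2)`!%:R / c ^+ m.+2 * x ^+ 2 * (t ^+ m.+2 / (m.+2)`!%:R))); last first.
  by rewrite ler_wpM2l// mulr_ge0 ?exprn_ge0 ?(ltW x0)// divr_ge0 ?exprn_ge0 ?(ltW c0)// ltW.
rewrite le_eqVlt; apply/orP; left; apply/eqP.
have E : x^-1 ^+ m.+2 = x^-1 ^+ m * x ^- 2 by rewrite -exprVn -exprD addn2.
have C0 : c ^+ m.+2 != 0 by rewrite expf_neq0 ?gt_eqF.
rewrite /t exprMn E; set F := _%:R in fp *; set C := c ^+ _ in C0 *; set V := x^-1 ^+ m.
by field; rewrite C0 !gt_eqF.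
Qed.

Lemma flat_ge0 c m x : 0 <= flat c m x.
Proof.
rewrite /flat; case: ifPn => // x0; apply: mulr_ge0; last exact: expR_ge0.
by rewrite exprn_ge0// invr_ge0 ltW.
Qed.

Lemma is_derive_quadratic f (C : R) : (forall x, `|f x| <= C * x ^+ 2) -> is_derive (0 : R) 1 f 0.
Proof.
move=> hf; have f0 : f 0 = 0.
  by have := hf 0; rewrite expr0n mulr0 normr_le0 => /eqP.
have C0 : 0 <= C by have := hf 1; rewrite expr1n mulr1; apply: le_trans.
have h : (fun h : R => h^-1 *: (f (h *: 1 + 0) - f 0)) @ 0^' --> (0 : R).
  apply/cvgrPdist_le => e e0.
  have d0 : 0 < e / (C + 1) by rewrite divr_gt0// ltr_pwDr.
  near=> t; rewrite sub0r normrN f0 subr0 addr0 normrZ [t *: 1]mulr1.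
  have t0 : t != 0 by near: t; exact: nbhs_dnbhs_neq.
  rewrite normfV mulrC ler_pdivrMr ?normr_gt0//.
  apply: (le_trans (hf t)); rewrite -real_normK ?num_real// expr2 mulrA ler_wpM2r//.
  have : `|t| < e / (C + 1) by near: t; apply: dnbhs0_lt.
  by rewrite ltr_pdivlMr ?ltr_pwDr// => /ltW; apply: le_trans; rewrite mulrC ler_wpM2l// lerDl.
apply: DeriveDef; first by apply/cvg_ex; exists 0.
exact: cvg_lim h.
Unshelve. all: by end_near. Qed.

Lemma is_derive_flat c m (x : R) : 0 < c ->
  is_derive x 1 (flat c m) (c * flat c m.+2 x - m%:R * flat c m.+1 x).
Proof.
move=> c0; have [x0|x0|->] := ltgtP x 0.
- have -> : c * flat c m.+2 x - m%:R * flat c m.+1 x = 0.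
    by rewrite /flat !ltNge (ltW x0) /= !mulr0 subrr.
  have h0 : is_derive x 1 (cst (0 : R)) 0 by exact: is_derive_cst.
  apply: near_eq_is_derive h0; near=> y; rewrite /flat ltNge (_ : y <= 0)//.
  by apply: ltW; near: y; exact: lt_nbhsl.
- have xn0 : x != 0 by rewrite gt_eqF.
  have dV : is_derive x 1 (fun y : R => y^-1) (- x ^- 2).
    by apply: is_derive_eq; [exact: is_deriveV|rewrite [_ *: 1]mulr1].
  have dX : is_derive x 1 (fun y : R => (y^-1) ^+ m) (m%:R * (x^-1) ^+ m.-1 * - x ^- 2).
    rewrite (_ : (fun y : R => y^-1 ^+ m) = (fun y : R => y^-1) ^+ m).
      exact: (@is_deriveX _ _ (fun y : R => y^-1) m x 1 _ dV).
    by apply/funext => y; rewrite exprfctE.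
  have dE : is_derive x 1 (fun y : R => expR (- (c * y^-1))) (expR (- (c * x^-1)) * (c * x ^- 2)).
    apply: (@is_derive1_comp _ expR (fun y => - (c * y^-1))).
    have dZ : is_derive x 1 (fun y : R => c * y^-1) (c * - x ^- 2).
      exact: (@is_deriveZ _ _ _ (fun y : R => y^-1) c x 1 _ dV).
    by apply: (is_derive_eq (is_deriveN dZ)); rewrite mulrN opprK.
  have dM : is_derive x 1 (fun y : R => y^-1 ^+ m * expR (- (c * y^-1)))
      (c * flat c m.+2 x - m%:R * flat c m.+1 x).
    apply: (is_derive_eq (is_deriveM dX dE)).
    rewrite /flat x0 /GRing.scale /=.
    case: m {dX} => [|m] /=; first by rewrite !expr0 mul0r -!exprVn; ring.
    by rewrite -!exprVn !exprS; ring.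
  apply: near_eq_is_derive dM; near=> y.
  by rewrite /flat (_ : 0 < y)//; near: y; exact: lt_nbhsr.
- have -> : c * flat c m.+2 0 - m%:R * flat c m.+1 0 = 0.
    by rewrite /flat ltxx !mulr0 subrr.
  apply: (@is_derive_quadratic _ ((m.+2`!)%:R / c ^+ m.+2)) => y.
  rewrite ger0_norm ?flat_ge0//; have [y0|y0] := ltP 0 y; first exact: flat_le.
  rewrite {1}/flat ltNge y0 /= mulr_ge0 ?sqr_ge0//.
  by rewrite divr_ge0// exprn_ge0// ltW.
Unshelve. all: by end_near. Qed.

Lemma smooth1_flat c m : 0 < c -> smooth1 (flat c m).
Proof.
move=> c0 n; elim: n m => [|n IH] m.
  by split => // x; case: (is_derive_flat m x c0).
apply: (@Ck_is_derive _ _ _ (fun x => is_derive_flat m x c0)).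
rewrite (_ : (fun x => _) = (fun x => cst c x * flat c m.+2 x + cst (- m%:R) x * flat c m.+1 x)).
  by apply: CkD; apply: CkM => //; exact: Ck_cst.
by apply/funext => x; rewrite mulNr.
Qed.

(** Smooth and positive exactly between [a] and [b]. The functions [exp (- c / x)] increase
    to 1 as [c] decreases to 0, so that humps approximate the indicator function of an
    interval from below. *)
Definition hump (a b c x : R) := flat c 0 (x - a) * flat c 0 (b - x).

Lemma smooth1_hump a b c : 0 < c -> smooth1 (hump a b c).
Proof.
move=> c0; apply: smooth1M.
  rewrite (_ : (fun x => _) = (fun x => flat c 0 (1 * x + - a))).
    by move=> n; apply: Ck_affine; exact: smooth1_flat.
  by apply/funext => x; rewrite mul1r.
rewrite (_ : (fun x => _) = (fun x => flat c 0 (-1 * x + b))).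
  by move=> n; apply: Ck_affine; exact: smooth1_flat.
by apply/funext => x; rewrite mulN1r addrC.
Qed.

Lemma flat_le1 c x : 0 < c -> flat c 0 x <= 1.
Proof.
move=> c0; rewrite /flat; case: ifPn => // x0; rewrite mul1r -expR0 ler_expR.
by rewrite oppr_le0 mulr_ge0 ?invr_ge0 ?ltW.
Qed.

Lemma hump_ge0 a b c x : 0 <= hump a b c x.
Proof. by rewrite mulr_ge0 ?flat_ge0. Qed.

Lemma hump_le1 a b c x : 0 < c -> hump a b c x <= 1.
Proof. by move=> c0; rewrite mulr_ile1 ?flat_ge0 ?flat_le1. Qed.

Lemma hump_norm_le1 a b c x : 0 < c -> `|hump a b c x| <= 1.
Proof. by move=> c0; rewrite ger0_norm ?hump_ge0 ?hump_le1. Qed.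

Lemma hump_out a b c x : ~~ (a < x < b) -> hump a b c x = 0.
Proof.
rewrite negb_and -!leNgt /hump /flat => /orP[h|h].
  by rewrite subr_gt0 ltNge h /= mul0r.
by rewrite [X in _ * X]ifF ?mulr0// subr_gt0 ltNge h.
Qed.

Lemma hump_gt0 a b c x : a < x < b -> 0 < hump a b c x.
Proof.
move=> /andP[ax xb]; rewrite /hump /flat !subr_gt0 ax xb !expr0 !mul1r.
by rewrite mulr_gt0 ?expR_gt0.
Qed.

Lemma hump_cvg a b x : a < x < b -> (fun n => hump a b n.+1%:R^-1 x) @ \oo --> (1 : R).
Proof.
move=> /andP[ax xb].
have H (y : R) : 0 < y -> (fun n => flat n.+1%:R^-1 0 y) @ \oo --> (1 : R).
  move=> y0; rewrite /flat y0.
  rewrite (_ : (fun n => _) = (fun n : nat => expR (- (n.+1%:R^-1 * y^-1)))); last first.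
    by apply/funext => n; rewrite expr0 mul1r.
  have h : (fun n : nat => n.+1%:R^-1 * y^-1) @ \oo --> 0 * y^-1.
    by apply: cvgM; [exact: cvg_harmonic|exact: cvg_cst].
  rewrite mul0r in h; have {h} := cvgN h; rewrite oppr0 => h.
  by rewrite -[X in _ --> X]expR0; apply: continuous_cvg; [exact: continuous_expR|exact: h].
rewrite -[X in _ --> X](mul1r 1); apply: cvgM; apply: H; by rewrite subr_gt0.
Qed.

End Smooth1.

Section Primitive.
Context {R : realType}.
Local Notation leb := (@lebesgue_measure R).

Definition mass (a b c : R) : R := \int[leb]_(x in setT) hump a b c x.

Lemma hump_indic (a b c x : R) : 0 < c -> `|hump a b c x| <= \1_(`]a, b[%classic) x.
Proof.
move=> c0; rewrite ger0_norm ?hump_ge0// indicE.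
case: (boolP (a < x < b)) => h; first by rewrite mem_set ?hump_le1//= in_itv.
by rewrite hump_out// ler0n.
Qed.

Lemma measurable_hump (a b c : R) D : 0 < c -> measurable_fun D (hump a b c).
Proof.
move=> c0; apply: measurable_funTS; apply: continuous_measurable_fun.
exact/smooth1_continuous/smooth1_hump.
Qed.

Lemma ig_hump (a b c : R) : 0 < c -> ig leb setT (hump a b c).
Proof.
move=> c0; apply: (@ig_le _ _ _ leb setT _ (\1_(`]a, b[%classic))) => //.
- exact: measurable_hump.
- by move=> x _; exact: hump_indic.
- exact: (integrable_indic_itv a b false true).
Qed.

(** A difference of two such functions is compactly supported, although its derivative is
    a difference of two averaging weights. *)
Lemma hump_primitive (a b c : R) : a < b -> 0 < c -> exists F, [/\ 0 < mass a b c, smooth1 F,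
  forall x, derive1 F x = hump a b c x / mass a b c, forall x, 0 <= F x <= 1 &
  (forall x, x <= a -> F x = 0) /\ (forall x, b <= x -> F x = 1)].
Proof.
move=> ab c0; have ib := ig_hump a b c0; pose h := hump a b c.
pose G x := \int[leb]_(t in [set` Interval -oo%O (BRight x)]) h t.
have mI (x : R) : measurable ([set` Interval -oo%O (BRight x)] : set (measurableTypeR R)).
  by exact: measurable_itv.
have dG (x : R) : is_derive x 1 G (h x).
  have [] := @continuous_FTC1 R h -oo%O x (x + 1) _ _ _ _.
  - by rewrite ltrDl.
  - exact: (igS measurableT (mI _) (@subsetT _ _) ib).
  - by rewrite ltNyr.
  - exact/smooth1_continuous/smooth1_hump.
  move=> dG GE; apply: DeriveDef; first exact: dG.
  by rewrite -derive1E.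
have G0 x : 0 <= G x by apply: Rintegral_ge0 => t _; exact: hump_ge0.
have GI x : G x <= mass a b c.
  by apply: (Rint_subset measurableT (mI _) (@subsetT _ _) ib) => t _; exact: hump_ge0.
have Ga x : x <= a -> G x = 0.
  move=> xa; rewrite /G (@eq_Rintegral _ _ _ _ _ (cst 0)).
    by rewrite Rintegral_cst// mul0r.
  move=> t /set_mem /=; rewrite in_itv/= => tx; rewrite /h hump_out//.
  by rewrite negb_and -!leNgt (le_trans tx xa).
have Gb x : b <= x -> G x = mass a b c.
  move=> bx; rewrite /G Rintegral_mkcond; apply: eq_Rintegral => t _; rewrite patchE.
  case: ifPn => // /negP h1; rewrite [RHS]hump_out// negb_and -!leNgt.
  apply/orP; right; rewrite leNgt; apply/negP => tb; apply: h1; apply/mem_set => /=.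
  by rewrite in_itv/= (le_trans (ltW tb)).
have sG : smooth1 G.
  move=> [|n].
    by split => // x; case: (dG x).
  by apply: (@Ck_is_derive _ _ _ h) => //; exact: smooth1_hump.
have I0 : 0 < mass a b c.
  rewrite lt_neqAle (le_trans (G0 0) (GI 0)) andbT; apply/eqP => I0.
  have GE : G = cst 0 by apply/funext => x; apply/eqP; rewrite eq_le G0 andbT (le_trans (GI x))// -I0.
  pose m := (a + b) / 2.
  have := dG m; rewrite GE => dm.
  have := hump_gt0 c (_ : a < m < b); rewrite -/h.
  have -> : h m = 0 by rewrite -(@derive_val _ _ _ _ _ _ _ dm) derive_cst.
  by rewrite ltxx => /(_ _)/negP; apply => //; rewrite /m; lra.
exists (fun x => (mass a b c)^-1 * G x); split => //.
- exact: smooth1Z.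
- move=> x; rewrite (@is_derive_derive1 _ _ (fun x => (mass a b c)^-1 * h x)); exact: mulrC.
- move=> x; rewrite mulr_ge0 ?invr_ge0 ?(ltW I0)//=.
  by rewrite mulrC ler_pdivrMr// mul1r.
- by split => [x xa|x bx]; [rewrite Ga// mulr0|rewrite Gb// mulVf// gt_eqF].
Qed.

Lemma mass_cvg (a b : R) : a < b -> (fun n => mass a b n.+1%:R^-1) @ \oo --> b - a.
Proof.
move=> ab.
have -> : b - a = \int[leb]_(x in setT) \1_(`]a, b[%classic) x.
  rewrite /Rintegral integral_indic//= setIT (lebesgue_measure_itv `]a, b[) /= lte_fin ab.
  by rewrite -EFinB.
have c0 n : 0 < n.+1%:R^-1 :> R by rewrite invr_gt0.
apply: (@dct _ _ _ leb setT _ _ (\1_(`]a, b[%classic))) => //.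
- by move=> n; exact: measurable_hump.
- apply: aeW => x _; rewrite indicE; case: (boolP (a < x < b)) => h.
    by rewrite mem_set /= ?in_itv//; exact: hump_cvg.
  rewrite memNset /= ?in_itv//=; last exact/negP.
  by apply: cvg_near_cst; apply: nearW => n; exact: hump_out.
- exact: (integrable_indic_itv a b false true).
- by move=> n x _; exact: hump_indic.
Qed.

End Primitive.

Section Plane.
Context {R : realType}.
Implicit Types (s : bool) (x : R * R) (U : set (R * R)).

(** The coordinate along the axis [s] ([true] for the second axis, along [e2]), and boxes
    with the sides transversal to and along this axis. *)
Definition co s x : R := if s then x.2 else x.1.
Definition ev s : R * R := if s then e2 else e1.
Definition bx s (a b c d : R) := if s then rect a b c d else rect c d a b.
Definition cbx s (a b c d : R) : set (R * R) :=
  [set x | a <= co (~~ s) x <= b /\ c <= co s x <= d].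

Lemma bxP s a b c d x : bx s a b c d x <-> (a < co (~~ s) x <= b /\ c < co s x <= d).
Proof. by case: s => /=; rewrite rectP// and_comm. Qed.

Lemma bx_cbx s a b c d : bx s a b c d `<=` cbx s a b c d.
Proof. by move=> x /bxP[/andP[h1 h2] /andP[h3 h4]]; split; apply/andP; split => //; exact: ltW. Qed.

Lemma cbx_sub s a b c d a' b' c' d' : a <= a' -> b' <= b -> c <= c' -> d' <= d ->
  cbx s a' b' c' d' `<=` cbx s a b c d.
Proof. by move=> ? ? ? ? x [/andP[? ?] /andP[? ?]]; split; lra. Qed.

Lemma bx_sub s a b c d a' b' c' d' : a <= a' -> b' <= b -> c <= c' -> d' <= d ->
  bx s a' b' c' d' `<=` bx s a b c d.
Proof. by move=> ? ? ? ? x /bxP[/andP[? ?] /andP[? ?]]; apply/bxP; split; lra. Qed.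

Lemma measurable_bx s a b c d : pmeasurable (bx s a b c d).
Proof. by case: s; exact: measurable_rect. Qed.

Lemma leb2_bx_lty s a b c d : (leb2 (bx s a b c d) < +oo)%E.
Proof. by case: s; exact: leb2_rect_lty. Qed.

Lemma compact_cbx s a b c d : compact (cbx s a b c d).
Proof.
case: s; [rewrite (_ : cbx _ _ _ _ _ = `[a, b] `*` `[c, d])|rewrite (_ : cbx _ _ _ _ _ = `[c, d] `*` `[a, b])];
  try (by apply: compact_setX; exact: segment_compact);
  by apply/seteqP; split => x /= []; rewrite ?in_itv.
Qed.

Lemma closed_cbx s a b c d : closed (cbx s a b c d).
Proof. by apply: compact_closed; [exact: norm_hausdorff|exact: compact_cbx]. Qed.

Lemma ballE x (r : R) y : ball x r y <-> `|x.1 - y.1| < r /\ `|x.2 - y.2| < r.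
Proof. by []. Qed.

Lemma measurable_co s : measurable_fun (setT : set (plane R)) (co s).
Proof. by case: s; [exact: measurable_snd|exact: measurable_fst]. Qed.

Lemma ae_co s t : {ae leb2, forall x, co s x != t}.
Proof.
exists [set x : R * R | co s x = t]; split; last by move=> x /= /negP; rewrite negbK => /eqP.
- rewrite -[X in measurable X]/(co s @^-1` [set t]).
  by rewrite -[X in measurable X]setTI; exact: measurable_co.
- case: s.
    rewrite (_ : [set x | _] = setT `*` [set t]); last by apply/seteqP; split => x /= [].
    rewrite /leb2 product_measure1E; [|by []|by []].
    by rewrite [X in (_ * X)%E](lebesgue_measure_set1 t) mule0.
  rewrite (_ : [set x | _] = [set t] `*` setT); last by apply/seteqP; split => x /= [].
  rewrite /leb2 product_measure1E; [|by []|by []].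
  by rewrite [X in (X * _)%E](lebesgue_measure_set1 t) mul0e.
Qed.

(** An enumeration of the rectangles with rational corners; invalid codes give empty ones. *)
Definition rats (n : nat) : rat * rat * rat * rat := odflt (0, 0, 0, 0) (unpickle n).
Definition ra n : R := ratr (rats n).1.1.1.
Definition rb n : R := ratr (rats n).1.1.2.
Definition rc n : R := ratr (rats n).1.2.
Definition rd n : R := ratr (rats n).2.
Definition ratbox n := rect (ra n) (rb n) (rc n) (rd n).
Definition good U n := [/\ ra n < rb n, rc n < rd n &
  cbx true (ra n) (rb n) (rc n) (rd n) `<=` U].

Lemma measurable_ratbox n : pmeasurable (ratbox n).
Proof. exact: measurable_rect. Qed.

Lemma ratbox_sub U n : good U n -> ratbox n `<=` U.
Proof. by move=> [_ _ sO] x /(@bx_cbx true) /sO. Qed.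

Lemma ratboxP (p q r t : rat) : exists n, [/\ ra n = ratr p, rb n = ratr q, rc n = ratr r & rd n = ratr t].
Proof. by exists (pickle (p, q, r, t)); rewrite /ra /rb /rc /rd /rats pickleK. Qed.

Lemma good_nbhd U x : open U -> U x -> exists n, good U n /\ ra n < x.1 < rb n /\ rc n < x.2 < rd n.
Proof.
move=> oU Ux; have [r /= r0 hr] : exists2 r : R, 0 < r & ball x r `<=` U.
  have /nbhs_ballP[r r0 hr] : nbhs x U by exact: open_nbhs_nbhs.
  by exists r.
have br (y : R) : exists p q : rat, y - r < ratr p /\ ratr p < y /\ y < ratr q /\ ratr q < y + r.
  have [|p /itvP hp] := @rat_in_itvoo R (y - r) y; first by rewrite ltrBlDr ltrDl.
  have [|q /itvP hq] := @rat_in_itvoo R y (y + r); first by rewrite ltrDl.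
  by exists p, q; rewrite !hp !hq.
have [p [q [h1 [h2 [h3 h4]]]]] := br x.1; have [p' [q' [k1 [k2 [k3 k4]]]]] := br x.2.
have [n [na nb nc nd]] := ratboxP p q p' q'.
exists n; rewrite /good na nb nc nd; repeat split; rewrite ?h2 ?h3 ?k2 ?k3//; try lra.
move=> y [/= y1 y2]; apply: hr; apply/ballE.
by rewrite !ltr_norml; split; lra.
Qed.

Lemma open_bigcup U : open U -> U = \bigcup_(n in good U) ratbox n.
Proof.
move=> oU; apply/seteqP; split => [x /(good_nbhd oU)[n [gn [h1 h2]]]|x [n [_ _ gn] /(@bx_cbx true) h]].
  by exists n => //; apply/rectP; split; lra.
exact: gn.
Qed.

Lemma open_pmeasurable U : open U -> pmeasurable U.
Proof.
by move=> /open_bigcup ->; apply: bigcup_measurable => n _; exact: measurable_rect.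
Qed.

Lemma continuous_pmeasurable (f : R * R -> R) : continuous f -> measurable_fun (setT : set (plane R)) f.
Proof.
move=> cf; apply: (measurability _ (RGenOpens.measurableE R)).
move=> _ [_ [p [q ->]] <-]; rewrite setTI; apply: open_pmeasurable.
by apply: open_comp => [x _|]; [exact: cf|exact: interval_open].
Qed.

(** Finite sums of products of functions of one coordinate are closed under all partial
    derivatives, which makes their smoothness immediate. *)
Inductive separable : (R * R -> R) -> Prop :=
| sep_prod f g : smooth1 f -> smooth1 g -> separable (fun x => f x.1 * g x.2)
| sep_add p q : separable p -> separable q -> separable (fun x => p x + q x).

Lemma continuous_co s : continuous (co s : R * R -> R).
Proof.
by case: s => x; [exact: (@cvg_snd _ _ (nbhs x.1) (nbhs x.2))|exact: (@cvg_fst _ _ (nbhs x.1) (nbhs x.2))].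
Qed.

Lemma open_lt0 (f : R * R -> R) : continuous f -> open [set x | f x < 0].
Proof. by move=> cf; apply: (@open_comp _ _ f [set t | t < 0]) => [x _|]; [exact: cf|exact: open_lt]. Qed.

Lemma differentiable_co s x : differentiable (co s : R * R -> R) x.
Proof.
case: s; [apply: (@linear_differentiable _ _ _ (snd : {linear (R * R)%type -> R^o}))|
  apply: (@linear_differentiable _ _ _ (fst : {linear (R * R)%type -> R^o}))].
  move=> y; exact: cvg_snd.
move=> y; exact: cvg_fst.
Qed.

Lemma diff_co s x : 'd (co s : R * R -> R) x = co s :> (R * R -> R).
Proof.
case: s; [apply: (@diff_lin _ _ _ (snd : {linear (R * R)%type -> R^o}))|
  apply: (@diff_lin _ _ _ (fst : {linear (R * R)%type -> R^o}))].
  move=> y; exact: cvg_snd.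
move=> y; exact: cvg_fst.
Qed.

Lemma is_derive_co s (f : R -> R) (x v : R * R) : smooth1 f ->
  differentiable (f \o co s) x /\ 'D_v (f \o co s) x = derive1 f (co s x) * co s v.
Proof.
move=> sf; have df : differentiable f (co s x) by apply/derivable1_diffP/smooth1_derivable.
have dd : differentiable (f \o co s) x.
  by apply: differentiable_comp => //; exact: differentiable_co.
split => //; rewrite deriveE// diff_comp//=; last exact: differentiable_co.
rewrite diff_co -[X in 'd f _ X]mulr1 -[_ * 1]/(_ *: _) linearZ /=.
by rewrite -derive1E'// /GRing.scale /= mulrC.
Qed.

Lemma sep_derive p v : separable p -> (forall x, differentiable p x) /\ separable ('D_v p).
Proof.
elim=> [f g sf sg|q r _ [dq sq] _ [dr sr]].
  have df x := is_derive_co false x v sf; have dg x := is_derive_co true x v sg.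
  split; first by move=> x; apply: (differentiableM (proj1 (df x)) (proj1 (dg x))).
  rewrite (_ : 'D_v _ = fun x => (v.2 * f x.1) * derive1 g x.2 + (v.1 * derive1 f x.1) * g x.2).
    exact: (sep_add (sep_prod (smooth1Z v.2 sf) (smooth1_derive sg))
      (sep_prod (smooth1Z v.1 (smooth1_derive sf)) sg)).
  apply/funext => x; have [f1 f2] := df x; have [g1 g2] := dg x.
  transitivity ((f \o co false) x *: 'D_v (g \o co true) x + (g \o co true) x *: 'D_v (f \o co false) x).
    by rewrite -deriveM//; exact: diff_derivable.
  rewrite f2 g2 /GRing.scale /=; ring.
split; first by move=> x; exact: (differentiableD (dq x) (dr x)).
rewrite (_ : 'D_v _ = fun x => 'D_v q x + 'D_v r x); first exact: sep_add.
by apply/funext => x; rewrite -deriveD//; exact: diff_derivable.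
Qed.

Lemma sep_smooth p : separable p -> smooth p.
Proof.
move=> sp s x.
suff /(sep_derive 0)[] : separable (foldr (fun v g => 'D_v g : R * R -> R) p s) by [].
by elim: s => //= v s /(sep_derive v)[].
Qed.

(** The factor [g] varies along the axis [s], and [f] along the other one. *)
Definition tensor s (f g : R -> R) (x : R * R) : R := f (co (~~ s) x) * g (co s x).

Lemma sep_tensor s f g : smooth1 f -> smooth1 g -> separable (tensor s f g).
Proof.
move=> sf sg; case: s; first exact: sep_prod.
rewrite (_ : tensor _ _ _ = fun x => g x.1 * f x.2); first exact: sep_prod.
by apply/funext => x; rewrite /tensor /= mulrC.
Qed.

Lemma derive_tensor s f g x : smooth1 f -> smooth1 g ->
  'D_(ev s) (tensor s f g) x = f (co (~~ s) x) * derive1 g (co s x).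
Proof.
move=> sf sg; have [f1 f2] := is_derive_co (~~ s) x (ev s) sf.
have [g1 g2] := is_derive_co s x (ev s) sg.
transitivity ((f \o co (~~ s)) x *: 'D_(ev s) (g \o co s) x + (g \o co s) x *: 'D_(ev s) (f \o co (~~ s)) x).
  by rewrite -deriveM//; exact: diff_derivable.
by rewrite f2 g2; case: s {f1 f2 g1 g2} => /=; rewrite /GRing.scale /=; ring.
Qed.

Lemma closure_support (phi : R * R -> R) C : closed C -> (forall x, ~ C x -> phi x = 0) ->
  closure [set x | phi x != 0] `<=` C.
Proof.
move=> cC h; rewrite [X in _ `<=` X](closure_id C).1//; apply: closure_subset => x /= px.
by apply: contrapT => /h /eqP; rewrite (negbTE px).
Qed.

Lemma test_tensor U s (f g : R -> R) (a b c d : R) : smooth1 f -> smooth1 g ->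
  (forall x : R, ~~ (a < x < b) -> f x = 0) -> (forall x : R, ~~ (c < x < d) -> g x = 0) ->
  cbx s a b c d `<=` U -> test_function U (tensor s f g).
Proof.
move=> sf sg f0 g0 sU.
have sub : closure [set x | tensor s f g x != 0] `<=` cbx s a b c d.
  apply: closure_support; first exact: closed_cbx.
  move=> x nx; rewrite /tensor; case: (boolP (a < co (~~ s) x < b)) => h1; last by rewrite f0// mul0r.
  case: (boolP (c < co s x < d)) => h2; last by rewrite g0// mulr0.
  by exfalso; apply: nx; split; lra.
split; first exact/sep_smooth/sep_tensor.
- apply: subclosed_compact sub; [exact: closed_closure|exact: compact_cbx].
- by move=> x /sub /sU.
Qed.

End Plane.
#[global] Hint Resolve measurable_bx measurable_ratbox : core.

(** * Weak derivatives on boxes *)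

Section WeakDerivative.
Context {R : realType}.
Implicit Types (s : bool) (Om : set (R * R)) (u g f : R * R -> R).
Local Notation mu := (@leb2 R).

Lemma cbxC s (a b c d : R) : cbx (~~ s) c d a b = cbx s a b c d.
Proof. by rewrite /cbx negbK; apply/seteqP; split => x []. Qed.

Lemma leb2_bx s (a b c d : R) : a <= b -> c <= d -> fine (mu (bx s a b c d)) = (b - a) * (d - c).
Proof. by move=> ab cd; case: s; rewrite leb2_rect//= mulrC. Qed.

Lemma sqi_bxS s (a b c d a' b' c' d' : R) f : a <= a' -> b' <= b -> c <= c' -> d' <= d ->
  sqi mu (bx s a b c d) f -> sqi mu (bx s a' b' c' d') f.
Proof.
move=> h1 h2 h3 h4; apply: sqiS; [exact: measurable_bx|exact: measurable_bx|exact: bx_sub].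
Qed.

Lemma sqi_bx_ig s (a b c d : R) f : sqi mu (bx s a b c d) f -> ig mu (bx s a b c d) f.
Proof. by apply: sqi_ig; [exact: measurable_bx|exact: leb2_bx_lty]. Qed.

Lemma measurable_hump_co (p q e : R) s D : 0 < e ->
  measurable_fun (D : set (plane R)) (fun x => hump p q e (co s x)).
Proof.
move=> e0; apply: measurable_funTS; apply: (measurableT_comp (f := hump p q e)).
  exact: measurable_hump.
exact: measurable_co.
Qed.

Let cn0 n : 0 < n.+1%:R^-1 :> R. Proof. by rewrite invr_gt0. Qed.

Lemma hump_ae_cvg (p q t : R) : t != q ->
  (fun n => hump p q n.+1%:R^-1 t) @ \oo --> (((p < t <= q)%R)%:R : R).
Proof.
move=> tq; have -> : (p < t <= q) = (p < t < q) by rewrite le_eqVlt (negbTE tq).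
case: (boolP (p < t < q)) => h; first exact: hump_cvg.
by apply: cvg_near_cst; apply: nearW => n; exact: hump_out.
Qed.

(** Tensor products of humps approximate the indicator function of a box, boundedly and
    almost everywhere. *)
Lemma hump_box_cvg s (a b c d p q : R) f : ig mu (bx s a b c d) f -> c <= p -> q <= d ->
  (fun n => \int[mu]_(x in bx s a b c d)
     (f x * (hump a b n.+1%:R^-1 (co (~~ s) x) * hump p q n.+1%:R^-1 (co s x)))) @ \oo -->
  \int[mu]_(x in bx s a b p q) f x.
Proof.
move=> igf cp qd.
have sub : bx s a b p q `<=` bx s a b c d by exact: bx_sub.
rewrite -(setIidr sub) RintegralT; have mf := ig_meas igf.
apply: (@dct _ _ _ mu _ _ _ (fun x => `|f x|)).
- exact: measurable_bx.
- move=> n; apply: measurable_funM => //; apply: measurable_funM; exact: measurable_hump_co.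
- by apply: measurable_funM => //; apply: measurable_indic; exact: measurable_bx.
- have [N1 [mN1 N10 sN1]] := ae_co (~~ s) b; have [N2 [mN2 N20 sN2]] := ae_co s q.
  exists (N1 `|` N2); split; [exact: measurableU|by rewrite null_set_setU|].
  move=> x nx; apply: contrapT => nN; apply: nx => Dx.
  have x1 : co (~~ s) x != b.
    by apply/negP => /eqP h; apply: nN; left; apply: sN1 => /=; rewrite h eqxx.
  have x2 : co s x != q.
    by apply/negP => /eqP h; apply: nN; right; apply: sN2 => /=; rewrite h eqxx.
  apply: cvgM; first exact: cvg_cst.
  rewrite (_ : \1_(bx s a b p q) x = ((a < co (~~ s) x <= b)%R)%:R * ((p < co s x <= q)%R)%:R).
    by apply: cvgM; exact: hump_ae_cvg.
  rewrite -natrM mulnb indicE; congr (_%:R); congr nat_of_bool.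
  by apply/idP/andP => [/set_mem/bxP[]|[? ?]]; [|apply/mem_set/bxP].
- exact: ig_norm.
- by move=> n x _; rewrite normrM ler_piMr// normrM mulr_ile1// hump_norm_le1.
Qed.

(** Testing with a tensor product supported in a box of [Om] turns the integrals over
    [Om] into integrals over this box. *)
Lemma Rint_box Om s (a b c d : R) f (k : R * R -> R) : cbx s a b c d `<=` Om ->
  (forall x, ~ bx s a b c d x -> k x = 0) ->
  fine (\int[mu]_(x in Om) (f x * k x)%:E)%E = \int[mu]_(x in bx s a b c d) (f x * k x).
Proof.
move=> sO k0; rewrite /Rintegral; congr fine.
rewrite [LHS]integral_mkcond [RHS]integral_mkcond.
congr integral; apply/funext => x.
rewrite !patchE; case: (boolP (x \in bx s a b c d)) => [/set_mem h|/negP h].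
  by rewrite mem_set//; apply: sO; exact: bx_cbx h.
rewrite k0 ?mulr0; last by move=> /mem_set.
by case: ifP.
Qed.

Lemma weak_derivative_tensor Om s (a b c d : R) u g (al be : R -> R) :
  weak_derivative Om (ev s) u g -> cbx s a b c d `<=` Om -> smooth1 al -> smooth1 be ->
  (forall x : R, ~~ (a < x < b) -> al x = 0) -> (forall x : R, ~~ (c < x < d) -> be x = 0) ->
  (forall x : R, ~~ (c < x < d) -> derive1 be x = 0) ->
  \int[mu]_(x in bx s a b c d) (u x * (al (co (~~ s) x) * derive1 be (co s x))) =
  - \int[mu]_(x in bx s a b c d) (g x * (al (co (~~ s) x) * be (co s x))).
Proof.
move=> wd sO sal sbe al0 be0 be'0.
have t0 (be1 : R -> R) : (forall x : R, ~~ (c < x < d) -> be1 x = 0) ->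
   forall x, ~ bx s a b c d x -> al (co (~~ s) x) * be1 (co s x) = 0.
  move=> h x nx; case: (boolP (a < co (~~ s) x < b)) => h1; last by rewrite al0// mul0r.
  case: (boolP (c < co s x < d)) => h2; last by rewrite h// mulr0.
  by exfalso; apply: nx; apply/bxP; split; lra.
rewrite -(Rint_box _ sO (t0 _ be'0)) -(Rint_box _ sO (t0 _ be0)).
have := wd _ (test_tensor sal sbe al0 be0 sO) => /(congr1 fine); rewrite fineN.
move=> {}wd; rewrite -{}wd; congr fine; apply: eq_integral => x _.
by rewrite derive_tensor.
Qed.

(** The test function is a hump across the column times a function along it, bounded by 1,
    whose derivative is the difference of the weights that average over the two segments;
    then the humps tend to indicator functions. *)
Lemma box_average_diff Om s (a b c d p q p' q' : R) u g :
  weak_derivative Om (ev s) u g -> cbx s a b c d `<=` Om -> a < b ->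
  ig mu (bx s a b c d) u -> ig mu (bx s a b c d) g ->
  c <= p -> p < q -> q <= d -> c <= p' -> p' < q' -> q' <= d ->
  `|(\int[mu]_(x in bx s a b p q) u x) / (q - p) - (\int[mu]_(x in bx s a b p' q') u x) / (q' - p')|
  <= \int[mu]_(x in bx s a b c d) `|g x|.
Proof.
move=> wd sO ab iu ih cp pq qd cp' pq' qd'.
pose e n : R := n.+1%:R^-1; set Q := bx s a b c d.
pose w n (x : R * R) := hump a b (e n) (co (~~ s) x).
pose X n := (\int[mu]_(x in Q) (u x * (w n x * hump p q (e n) (co s x)))) / mass p q (e n) -
            (\int[mu]_(x in Q) (u x * (w n x * hump p' q' (e n) (co s x)))) / mass p' q' (e n).
have Xl : X @ \oo --> (\int[mu]_(x in bx s a b p q) u x) / (q - p) - (\int[mu]_(x in bx s a b p' q') u x) / (q' - p').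
  by apply: cvgB; apply: cvgM; [exact: hump_box_cvg|apply: cvgV; [rewrite subr_eq0 gt_eqF|exact: mass_cvg]|
    exact: hump_box_cvg|apply: cvgV; [rewrite subr_eq0 gt_eqF|exact: mass_cvg]].
have iuw n (r t : R) : ig mu Q (fun x => u x * (w n x * hump r t (e n) (co s x))).
  apply: (@ig_le _ _ _ mu _ _ (fun x => `|u x|)); [exact: measurable_bx| | |exact: ig_norm].
    apply: measurable_funM; first exact: ig_meas iu.
    by apply: measurable_funM; exact: measurable_hump_co (cn0 n).
  by move=> x _; rewrite normrM ler_piMr// normrM mulr_ile1// (hump_norm_le1 _ _ _ (cn0 n)).
have XE n : `|X n| <= \int[mu]_(x in Q) `|g x|.
  have [F [I0 sF dF F01 [F0 F1]]] := hump_primitive pq (cn0 n).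
  have [F' [I0' sF' dF' F01' [F0' F1']]] := hump_primitive pq' (cn0 n).
  (* Below [c] both primitives are 0, and above [d] both are 1. *)
  pose be x := F x + -1 * F' x.
  have sbe : smooth1 be by apply: smooth1D => //; exact: smooth1Z.
  have dbe x : derive1 be x = hump p q (e n) x / mass p q (e n) - hump p' q' (e n) x / mass p' q' (e n).
    have h1 := smooth1_is_derive x sF; have h2 := smooth1_is_derive x sF'.
    have h3 := @is_deriveZ _ _ _ F' (-1) x 1 _ h2.
    have := is_deriveD h1 h3 => h4; rewrite derive1E (@derive_val _ _ _ _ _ _ _ h4).
    by rewrite dF dF' scaleN1r.
  have be0 x : ~~ (c < x < d) -> be x = 0.
    rewrite negb_and -!leNgt => /orP[h|h]; rewrite /be.
      by rewrite F0 ?F0' ?mulr0 ?addr0//; apply: le_trans h _.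
    by rewrite F1 ?F1' ?mulr1 ?subrr//; apply: le_trans h.
  have dbe0 x : ~~ (c < x < d) -> derive1 be x = 0.
    move=> h; rewrite dbe !hump_out ?mul0r ?subrr//; apply: contra h; lra.
  have be1 x : `|be x| <= 1.
    by have := F01 x; have := F01' x; rewrite /be ler_norml; lra.
  have := weak_derivative_tensor wd sO (smooth1_hump a b (cn0 n)) sbe
    (fun x => @hump_out _ a b _ x) be0 dbe0.
  have -> : \int[mu]_(x in Q) (u x * (hump a b n.+1%:R^-1 (co (~~ s) x) * derive1 be (co s x))) = X n.
    pose m1 := (mass p q (e n))^-1; pose m2 := (mass p' q' (e n))^-1.
    have mQ : pmeasurable Q by exact: measurable_bx.
    transitivity (m1 * (\int[mu]_(x in Q) (u x * (w n x * hump p q (e n) (co s x)))) -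
      m2 * \int[mu]_(x in Q) (u x * (w n x * hump p' q' (e n) (co s x)))); last first.
      by rewrite /X ![_ / mass _ _ _]mulrC.
    rewrite -(RintZ m1 mQ (iuw _ _ _)) -(RintZ m2 mQ (iuw _ _ _)).
    rewrite -(RintegralB mQ (igZ m1 mQ (iuw _ _ _)) (igZ m2 mQ (iuw _ _ _))).
    apply: eq_Rintegral => x _; rewrite dbe -/m1 -/m2 -/(e n) -/(w n x).
    move: (w n x) (hump _ _ _ _) (hump _ _ _ _) (u x) m1 m2 => *; ring.
  move=> ->; rewrite normrN.
  have ig1 : ig mu Q (fun x => g x * (hump a b n.+1%:R^-1 (co (~~ s) x) * be (co s x))).
    apply: (@ig_le _ _ _ mu _ _ (fun x => `|g x|)); [exact: measurable_bx| | |exact: ig_norm].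
      apply: measurable_funM; first exact: ig_meas ih.
      apply: measurable_funM; first exact: measurable_hump_co (cn0 n).
      apply: measurable_funTS; apply: (measurableT_comp (f := be)); last exact: measurable_co.
      by apply: continuous_measurable_fun; exact: smooth1_continuous.
    move=> x _; rewrite normrM ler_piMr// normrM mulr_ile1 ?be1//.
    exact: (hump_norm_le1 _ _ _ (cn0 n)).
  apply: (le_trans (le_normr_Rintegral (measurable_bx _ _ _ _ _) ig1)).
  apply: le_Rintegral; [exact: measurable_bx|exact: ig_norm|exact: ig_norm|].
  move=> x _; rewrite normrM ler_piMr// normrM mulr_ile1 ?be1//.
  exact: (hump_norm_le1 _ _ _ (cn0 n)).
move: (Xl) => /cvg_norm nX.
rewrite -(cvg_lim _ nX)//; apply: limr_le; first by apply/cvg_ex; eexists; exact: nX.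
exact: nearW.
Qed.

Lemma weak_derivative_box_unique Om s (a b c d : R) u g g' :
  weak_derivative Om (ev s) u g -> weak_derivative Om (ev s) u g' ->
  cbx s a b c d `<=` Om -> a < b -> c < d ->
  ig mu (bx s a b c d) g -> ig mu (bx s a b c d) g' ->
  \int[mu]_(x in bx s a b c d) g x = \int[mu]_(x in bx s a b c d) g' x.
Proof.
move=> wd wd' sO ab cd ih ih'.
have h1 := hump_box_cvg ih (lexx c) (lexx d); have h2 := hump_box_cvg ih' (lexx c) (lexx d).
suff E : (fun n => \int[mu]_(x in bx s a b c d) (g x * (hump a b n.+1%:R^-1 (co (~~ s) x) * hump c d n.+1%:R^-1 (co s x)))) =
    (fun n => \int[mu]_(x in bx s a b c d) (g' x * (hump a b n.+1%:R^-1 (co (~~ s) x) * hump c d n.+1%:R^-1 (co s x)))).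
  by rewrite E in h1; exact: (cvg_unique _ h1 h2).
apply/funext => n.
have z0 : forall x, ~ bx s a b c d x -> hump a b n.+1%:R^-1 (co (~~ s) x) * hump c d n.+1%:R^-1 (co s x) = 0.
  move=> x nx; case: (boolP (a < co (~~ s) x < b)) => h3; last by rewrite hump_out// mul0r.
  case: (boolP (c < co s x < d)) => h4; last by rewrite (hump_out _ h4) mulr0.
  by exfalso; apply: nx; apply/bxP; split; lra.
rewrite -!(Rint_box _ sO z0).
have tt := test_tensor (smooth1_hump a b (cn0 n)) (smooth1_hump c d (cn0 n))
  (fun x => @hump_out _ a b _ x) (fun x => @hump_out _ c d _ x) sO.
have := wd' _ tt; rewrite (wd _ tt) => /(congr1 fine); rewrite !fineN.
by move=> /oppr_inj.
Qed.

Lemma ae_eq_open Om (f f' : R * R -> R) : open Om ->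
  (forall n, good Om n -> {ae mu, forall x, ratbox n x -> f x = f' x}) ->
  {ae mu, forall x, Om x -> f x = f' x}.
Proof.
move=> oO h.
have : forall n, {ae mu, forall x, good Om n -> ratbox n x -> f x = f' x}.
  move=> n; have [g|ng] := pselect (good Om n); last by apply: aeW.
  by apply: aeS (h _ g) => x hx _.
move=> /(@negligible_bigcup _ _ _ mu); apply: negligibleS.
move=> x /= /not_implyP[Ox ne].
have [n gn rx] : (\bigcup_(n in good Om) ratbox n) x by rewrite -open_bigcup.
by exists n => //= /(_ gn rx).
Qed.

(** Testing with humps shows that both derivatives have the same integral over every box
    inside the domain. *)
Lemma weak_derivative_unique Om s u g g' : open Om ->
  weak_derivative Om (ev s) u g -> weak_derivative Om (ev s) u g' ->
  sqi mu Om g -> sqi mu Om g' -> {ae mu, forall x, Om x -> g x = g' x}.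
Proof.
move=> oO wd wd' sg sg'; apply: ae_eq_open => // n [ab cd sO].
have mO := open_pmeasurable oO.
have sub : ratbox n `<=` Om by move=> x /(@bx_cbx _ true) /sO.
have ih : ig mu (ratbox n) g by apply: (@sqi_bx_ig true); exact: sqiS sg.
have ih' : ig mu (ratbox n) g' by apply: (@sqi_bx_ig true); exact: sqiS sg'.
have : {ae mu, forall x, ratbox n x -> g x - g' x = 0}.
  apply: ae_zero_full => //; first exact: igB.
  move=> a' b' c' d' h1 h2 h3 h4 h5 h6.
  have jg : ig mu (rect a' b' c' d') g by apply: ig_rect_sub ih.
  have jg' : ig mu (rect a' b' c' d') g' by apply: ig_rect_sub ih'.
  rewrite RintegralB//; apply/eqP; rewrite subr_eq0; apply/eqP.
  case: s wd wd' => wd wd'.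
    apply: (@weak_derivative_box_unique Om true a' b' c' d' u) => //.
    by apply: subset_trans sO; exact: cbx_sub.
  apply: (@weak_derivative_box_unique Om false c' d' a' b' u) => //.
  by rewrite -[false]/(~~ true) cbxC; apply: subset_trans sO; exact: cbx_sub.
by apply: aeS => x h /h /eqP; rewrite subr_eq0 => /eqP.
Qed.

End WeakDerivative.

(** * Estimates on boxes *)

Section BoxEstimates.
Context {R : realType}.
Implicit Types (s : bool) (Om : set (R * R)) (u g f : R * R -> R).
Local Notation mu := (@leb2 R).

Lemma bx_dyadic_n2_le s (a b c d : R) u C : a < b -> c < d -> sqi mu (bx s a b c d) u ->
  (forall k, \sum_(i < 2 ^ k) \sum_(j < 2 ^ k)
     (\int[mu]_(x in bx s (pt a b k i) (pt a b k i.+1) (pt c d k j) (pt c d k j.+1)) u x) ^+ 2 /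
       (((b - a) / 2 ^+ k) * ((d - c) / 2 ^+ k)) <= C) ->
  n2 mu (bx s a b c d) u <= C.
Proof.
move=> ab cd; case: s => su h; first exact: dyadic_n2_le.
apply: dyadic_n2_le => // k; rewrite exchange_big /=.
apply: le_trans (h k); rewrite le_eqVlt; apply/orP; left; apply/eqP.
by apply: eq_bigr => i _; apply: eq_bigr => j _; rewrite /cell_area [X in _ / X]mulrC.
Qed.

Lemma Rint_columns s (a b c d : R) k f : a <= b -> c <= d -> ig mu (bx s a b c d) f ->
  \sum_(i < 2 ^ k) \int[mu]_(x in bx s (pt a b k i) (pt a b k i.+1) c d) f x =
  \int[mu]_(x in bx s a b c d) f x.
Proof.
move=> ab cd h; pose q j := if j is 0%N then c else d.
have hq j : q j <= q j.+1 by case: j.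
have hp j : pt a b k j <= pt a b k j.+1 by exact: pt_le.
case: s h => h.
  have := @Rint_grid _ (pt a b k) q (2 ^ k) 1 f hp hq; rewrite pt0 pt_max /= => -> //.
  by apply: eq_bigr => i _; rewrite big_ord1.
have := @Rint_grid _ q (pt a b k) 1 (2 ^ k) f hq hp; rewrite pt0 pt_max /= => -> //.
by rewrite big_ord1.
Qed.

Lemma sum_const_pow (k : nat) (r : R) : \sum_(j < 2 ^ k) (r / 2 ^+ k) = r.
Proof. by rewrite sumr_const card_ord -[LHS]mulr_natl natrX mulrC divfK// expf_neq0. Qed.

Lemma column_diff_sq Om s (a b c d p q p' q' : R) u g :
  weak_derivative Om (ev s) u g -> cbx s a b c d `<=` Om -> a < b ->
  sqi mu (bx s a b c d) u -> sqi mu (bx s a b c d) g ->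
  c <= p -> p < q -> q <= d -> c <= p' -> p' < q' -> q' <= d ->
  ((\int[mu]_(x in bx s a b p q) u x) / (q - p) - (\int[mu]_(x in bx s a b p' q') u x) / (q' - p')) ^+ 2
  <= (b - a) * (d - c) * n2 mu (bx s a b c d) g.
Proof.
move=> wd sO ab su sg cp pq qd cp' pq' qd'.
have h := box_average_diff wd sO ab (sqi_bx_ig su) (sqi_bx_ig sg) cp pq qd cp' pq' qd'.
have cd : c <= d by lra.
have mQ := measurable_bx s a b c d.
have := sq_Rint_le mQ (leb2_bx_lty s a b c d) (sqi_norm mQ sg).
rewrite n2_norm leb2_bx ?(ltW ab)//; apply: le_trans.
rewrite -real_normK ?num_real// ler_pXn2r ?nnegrE//.
exact: le_trans h.
Qed.

Lemma pt_range (a b : R) k i : a <= b -> (i < 2 ^ k)%N -> a <= pt a b k i /\ pt a b k i.+1 <= b.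
Proof.
move=> ab ik; split; first by rewrite -[leLHS](pt0 a b k) pt_le.
by rewrite -[leRHS](pt_max a b k) pt_le.
Qed.

Lemma ptB (a b : R) k i : pt a b k i.+1 - pt a b k i = (b - a) / 2 ^+ k.
Proof. by rewrite ptS addrC addKr. Qed.

(** On each dyadic grid of the box, the average over a cell is compared, within its column,
    with the average over the part of the column in the strip; the norm is then recovered
    from the averages over the cells ([dyadic_n2_le]). *)
Lemma strip_estimate Om s (a b c d p q : R) u g :
  weak_derivative Om (ev s) u g -> cbx s a b c d `<=` Om -> a < b ->
  sqi mu (bx s a b c d) u -> sqi mu (bx s a b c d) g ->
  c <= p -> p < q -> q <= d ->
  n2 mu (bx s a b c d) u <= 2 * ((d - c) / (q - p)) * n2 mu (bx s a b p q) u +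
    2 * (d - c) ^+ 2 * n2 mu (bx s a b c d) g.
Proof.
move=> wd sO ab su sg cp pq qd; have cd : c < d by lra.
apply: bx_dyadic_n2_le => // k; set P := 2 ^+ k : R; have P0 : 0 < P by rewrite exprn_gt0.
pose A := (b - a) / P; pose B := (d - c) / P; pose l := q - p.
have A0 : 0 < A by rewrite divr_gt0// subr_gt0.
have B0 : 0 < B by rewrite divr_gt0// subr_gt0.
have l0 : 0 < l by rewrite subr_gt0.
pose nu i := n2 mu (bx s (pt a b k i) (pt a b k i.+1) p q) u.
pose ng i := n2 mu (bx s (pt a b k i) (pt a b k i.+1) c d) g.
apply: (@le_trans _ _ (\sum_(i < 2 ^ k) \sum_(j < 2 ^ k) ((2 / l * nu i + 2 * (d - c) * ng i) * (d - c)) / P)).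
  apply: ler_sum => i _; apply: ler_sum => j _.
  have [i1 i2] := pt_range (ltW ab) (ltn_ord i); have [j1 j2] := pt_range (ltW cd) (ltn_ord j).
  have iA := ptB a b k i; have jB := ptB c d k j.
  have i3 : pt a b k i < pt a b k i.+1 by rewrite pt_lt.
  have j3 : pt c d k j < pt c d k j.+1 by rewrite pt_lt.
  have sub : cbx s (pt a b k i) (pt a b k i.+1) c d `<=` Om by apply: subset_trans sO; exact: cbx_sub.
  have su' : sqi mu (bx s (pt a b k i) (pt a b k i.+1) c d) u by apply: sqi_bxS su.
  have sg' : sqi mu (bx s (pt a b k i) (pt a b k i.+1) c d) g by apply: sqi_bxS sg.
  have := column_diff_sq wd sub i3 su' sg' j1 j3 j2 cp pq qd.
  rewrite iA jB -/P -/A -/B -/l -/(ng i).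
  have su2 : sqi mu (bx s (pt a b k i) (pt a b k i.+1) p q) u by apply: sqi_bxS su'.
  have := sq_Rint_le (measurable_bx s _ _ _ _) (leb2_bx_lty s _ _ _ _) su2.
  rewrite leb2_bx ?(ltW i3) ?(ltW pq)// iA -/P -/A -/l -/(nu i).
  set X := (\int[mu]_(x in _) _); set Y := (\int[mu]_(x in _) _) => hY hX.
  have h1 : X ^+ 2 / B ^+ 2 <= 2 * (Y ^+ 2 / l ^+ 2) + 2 * (A * (d - c) * ng i).
    move: hX; rewrite -!expr_div_n; move: (X / B) (Y / l) (A * (d - c) * ng i) => x y z.
    by have := sqr_ge0 (2 * y - x); nra.
  have h2 : Y ^+ 2 / l ^+ 2 <= A / l * nu i.
    rewrite ler_pdivrMr ?exprn_gt0//.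
    rewrite [leRHS](_ : _ = A * l * nu i)//; field; by rewrite gt_eqF.
  have -> : X ^+ 2 / (A * B) = (B / A) * (X ^+ 2 / B ^+ 2).
    by field; rewrite !gt_eqF.
  apply: (@le_trans _ _ ((B / A) * (2 * (A / l * nu i) + 2 * (A * (d - c) * ng i)))).
    by apply: ler_wpM2l; [exact: (divr_ge0 (ltW B0) (ltW A0))|lra].
  rewrite le_eqVlt; apply/orP; left; apply/eqP; rewrite /B.
  by field; rewrite !gt_eqF.
under eq_bigr do rewrite sum_const_pow.
rewrite -mulr_suml big_split /= -!mulr_sumr.
have -> : \sum_(i < 2 ^ k) nu i = n2 mu (bx s a b p q) u.
  apply: (@Rint_columns s a b p q k (fun x => u x ^+ 2) (ltW ab) (ltW pq)).
  by case: (sqi_bxS (lexx a) (lexx b) cp qd su).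
have -> : \sum_(i < 2 ^ k) ng i = n2 mu (bx s a b c d) g.
  by apply: (@Rint_columns s a b c d k (fun x => g x ^+ 2) (ltW ab) (ltW cd)); case: sg.
rewrite -/l.
by rewrite le_eqVlt; apply/orP; left; apply/eqP; field; rewrite gt_eqF.
Qed.

(** The average over a cell is compared with the average over its column, and this one with
    the average over the box by means of the derivative in the other direction. *)
Lemma poincare Om (a b c d : R) u (g : bool -> R * R -> R) :
  (forall s, weak_derivative Om (ev s) u (g s)) -> cbx true a b c d `<=` Om -> a < b -> c < d ->
  sqi mu (rect a b c d) u -> (forall s, sqi mu (rect a b c d) (g s)) ->
  n2 mu (rect a b c d) (fun x => u x - (\int[mu]_(y in rect a b c d) u y) / ((b - a) * (d - c))) <=
    2 * (d - c) ^+ 2 * n2 mu (rect a b c d) (g true) + 2 * (b - a) ^+ 2 * n2 mu (rect a b c d) (g false).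
Proof.
move=> wd sO ab cd su sg; set Q := rect a b c d.
set m := _ / _; have mQ : pmeasurable Q by exact: measurable_rect.
have Qy := leb2_rect_lty a b c d.
have sm : sqi mu Q (fun x => u x - m) by apply: sqiB => //; exact: sqi_cst.
apply: (@bx_dyadic_n2_le true) => // k; set P := 2 ^+ k : R; have P0 : 0 < P by rewrite exprn_gt0.
pose A := (b - a) / P; pose B := (d - c) / P.
have A0 : 0 < A by rewrite divr_gt0// subr_gt0.
have B0 : 0 < B by rewrite divr_gt0// subr_gt0.
have ba0 : 0 < b - a by rewrite subr_gt0.
have dc0 : 0 < d - c by rewrite subr_gt0.
pose ng i := n2 mu (bx true (pt a b k i) (pt a b k i.+1) c d) (g true).
pose N := n2 mu Q (g false).
apply: (@le_trans _ _ (\sum_(i < 2 ^ k) \sum_(j < 2 ^ k) ((2 * (d - c) * ng i + 2 * A * (b - a) / (d - c) * N) * (d - c)) / P)).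
  apply: ler_sum => i _; apply: ler_sum => j _.
  have [i1 i2] := pt_range (ltW ab) (ltn_ord i); have [j1 j2] := pt_range (ltW cd) (ltn_ord j).
  have iA := ptB a b k i; have jB := ptB c d k j.
  have i3 : pt a b k i < pt a b k i.+1 by rewrite pt_lt.
  have j3 : pt c d k j < pt c d k j.+1 by rewrite pt_lt.
  have sub : cbx true (pt a b k i) (pt a b k i.+1) c d `<=` Om by apply: subset_trans sO; exact: cbx_sub.
  have su' : sqi mu (bx true (pt a b k i) (pt a b k i.+1) c d) u by apply: (@sqi_bxS _ true a b c d).
  have sg' : sqi mu (bx true (pt a b k i) (pt a b k i.+1) c d) (g true) by apply: (@sqi_bxS _ true a b c d) => //; exact: sg.
  have := column_diff_sq (wd true) sub i3 su' sg' j1 j3 j2 (lexx c) cd (lexx d).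
  have sO' : cbx false c d a b `<=` Om by rewrite -[false]/(~~ true) cbxC.
  have := column_diff_sq (wd false) sO' cd su (sg false) i1 i3 i2 (lexx a) ab (lexx b).
  rewrite iA jB -/P -/A -/B -/(ng i) -/N.
  rewrite RintegralB; last 3 first.
  - exact: measurable_bx.
  - by apply: sqi_bx_ig; apply: sqi_bxS su'.
  - by apply: ig_cst; [exact: measurable_bx|exact: leb2_bx_lty].
  rewrite Rint_cst_rect ?(ltW i3) ?(ltW j3)// iA jB -/P -/A -/B.
  rewrite -[bx false c d (pt a b k i) (pt a b k i.+1)]/(bx true (pt a b k i) (pt a b k i.+1) c d).
  rewrite -[bx false c d a b]/Q.
  set Y := (\int[mu]_(x in bx true (pt a b k i) (pt a b k i.+1) c d) _).
  set X := (\int[mu]_(x in bx true (pt a b k i) _ _ _) _) => hY hX.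
  set Z := \int[mu]_(x in Q) u x in hY.
  have mE : m = Z / (b - a) / (d - c) by rewrite /m -/Z; field; rewrite !gt_eqF.
  have -> : (X - m * (A * B)) ^+ 2 / (A * B) = A * B * ((X / B - Y / (d - c)) / A + (Y / A - Z / (b - a)) / (d - c)) ^+ 2.
    by rewrite mE; field; rewrite !gt_eqF.
  apply: (@le_trans _ _ (A * B * (2 * (A * (d - c) * ng i / A ^+ 2) + 2 * ((d - c) * (b - a) * N / (d - c) ^+ 2)))).
    apply: ler_wpM2l; first exact: (mulr_ge0 (ltW A0) (ltW B0)).
    have h1 : ((X / B - Y / (d - c)) / A) ^+ 2 <= A * (d - c) * ng i / A ^+ 2.
      by rewrite expr_div_n ler_wpM2r// invr_ge0 exprn_ge0 ?ltW.
    have h2 : ((Y / A - Z / (b - a)) / (d - c)) ^+ 2 <= (d - c) * (b - a) * N / (d - c) ^+ 2.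
      by rewrite expr_div_n ler_wpM2r// invr_ge0 exprn_ge0 ?ltW.
    move: h1 h2; set x := _ / A; set y := _ / (d - c); have := sqr_ge0 (x - y); nra.
  rewrite le_eqVlt; apply/orP; left; apply/eqP; rewrite /B.
  by field; rewrite !gt_eqF.
under eq_bigr do rewrite sum_const_pow.
rewrite -mulr_suml big_split /= -!mulr_sumr.
have -> : \sum_(i < 2 ^ k) ng i = n2 mu Q (g true).
  by apply: (@Rint_columns true a b c d k (fun x => g true x ^+ 2) (ltW ab) (ltW cd)); case: (sg true).
have -> : \sum_(i < 2 ^ k) N = P * N by rewrite sumr_const card_ord -[LHS]mulr_natl natrX.
rewrite le_eqVlt /A; apply/orP; left; apply/eqP; rewrite -/N.
by field; rewrite !gt_eqF.
Qed.

End BoxEstimates.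

(** * Compactly supported weights *)

Section CompactSupport.
Context {R : realType}.
Implicit Types (s : bool) (Om : set (R * R)) (u g f phi psi : R * R -> R).
Local Notation mu := (@leb2 R).

Definition L2loc Om u := forall n, good Om n -> sqi mu (ratbox n) u.

(** What a test function and its derivatives have in common. *)
Definition cc Om psi := continuous psi /\
  exists K, [/\ compact K, K `<=` Om & forall x, ~ K x -> psi x = 0].

Lemma cc_test Om phi : test_function Om phi -> cc Om phi.
Proof.
move=> [sm cK KO]; split.
  by move=> x; apply: differentiable_continuous; exact: (sm [::] x).
exists (closure [set x | phi x != 0]); split => // x nx.
apply: contrapT => /eqP px; apply: nx; exact: subset_closure.
Qed.

Lemma cc_derive Om phi v : test_function Om phi -> cc Om ('D_v phi).
Proof.
move=> [sm cK KO]; split.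
  by move=> x; apply: differentiable_continuous; exact: (sm [:: v] x).
exists (closure [set x | phi x != 0]); split => // x nx.
have near0 : \forall y \near x, phi y = cst 0 y.
  have : nbhs x (~` closure [set x | phi x != 0]).
    by apply: open_nbhs_nbhs; split => //; apply: closed_openC; exact: closed_closure.
  apply: filterS => y ny; apply: contrapT => /eqP py; apply: ny; exact: subset_closure.
by rewrite (near_eq_derive _ near0) derive_cst.
Qed.

Lemma co_norm_le s (x : R * R) : `|co s x| <= `|x|.
Proof. by rewrite prod_normE; case: s; rewrite le_max lexx ?orbT. Qed.

Lemma compact_box (K : set (R * R)) : compact K -> exists2 M : R, 0 < M & forall x, K x -> forall s, `|co s x| < M.
Proof.
move=> /compact_bounded [M [Mr hM]]; exists (`|M| + 2); first by rewrite ltr_pwDr.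
move=> x Kx s; have := hM (`|M| + 1) _ x Kx.
rewrite (le_lt_trans (ler_norm M)) ?ltrDl// => /(_ isT) h.
by apply: le_lt_trans (co_norm_le s x) (le_lt_trans h _); rewrite ltrD2l ltr1n.
Qed.

Lemma cc_bound Om psi : cc Om psi -> exists2 C, 0 <= C & forall x, `|psi x| <= C.
Proof.
move=> [cp [K [cK _ p0]]].
have : compact (psi @` K) by apply: continuous_compact => //; exact: continuous_subspaceT.
move=> /compact_bounded [M [Mr hM]]; exists (`|M| + 1); first by rewrite addr_ge0.
move=> x; have [Kx|nKx] := pselect (K x); last by rewrite p0// normr0 addr_ge0.
by apply: (hM (`|M| + 1)); [rewrite (le_lt_trans (ler_norm M)) ?ltrDl|exists x].
Qed.

(** The filter form of compactness applies, because a point covered by the first [n] boxes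
    of a kind stays covered as [n] grows. *)
Lemma compact_cover_ratbox (G : nat -> Prop) (K : set (R * R)) : compact K ->
  (forall x, K x -> exists n, [/\ G n, ra n < x.1 < rb n & rc n < x.2 < rd n]) ->
  exists2 r : seq nat, forall n, n \in r -> G n & forall x, K x -> exists2 n, n \in r & ratbox n x.
Proof.
move=> /compact_near_coveringP cK hK.
have := cK nat \oo (fun N x => exists m, [/\ (m <= N)%N, G m & ratbox m x]) _.
case=> [x Kx|N _ hN].
  have [m [Gm /andP[h1 h2] /andP[h3 h4]]] := hK x Kx.
  exists ([set y | ra m < co false y < rb m] `&` [set y | rc m < co true y < rd m], [set N | (m <= N)%N]).
    split => /=; last by exists m.
    have H s (p q : R) : p < co s x -> co s x < q -> nbhs x [set y | p < co s y < q].
      move=> px xq; have /= hc := @continuous_co R s x.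
      have : nbhs (co s x) [set t | p < t < q].
        rewrite (_ : [set t | _] = `]p, q[%classic); last by apply/seteqP; split => t; rewrite /= in_itv.
        by apply: near_in_itvoo; rewrite in_itv/= px.
      exact: hc.
    by apply: filterI; [exact: (H false _ _ h1 h2)|exact: (H true _ _ h3 h4)].
  move=> [y N] /= [[/andP[y1 y2] /andP[y3 y4]] mN]; exists m; split => //.
  by apply/rectP; move: y1 y2 y3 y4; rewrite /co => y1 y2 y3 y4; rewrite y1 y3 !ltW.
exists [seq m <- iota 0 N.+1 | `[< G m >]].
  by move=> n; rewrite mem_filter => /andP[/asboolP].
move=> x Kx; have [m [mN Gm bm]] := hN N (leqnn N) x Kx; exists m => //.
by rewrite mem_filter mem_iota add0n ltnS mN; apply/andP; split => //; exact/asboolP.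
Qed.

Lemma compact_cover_good Om (K : set (R * R)) : open Om -> compact K -> K `<=` Om ->
  exists2 r : seq nat, forall n, n \in r -> good Om n & forall x, K x -> exists2 n, n \in r & ratbox n x.
Proof.
move=> oO cK KO; apply: compact_cover_ratbox => // x /KO Ox.
by have [n [gn [h1 h2]]] := good_nbhd oO Ox; exists n; split.
Qed.

Lemma cvg_sum0 (I : eqType) (r : seq I) (a : I -> nat -> R) :
  (forall i, i \in r -> a i @ \oo --> (0 : R)) -> (fun k => \sum_(i <- r) a i k) @ \oo --> (0 : R).
Proof.
elim: r => [|i r IH] h.
  by apply: cvg_near_cst; apply: nearW => k; rewrite big_nil.
rewrite (_ : (fun k => _) = (fun k => a i k + \sum_(i <- r) a i k)); last first.
  by apply/funext => k; rewrite big_cons.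
rewrite -[X in _ --> X]addr0; apply: cvgD; first by apply: h; rewrite mem_head.
by apply: IH => j jr; apply: h; rewrite inE jr orbT.
Qed.

Lemma igI A B f : pmeasurable A -> pmeasurable B -> ig mu B f -> ig mu A (fun x => f x * \1_B x).
Proof.
move=> mA mB h; have : ig mu setT (fun x => f x * \1_B x).
  have := (@integrable_mkcond _ _ _ mu B (EFin \o f) mB).1 h.
  apply: eq_integrable => // x _ /=; rewrite patchE indicE; case: ifPn => _; by rewrite ?mulr1 ?mulr0.
by apply: igS.
Qed.

Lemma igU A B f : pmeasurable A -> pmeasurable B -> ig mu A f -> ig mu B f -> ig mu (A `|` B) f.
Proof.
move=> mA mB hA hB; have mAB := measurableU _ _ mA mB.
apply: (@ig_le _ _ _ mu _ _ (fun x => `|f x * \1_A x| + `|f x * \1_B x|)) => //.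
- by apply/(measurable_funU _ mA mB); split; [exact: ig_meas hA|exact: ig_meas hB].
- move=> x [h|h]; rewrite !indicE (mem_set h) mulr1.
    by rewrite lerDl.
  by rewrite lerDr.
- by apply: igD => //; apply: ig_norm; apply: igI.
Qed.

Lemma sqiU A B f : pmeasurable A -> pmeasurable B -> sqi mu A f -> sqi mu B f -> sqi mu (A `|` B) f.
Proof.
move=> mA mB [hA iA] [hB iB]; split; last exact: igU.
by apply/(measurable_funU _ mA mB).
Qed.

Lemma sqi_cover (A : set (R * R)) (I : eqType) (r : seq I) (B : I -> set (R * R)) f :
  pmeasurable A -> (forall i, i \in r -> pmeasurable (B i)) -> (forall i, i \in r -> sqi mu (B i) f) ->
  (forall x, A x -> exists2 i, i \in r & B i x) -> sqi mu A f.
Proof.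
move=> mA mB sB cov.
suff [C [mC AC sC]] : exists C, [/\ pmeasurable C, (forall x, (exists2 i, i \in r & B i x) -> C x) & sqi mu C f].
  by apply: sqiS sC => // x /cov /AC.
elim: r mB sB {cov} => [|i r IH] mB sB.
  exists set0; split => [|x []//|]; first exact: measurable0.
  split; first exact: measurable_fun_set0.
  exact: integrable_set0.
have sub j : j \in r -> j \in i :: r by rewrite inE => ->; rewrite orbT.
have [C [mC AC sC]] := IH (fun j jr => mB j (sub j jr)) (fun j jr => sB j (sub j jr)).
exists (B i `|` C); split.
- by apply: measurableU => //; apply: mB; rewrite mem_head.
- move=> x [j]; rewrite inE => /predU1P[->|jr]; first by left.
  by right; apply: AC; exists j.
- by apply: sqiU => //; [apply: mB|apply: sB]; rewrite mem_head.
Qed.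

Lemma L2loc_meas Om u : open Om -> L2loc Om u -> measurable_fun (Om : set (plane R)) u.
Proof.
move=> oO hu; rewrite {1}(open_bigcup oO) bigcup_mkcond.
apply/measurable_fun_bigcup => n; case: ifPn => [/set_mem gn|_]; first exact: measurable_rect.
- exact: measurable0.
- by case: (hu n gn).
- exact: measurable_fun_set0.
Qed.

Lemma sqi_L2loc Om u : open Om -> sqi mu Om u -> L2loc Om u.
Proof.
move=> oO hu n gn.
exact: (sqiS (open_pmeasurable oO) (measurable_ratbox n) (ratbox_sub gn) hu).
Qed.

Lemma L2loc_box Om s (a b c d : R) u : open Om -> L2loc Om u -> cbx s a b c d `<=` Om ->
  sqi mu (bx s a b c d) u.
Proof.
move=> oO hu sO; have [r gr cov] := compact_cover_good oO (@compact_cbx _ s a b c d) sO.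
apply: (@sqi_cover _ _ r (@ratbox R)) => //; first by move=> n /gr /hu.
by move=> x /bx_cbx /cov.
Qed.

Lemma L2locB Om u f : L2loc Om u -> L2loc Om f -> L2loc Om (fun x => u x - f x).
Proof. by move=> hu hf n gn; exact: (sqiB (measurable_ratbox n) (hu n gn) (hf n gn)). Qed.

Lemma L2loc_cst Om k : L2loc Om (cst k).
Proof. by move=> n gn; exact: (sqi_cst k (measurable_ratbox n) (leb2_rect_lty _ _ _ _)). Qed.

(** Finitely many boxes cover the support of the weight. As they do not depend on [u], the
    integral is continuous for convergence on boxes. *)
Lemma cc_Rint_le Om psi : open Om -> cc Om psi -> exists C (r : seq nat),
  [/\ 0 <= C, forall n, n \in r -> good Om n &
   forall u, L2loc Om u -> ig mu Om (fun x => u x * psi x) /\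
     `|\int[mu]_(x in Om) (u x * psi x)| <= C * \sum_(n <- r) \int[mu]_(x in ratbox n) `|u x|].
Proof.
move=> oO ccp; have [C C0 hC] := cc_bound ccp; case: (ccp) => cp [K [cK KO p0]].
have [r gr cov] := compact_cover_good oO cK KO; exists C, r; split => // u hu.
have mO := open_pmeasurable oO.
have ib n : n \in r -> ig mu (ratbox n) u by move=> /gr /hu; exact: (@sqi_bx_ig _ true).
pose h x := \sum_(n <- r) `|u x| * \1_(ratbox n) x.
have [igh hE] : ig mu Om h /\ \int[mu]_(x in Om) h x <= \sum_(n <- r) \int[mu]_(x in ratbox n) `|u x|.
  rewrite /h; elim: r ib {gr cov h} => [|n r IH] ib.
    split; last by rewrite big_nil (@eq_Rintegral _ _ _ _ _ (cst 0)) ?Rintegral_cst ?mul0r// => x _; rewrite big_nil.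
    by apply: (@eq_ig _ _ _ mu _ (cst 0)) => //; [move=> x _; rewrite big_nil|exact: integrable0].
  have [|i1 i2] := IH; first by move=> m mr; apply: ib; rewrite inE mr orbT.
  have ibn : ig mu (ratbox n) (fun x => `|u x|) by apply: ig_norm; apply: ib; rewrite mem_head.
  have i3 : ig mu Om (fun x => `|u x| * \1_(ratbox n) x) by exact: igI.
  split; first by apply: eq_ig (igD mO i3 i1) => // x _; rewrite big_cons.
  rewrite [leLHS](_ : _ = \int[mu]_(x in Om) (`|u x| * \1_(ratbox n) x + \sum_(n <- r) `|u x| * \1_(ratbox n) x)); last first.
    by apply: eq_Rintegral => x _; rewrite big_cons.
  rewrite RintegralD// big_cons lerD// -RintegralT.
  apply: Rint_subset => //; exact: measurableI.
have mup : measurable_fun (Om : set (plane R)) (fun x => u x * psi x).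
  apply: measurable_funM; first exact: L2loc_meas.
  by apply: measurable_funTS; exact: continuous_pmeasurable.
have dom x : Om x -> `|u x * psi x| <= C * h x.
  move=> _; rewrite normrM mulrC; have [Kx|nKx] := pselect (K x); last first.
    rewrite p0// normr0 mul0r mulr_ge0// /h; apply: sumr_ge0 => n _.
    by apply: mulr_ge0; rewrite ?indicE ?ler0n.
  have [n nr bn] := cov _ Kx.
  apply: ler_pM => //; rewrite /h (big_rem n)//= indicE mem_set// mulr1 lerDl.
  by apply: sumr_ge0 => m _; apply: mulr_ge0; rewrite ?indicE ?ler0n.
have igup : ig mu Om (fun x => u x * psi x) by exact: (ig_le mO mup dom (igZ C mO igh)).
split => //; apply: (le_trans (le_normr_Rintegral mO igup)).
apply: le_trans (ler_wpM2l C0 hE); rewrite -RintZ//.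
by apply: le_Rintegral => //; [exact: ig_norm|exact: igZ].
Qed.

Lemma L2loc_cvg_test Om psi (F : nat -> R * R -> R) f : open Om -> cc Om psi ->
  (forall k, L2loc Om (F k)) -> L2loc Om f ->
  (forall n, good Om n -> (fun k => n2 mu (ratbox n) (fun x => F k x - f x)) @ \oo --> (0 : R)) ->
  (fun k => \int[mu]_(x in Om) (F k x * psi x)) @ \oo --> \int[mu]_(x in Om) (f x * psi x).
Proof.
move=> oO ccp hF hf hc; have mO := open_pmeasurable oO.
have [C [r [C0 gr hC]]] := cc_Rint_le oO ccp.
apply/subr_cvg0; apply/norm_cvg0P.
apply: (@squeeze_cvgr _ _ _ _ (fun=> 0) (fun k => C * \sum_(n <- r) \int[mu]_(x in ratbox n) `|F k x - f x|)).
- apply: nearW => k; rewrite normr_ge0 /=.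
  have [i1 _] := hC _ (hF k); have [i2 _] := hC _ hf.
  have [_ i3] := hC _ (L2locB (hF k) hf); rewrite -RintegralB//; apply: le_trans i3.
  by rewrite le_eqVlt; apply/orP; left; apply/eqP; congr (`| _ |); apply: eq_Rintegral => x _; rewrite mulrBl.
- exact: cvg_cst.
- rewrite -[X in _ --> X](mulr0 C); apply: cvgM; first exact: cvg_cst.
  apply: cvg_sum0 => n /gr gn.
  apply: (@squeeze_cvgr _ _ _ _ (fun=> 0) (fun k => Num.sqrt (fine (mu (ratbox n)) * n2 mu (ratbox n) (fun x => F k x - f x)))).
  + apply: nearW => k; have sd : sqi mu (ratbox n) (fun x => F k x - f x) by apply: L2locB.
    rewrite Rintegral_ge0 //=.
    have := sq_Rint_le (measurable_rect _ _ _ _) (leb2_rect_lty _ _ _ _) (sqi_norm (measurable_rect _ _ _ _) sd).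
    rewrite n2_norm => h; rewrite -(@ler_pXn2r _ 2)// ?nnegrE ?sqrtr_ge0// ?Rintegral_ge0//.
    by rewrite sqr_sqrtr// (le_trans _ h)// sqr_ge0.
  + exact: cvg_cst.
  + have E : 0 = Num.sqrt (fine (mu (ratbox n)) * 0) :> R by rewrite mulr0 sqrtr0.
    rewrite [X in _ --> X]E; apply: continuous_cvg; first exact: sqrt_continuous.
    by apply: cvgM; [exact: cvg_cst|exact: hc].
Qed.

(** ** The derivative of a test function has mean zero *)

Definition line s (t y : R) : R * R := if s then (t, y) else (y, t).

Lemma continuous_line s t : continuous (line s t).
Proof.
move=> y; apply/cvgrPdist_lt => e e0; near=> z.
have h : `|y - z| < e by near: z; exact: cvgr_dist_lt.
by case: s; rewrite prod_normE /= gt_max subrr normr0 e0 h.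
Unshelve. all: by end_near. Qed.

Lemma is_derive_line phi s t (y : R) : differentiable phi (line s t y) ->
  is_derive y 1 (fun y => phi (line s t y)) ('D_(ev s) phi (line s t y)).
Proof.
move=> df.
have E : (fun h : R => h^-1 *: (((fun y => phi (line s t y)) \o shift y) (h *: 1) - phi (line s t y))) =
   (fun h : R => h^-1 *: ((phi \o shift (line s t y)) (h *: ev s) - phi (line s t y))).
  apply/funext => h /=; congr (_ *: (phi _ - _)).
  by case: s {df} => /=; congr pair => /=; rewrite /GRing.scale /= ?mulr0 ?mulr1 ?add0r.
have dv : derivable phi (line s t y) (ev s) by exact: diff_derivable.
by apply: DeriveDef; rewrite /derivable /derive E.
Qed.

(** By Fubini's theorem, since the integral along each line vanishes by the fundamental
    theorem of calculus. *)
Lemma int_derive_test Om s phi : open Om -> test_function Om phi ->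
  \int[mu]_(x in Om) 'D_(ev s) phi x = 0.
Proof.
move=> oO tphi; have ccd := cc_derive (ev s) tphi; have ccp := cc_test tphi.
set h := 'D_(ev s) phi in ccd *; case: (ccd) => ch [K [cK KO h0]].
case: (ccp) => cp [K' [cK' KO' p0]].
have [M M0 hM] := compact_box cK; have [M' M'0 hM'] := compact_box cK'.
have [C C0 hC] := cc_bound ccd; pose m := Num.max M M'.
have m0 : 0 < m by rewrite lt_max M0.
have out x s' : m <= `|co s' x| -> h x = 0 /\ phi x = 0.
  move=> mx; split.
    by apply: h0 => /hM /(_ s'); rewrite ltNge (le_trans _ mx)// le_max lexx.
  by apply: p0 => /hM' /(_ s'); rewrite ltNge (le_trans _ mx)// le_max lexx orbT.
have mh : measurable_fun (setT : set (plane R)) h by exact: continuous_pmeasurable.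
have igh : ig mu setT h.
  apply: (@ig_le _ _ _ mu _ _ (fun x => C * \1_(rect (- m) m (- m) m) x)) => //.
    move=> x _; rewrite indicE; case: (boolP (x \in _)) => [_|/negP nx]; first by rewrite mulr1.
    rewrite (_ : h x = 0) ?normr0 ?mulr0//; apply: contrapT => hx; apply: nx; apply/mem_set/rectP.
    have : ~ (m <= `|co true x|) by move=> /out[].
    have : ~ (m <= `|co false x|) by move=> /out[].
    move=> /negP; rewrite -ltNge ltr_norml => /andP[? ?] /negP; rewrite -ltNge ltr_norml => /andP[? ?].
    by split; apply/andP; split => //; exact: ltW.
  apply: igZ => //.
  have := igI measurableT (measurable_rect (- m) m (- m) m)
    (ig_cst 1 (measurable_rect (- m) m (- m) m) (leb2_rect_lty _ _ _ _)).
  by apply: eq_ig => // x _; rewrite mul1r.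
have inner t : (\int[@lebesgue_measure R]_y (h (line s t y))%:E = 0)%E.
  have hl : continuous (fun y => h (line s t y)).
    move=> y; apply: (@continuous_comp _ _ _ (line s t) h); last exact: ch.
    exact: continuous_line.
  have dp (y : R) : is_derive y 1 (fun y => phi (line s t y)) (h (line s t y)).
    by apply: is_derive_line; case: tphi => sm _ _; exact: (sm [::]).
  have -> : (\int[@lebesgue_measure R]_y (h (line s t y))%:E = \int[@lebesgue_measure R]_(y in `[(- m)%R, m]%classic) (h (line s t y))%:E)%E.
    rewrite [RHS]integral_mkcond; congr integral; apply/funext => y; rewrite patchE.
    case: ifPn => // /negP ny; congr (_%:E); apply: (proj1 (out _ s _)).
    have -> : co s (line s t y) = y by case: s {h ccd ch h0 hM hC out mh igh hl dp ny}.
    rewrite leNgt; apply/negP; rewrite ltr_norml => /andP[? ?]; apply: ny; apply/mem_set => /=.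
    by rewrite in_itv/= !ltW.
  rewrite (@continuous_FTC2 _ _ (fun y => phi (line s t y))).
  - rewrite (proj2 (out _ s _)) ?(proj2 (out _ s _)) ?subee//.
      have -> : co s (line s t (- m)) = - m by case: s {h ccd ch h0 hM hC out mh igh hl dp}.
      by rewrite normrN gtr0_norm.
    have -> : co s (line s t m) = m by case: s {h ccd ch h0 hM hC out mh igh hl dp}.
    by rewrite gtr0_norm.
  - lra.
  - exact: continuous_subspaceT.
  - have cpl : continuous (fun y => phi (line s t y)).
      by move=> y; apply: differentiable_continuous; apply/derivable1_diffP; case: (dp y).
    split; first by move=> y _; case: (dp y).
      exact/cvg_at_right_filter/cpl.
    exact/cvg_at_left_filter/cpl.
  - by move=> y _; rewrite derive1E; have := dp y => ?; exact: derive_val.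
have -> : \int[mu]_(x in Om) h x = \int[mu]_(x in setT) h x.
  rewrite Rintegral_mkcond; apply: eq_Rintegral => x _; rewrite patchE; case: ifPn => // /negP nx.
  by rewrite h0// => /KO Ox; apply: nx; exact: mem_set.
rewrite /Rintegral.
case: s h {ccd ch h0 hM hC out mh} igh inner => h igh inner.
  have := integral12_prod_meas1 igh => /= <-.
  by rewrite (eq_integral (cst 0%E)) ?integral0// => x _; exact: inner.
have := integral21_prod_meas1 igh => /= <-.
by rewrite (eq_integral (cst 0%E)) ?integral0// => x _; exact: inner.
Qed.

(** ** Linearity of the weak derivative *)

Lemma weak_derivativeP Om v u g : open Om -> L2loc Om u -> L2loc Om g ->
  weak_derivative Om v u g <-> (forall phi, test_function Om phi ->
    \int[mu]_(x in Om) (u x * 'D_v phi x) = - \int[mu]_(x in Om) (g x * phi x)).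
Proof.
move=> oO hu hg; have mO := open_pmeasurable oO.
have H phi : test_function Om phi -> ig mu Om (fun x => u x * 'D_v phi x) /\ ig mu Om (fun x => g x * phi x).
  move=> tp; have [C [r [_ _ /(_ _ hu) [i1 _]]]] := cc_Rint_le oO (cc_derive v tp).
  by have [C' [r' [_ _ /(_ _ hg) [i2 _]]]] := cc_Rint_le oO (cc_test tp).
split => h phi tp; have [i1 i2] := H phi tp; have := h phi tp.
  by rewrite !ig_fin// -EFinN => -[].
by rewrite !ig_fin// -EFinN => ->.
Qed.

Lemma weak_derivativeB Om v u g u' g' : open Om -> L2loc Om u -> L2loc Om g -> L2loc Om u' -> L2loc Om g' ->
  weak_derivative Om v u g -> weak_derivative Om v u' g' ->
  weak_derivative Om v (fun x => u x - u' x) (fun x => g x - g' x).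
Proof.
move=> oO hu hg hu' hg' /(weak_derivativeP _ oO hu hg) h /(weak_derivativeP _ oO hu' hg') h'.
have mO := open_pmeasurable oO.
apply/weak_derivativeP => //; [exact: L2locB|exact: L2locB|] => phi tp.
have [C [r [_ _ H]]] := cc_Rint_le oO (cc_derive v tp).
have [C' [r' [_ _ H']]] := cc_Rint_le oO (cc_test tp).
have E (a b p : R * R -> R) : ig mu Om (fun x => a x * p x) -> ig mu Om (fun x => b x * p x) ->
   \int[mu]_(x in Om) ((a x - b x) * p x) = \int[mu]_(x in Om) (a x * p x) - \int[mu]_(x in Om) (b x * p x).
  by move=> i1 i2; rewrite -RintegralB//; apply: eq_Rintegral => x _; rewrite mulrBl.
rewrite !E ?h// ?h'//; first (by rewrite opprD); [by case: (H' _ hg)|by case: (H' _ hg')|by case: (H _ hu)|by case: (H _ hu')].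
Qed.

Lemma weak_derivative_cst Om s k : open Om -> weak_derivative Om (ev s) (cst k) (cst 0).
Proof.
move=> oO; have mO := open_pmeasurable oO.
apply/weak_derivativeP => //; [exact: L2loc_cst|exact: L2loc_cst|] => phi tp.
have [C [r [_ _ /(_ _ (L2loc_cst 1)) [i1 _]]]] := cc_Rint_le oO (cc_derive (ev s) tp).
rewrite RintZ//; last by apply: eq_ig i1 => // x _; rewrite mul1r.
rewrite int_derive_test// mulr0 (@eq_Rintegral _ _ _ _ _ (cst 0)) ?Rintegral_cst ?mul0r ?oppr0//.
by move=> x _; rewrite mul0r.
Qed.

End CompactSupport.

(** * Square-integrability up to the boundary *)

Section Boundary.
Context {R : realType}.
Implicit Types (s fl : bool) (Om : set (R * R)) (u g f : R * R -> R).
Local Notation mu := (@leb2 R).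

Definition sg fl (t : R) : R := (-1) ^+ fl * t.
(** Boxes in the coordinate [sg fl (co s x)], in which the domain lies above the graph
    whatever the orientation. *)
Definition bxf fl s (a b lo hi : R) := if fl then bx s a b (- hi) (- lo) else bx s a b lo hi.
Definition cbxf fl s (a b lo hi : R) := if fl then cbx s a b (- hi) (- lo) else cbx s a b lo hi.

Lemma sgE fl t : sg fl t = if fl then - t else t.
Proof. by rewrite /sg; case: fl; rewrite ?expr1 ?expr0 ?mulN1r ?mul1r. Qed.

Lemma cbxfP fl s a b lo hi x : cbxf fl s a b lo hi x <-> a <= co (~~ s) x <= b /\ lo <= sg fl (co s x) <= hi.
Proof. by rewrite sgE /cbxf; case: fl => //; split=> -[h1 h2]; split => //; lra. Qed.

Lemma bxfP fl s a b lo hi x : a < co (~~ s) x <= b -> lo < sg fl (co s x) < hi -> bxf fl s a b lo hi x.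
Proof. by rewrite sgE /bxf; case: fl => h1 h2; apply/bxP; split => //; lra. Qed.

Lemma bxf_cbxf fl s a b lo hi : bxf fl s a b lo hi `<=` cbxf fl s a b lo hi.
Proof. by rewrite /bxf /cbxf; case: fl; exact: bx_cbx. Qed.

Lemma bxfS fl s (a b lo hi lo' hi' : R) : lo' <= lo -> hi <= hi' ->
  bxf fl s a b lo hi `<=` bxf fl s a b lo' hi'.
Proof. by rewrite /bxf; case: fl => h1 h2; apply: bx_sub => //; lra. Qed.

Lemma measurable_bxf fl s a b lo hi : pmeasurable (bxf fl s a b lo hi).
Proof. by rewrite /bxf; case: fl; exact: measurable_bx. Qed.
Hint Resolve measurable_bxf : core.

Lemma L2loc_bxf Om fl s a b lo hi u : open Om -> L2loc Om u -> cbxf fl s a b lo hi `<=` Om ->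
  sqi mu (bxf fl s a b lo hi) u.
Proof. by rewrite /bxf /cbxf; case: fl; exact: L2loc_box. Qed.

Lemma Rint_columns_bxf fl s a b lo hi k f : a <= b -> lo <= hi -> ig mu (bxf fl s a b lo hi) f ->
  \sum_(i < 2 ^ k) \int[mu]_(x in bxf fl s (pt a b k i) (pt a b k i.+1) lo hi) f x =
  \int[mu]_(x in bxf fl s a b lo hi) f x.
Proof. by rewrite /bxf; case: fl => ab lh h; apply: Rint_columns => //; lra. Qed.

Lemma strip_estimate_bxf Om fl s (a b lo hi p : R) u g :
  weak_derivative Om (ev s) u g -> cbxf fl s a b lo hi `<=` Om -> a < b -> lo <= p -> p < hi ->
  sqi mu (bxf fl s a b lo hi) u -> sqi mu (bxf fl s a b lo hi) g ->
  n2 mu (bxf fl s a b lo hi) u <= 2 * ((hi - lo) / (hi - p)) * n2 mu (bxf fl s a b p hi) u +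
    2 * (hi - lo) ^+ 2 * n2 mu (bxf fl s a b lo hi) g.
Proof.
rewrite /bxf /cbxf; case: fl => wd sO ab lp ph su sg_; last exact: (strip_estimate wd sO ab su sg_ lp ph (lexx _)).
have := @strip_estimate _ _ s a b (- hi) (- lo) (- hi) (- p) u g wd sO ab su sg_.
by rewrite !opprK ![- _ + hi]addrC; apply; lra.
Qed.

Lemma pt_index (a b z : R) k : a < b -> a < z -> z <= b ->
  exists2 i, (i < 2 ^ k)%N & pt a b k i < z <= pt a b k i.+1.
Proof.
move=> ab az zb; have ex : exists j, z <= pt a b k j by exists (2 ^ k)%N; rewrite pt_max.
case: (ex_minnP ex) => -[|i] hi imin; first by move: hi; rewrite pt0; lra.
exists i; first by apply: imin; rewrite pt_max.
by rewrite hi andbT ltNge; apply/negP => /imin; rewrite ltnn.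
Qed.

Lemma Rint_sum A n (F : 'I_n -> R * R -> R) : pmeasurable A -> (forall i, ig mu A (F i)) ->
  ig mu A (fun x => \sum_(i < n) F i x) /\
  \int[mu]_(x in A) (\sum_(i < n) F i x) = \sum_(i < n) \int[mu]_(x in A) F i x.
Proof.
move=> mA; elim: n F => [|n IH] F h.
  split; last by rewrite big_ord0 (@eq_Rintegral _ _ _ _ _ (cst 0)) ?Rintegral_cst ?mul0r// => x _; rewrite big_ord0.
  by apply: (@eq_ig _ _ _ mu _ (cst 0)) => //; [move=> x _; rewrite big_ord0|exact: integrable0].
have [i1 i2] := IH _ (fun i => h (widen_ord (leqnSn n) i)).
split; first by apply: eq_ig (igD mA i1 (h ord_max)) => // x _; rewrite big_ord_recr.
rewrite big_ord_recr /= -i2 -(RintegralD mA i1 (h ord_max)).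
by apply: eq_Rintegral => x _; rewrite big_ord_recr.
Qed.

(** The region above a graph is exhausted by the unions, over finer and finer grids, of
    the columns that stay above the graph. The strip estimate bounds the integral over
    each column by a strip at a distance from the boundary and by the derivative, with
    constants that do not depend on the column. *)
Lemma graph_region Om s fl (gam : R -> R) (s0 t0 dl rho : R) u g :
  open Om -> L2loc Om u -> sqi mu Om g -> weak_derivative Om (ev s) u g ->
  0 < dl -> 0 < rho -> continuous gam ->
  (forall z, `|z - s0| <= dl -> `|gam z - t0| <= rho / 4) ->
  (forall x, `|co (~~ s) x - s0| <= dl -> `|sg fl (co s x) - t0| <= rho ->
    (Om x <-> gam (co (~~ s) x) < sg fl (co s x))) ->
  let V := [set x | `|co (~~ s) x - s0| < dl /\ gam (co (~~ s) x) < sg fl (co s x) < t0 + rho] in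
  pmeasurable V /\ sqi mu V u.
Proof.
move=> oO lu sgO wd dl0 rho0 cg hg hO V.
have mO := open_pmeasurable oO.
pose a := s0 - dl; pose b := s0 + dl; pose T := t0 + rho; pose P := t0 + rho / 2.
have ab : a < b by rewrite /a /b; lra.
have VO : V `<=` Om.
  move=> x [h1 /andP[h2 h3]]; apply/hO => //; first exact: ltW.
  by have := hg _ (ltW h1); move: h1; rewrite !ler_norml => ? /andP[? ?]; apply/andP; split; lra.
have csg : continuous (fun x : R * R => sg fl (co s x)).
  by move=> x; apply: cvgM; [exact: cvg_cst|exact: continuous_co].
have cga : continuous (fun x : R * R => gam (co (~~ s) x)).
  by move=> x; apply: (@continuous_comp _ _ _ (co (~~ s)) gam); [exact: continuous_co|exact: cg].
have mV : pmeasurable V.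
  apply: open_pmeasurable.
  rewrite (_ : V = [set x | co (~~ s) x - (s0 + dl) < 0] `&` [set x | (s0 - dl) - co (~~ s) x < 0] `&`
      [set x | gam (co (~~ s) x) - sg fl (co s x) < 0] `&` [set x | sg fl (co s x) - T < 0]).
    do ?apply: openI; apply: open_lt0 => x.
    - by apply: cvgB; [exact: continuous_co|exact: cvg_cst].
    - by apply: cvgB; [exact: cvg_cst|exact: continuous_co].
    - by apply: cvgB; [exact: cga|exact: csg].
    - by apply: cvgB; [exact: csg|exact: cvg_cst].
  apply/seteqP; split => x /=; rewrite /V /T /= ltr_norml !subr_lt0.
    by move=> [/andP[? ?] /andP[? ?]]; repeat split; lra.
  by move=> [[[? ?] ?] ?]; split; lra.
(* The columns of the [n]-th grid start at a height [tau n i] slightly above the supremum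
   of [gam] over their base, which keeps their closures inside the domain; the margin
   tends to 0, so that every point of the region is reached eventually. *)
pose M n i := sup [set gam z | z in [set z | pt a b n i <= z <= pt a b n i.+1]].
pose tau n i := M n i + rho / 4 / n.+1%:R.
have in_col n i z : (i < 2 ^ n)%N -> pt a b n i <= z <= pt a b n i.+1 -> `|z - s0| <= dl.
  move=> ik /andP[z1 z2]; have [h1 h2] := pt_range (ltW ab) ik.
  by move: h1 h2; rewrite /a /b ler_norml => h1 h2; apply/andP; split; lra.
have hs n i : (i < 2 ^ n)%N -> has_sup [set gam z | z in [set z | pt a b n i <= z <= pt a b n i.+1]].
  move=> ik; split.
    by exists (gam (pt a b n i)), (pt a b n i) => //=; rewrite lexx pt_le ?(ltW ab).
  exists (t0 + rho / 4) => _ [z hz <-]; have := hg z (in_col _ _ _ ik hz).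
  by rewrite ler_norml => /andP[_]; lra.
have Mge n i z : (i < 2 ^ n)%N -> pt a b n i <= z <= pt a b n i.+1 -> gam z <= M n i.
  by move=> ik hz; apply: sup_upper_bound; [exact: hs|exists z].
have Mle n i c : (i < 2 ^ n)%N -> (forall z, pt a b n i <= z <= pt a b n i.+1 -> gam z <= c) -> M n i <= c.
  move=> ik hc; apply: ge_sup; first by case: (hs n i ik).
  by move=> _ [z hz <-]; exact: hc.
have small n : 0 < rho / 4 / n.+1%:R <= rho / 4.
  by rewrite divr_gt0 ?divr_gt0//= ler_pdivrMr// ler_peMr ?ler1n// divr_ge0 ?(ltW rho0).
have tauP n i : (i < 2 ^ n)%N -> t0 - rho / 4 < tau n i <= P.
  move=> ik; have pi : pt a b n i <= pt a b n i <= pt a b n i.+1 by rewrite lexx pt_le ?(ltW ab).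
  have := Mge n i _ ik pi; have := hg _ (in_col _ _ _ ik pi); have := small n.
  have : M n i <= t0 + rho / 4.
    apply: Mle => // z hz; have := hg z (in_col _ _ _ ik hz).
    by rewrite ler_norml => /andP[_]; lra.
  rewrite /tau /P ler_norml; set w := rho / 4 / n.+1%:R => ? /andP[? ?] /andP[? ?] ?; apply/andP; split; lra.
pose Q n i := bxf fl s (pt a b n i) (pt a b n i.+1) (tau n i) T.
have QO n i : (i < 2 ^ n)%N -> cbxf fl s (pt a b n i) (pt a b n i.+1) (tau n i) T `<=` Om.
  move=> ik x /cbxfP[h1 h2]; have := tauP n i ik => h3; apply/hO.
  - exact: in_col h1.
  - by rewrite ler_norml /T in h2 *; lra.
  - have := Mge n i _ ik h1; have := small n; rewrite /tau in h2.
    by move: h2; set w := rho / 4 / n.+1%:R => *; lra.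
have JO : cbxf fl s a b P T `<=` Om.
  move=> x /cbxfP[h1 h2]; have z1 : `|co (~~ s) x - s0| <= dl by move: h1; rewrite /a /b ler_norml; lra.
  apply/hO => //; first by rewrite ler_norml; move: h2; rewrite /P /T; lra.
  by have := hg _ z1; move: h2; rewrite /P /T ler_norml; lra.
have suJ := L2loc_bxf oO lu JO.
have PT : P < T by rewrite /P /T; lra.
pose G x := g x ^+ 2 * \1_Om x.
have igG A : pmeasurable A -> ig mu A G by move=> mA; apply: igI => //; case: sgO.
pose C0 := bxf fl s a b (t0 - rho) T.
pose L := 8 * n2 mu (bxf fl s a b P T) u + 8 * rho ^+ 2 * \int[mu]_(x in C0) G x.
have suQ n i : (i < 2 ^ n)%N -> sqi mu (Q n i) u by move=> ik; exact: (L2loc_bxf oO lu (QO n i ik)).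
have QOm n i : (i < 2 ^ n)%N -> Q n i `<=` Om by move=> ik x /bxf_cbxf /(QO _ _ ik).
have sgQ n i : (i < 2 ^ n)%N -> sqi mu (Q n i) g.
  by move=> ik; exact: (sqiS mO (measurable_bxf _ _ _ _ _ _) (QOm n i ik) sgO).
have colsum n : \sum_(i < 2 ^ n) n2 mu (Q n i) u <= L.
  rewrite /L /n2.
  rewrite -(@Rint_columns_bxf fl s a b P T n (fun x => u x ^+ 2) (ltW ab) (ltW PT)); last by case: suJ.
  rewrite -(@Rint_columns_bxf fl s a b (t0 - rho) T n G (ltW ab)); [|by rewrite /T; lra|exact: igG].
  rewrite !mulr_sumr -big_split /=; apply: ler_sum => i _.
  have ik := ltn_ord i; have /andP[ta1 ta2] := tauP n i ik.
  have pp : pt a b n i < pt a b n i.+1 by rewrite pt_lt.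
  have := strip_estimate_bxf wd (QO n i ik) pp ta2 PT (suQ n i ik) (sgQ n i ik).
  rewrite -/(Q n i) => h; apply: (le_trans h); apply: lerD.
    apply: ler_wpM2r; first exact: n2_ge0.
    have h4 : (T - tau n i) / (T - P) <= 4.
      by rewrite ler_pdivrMr ?subr_gt0//; move: ta1; rewrite /T /P; lra.
    lra.
  apply: ler_pM; [by rewrite mulr_ge0 ?sqr_ge0|exact: n2_ge0| |].
    have h4 : (T - tau n i) ^+ 2 <= (2 * rho) ^+ 2.
      by rewrite ler_pXn2r// ?nnegrE; move: ta1 ta2; rewrite /T /P; lra.
    by move: h4; rewrite exprMn; lra.
  have -> : n2 mu (Q n i) g = \int[mu]_(x in Q n i) G x.
    apply: eq_Rintegral => x /set_mem Qx; rewrite /G indicE mem_set ?mulr1//.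
    exact: QOm Qx.
  apply: (Rint_subset (measurable_bxf _ _ _ _ _ _) (measurable_bxf _ _ _ _ _ _) _ (igG _ (measurable_bxf _ _ _ _ _ _))).
    by apply: bxfS => //; lra.
  by move=> x _; rewrite mulr_ge0 ?sqr_ge0// indicE ler0n.
split => //.
have suV : measurable_fun (V : set (plane R)) u by apply: measurable_funS (L2loc_meas oO lu).
pose h n x := \sum_(i < 2 ^ n) u x ^+ 2 * \1_(Q n i) x.
have igh n i : (i < 2 ^ n)%N -> ig mu V (fun x => u x ^+ 2 * \1_(Q n i) x).
  by move=> ik; exact: (igI mV (measurable_bxf _ _ _ _ _ _) (proj2 (suQ n i ik))).
have [] // := @fatou_Rint _ _ _ mu V h (fun x => u x ^+ 2) L mV.
- by move=> n; exact: (ig_meas (proj1 (Rint_sum mV (fun i : 'I_(2 ^ n) => igh n i (ltn_ord i))))).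
- exact: measurable_sq.
- by move=> n x _; apply: sumr_ge0 => i _; rewrite mulr_ge0 ?sqr_ge0// indicE ler0n.
- by move=> x _; exact: sqr_ge0.
- apply: aeW => x [x1 /andP[x2 x3]] e e0.
  pose z := co (~~ s) x; pose ep := (sg fl (co s x) - gam z) / 3.
  have ep0 : 0 < ep by rewrite divr_gt0// subr_gt0.
  have [et et0 het] : exists2 et, 0 < et & forall z', `|z' - z| < et -> gam z' <= gam z + ep.
    have /cvgrPdist_lt /(_ _ ep0) := cg z; move=> /nbhs_ballP[et et0 h1]; exists et => // z' hz'.
    have := h1 z'; rewrite /ball /= distrC => /(_ hz'); rewrite ltr_norml => /andP[]; lra.
  have [N1 _ hN1] : \forall n \near \oo, (b - a) * 2^-1 ^+ n < et.
    have : (fun n => (b - a) * 2^-1 ^+ n) @ \oo --> (b - a) * 0.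
      by apply: cvgM; [exact: cvg_cst|apply: cvg_expr; rewrite ger0_norm// invf_lt1// ltr1n].
    rewrite mulr0 => /cvgr0Pnorm_lt /(_ _ et0); apply: filterS => n; exact: le_lt_trans (ler_norm _).
  have [N2 _ hN2] : \forall n \near \oo, rho / 4 * n.+1%:R^-1 < ep.
    have : (fun n => rho / 4 * n.+1%:R^-1) @ \oo --> rho / 4 * 0.
      by apply: cvgM; [exact: cvg_cst|exact: cvg_harmonic].
    rewrite mulr0 => /cvgr0Pnorm_lt /(_ _ ep0); apply: filterS => n; exact: le_lt_trans (ler_norm _).
  exists (maxn N1 N2) => n; rewrite geq_max => /andP[/hN1 n1 /hN2 n2']; rewrite /= in n1 n2'.
  have /andP[az1 /ltW az2] : a < z < b by rewrite /a /b /z -ltr_distl.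
  have [i ik /andP[i1 i2]] := pt_index n ab az1 az2.
  have Mz : M n i <= gam z + ep.
    apply: Mle => // z' /andP[z1 z2]; apply: het.
    have := ptB a b n i; rewrite -exprVn => w.
    by rewrite ltr_norml; apply/andP; split; lra.
  have Qx : Q n i x.
    apply: bxfP; first by rewrite -/z i1 i2.
    apply/andP; split => //; rewrite /tau.
    move: n2' Mz; set w := rho / 4 / n.+1%:R; rewrite -/z in x2.
    have -> : ep = (sg fl (co s x) - gam z) / 3 by []; move=> *; lra.
  rewrite /h (bigD1 (Ordinal ik))//= indicE mem_set// mulr1 -addrA lerDl addr_ge0 ?(ltW e0)//.
  by apply: sumr_ge0 => j _; rewrite mulr_ge0 ?sqr_ge0// indicE ler0n.
- move=> e e0; exists 0%N => n _.
  have [i1 i2] := Rint_sum mV (fun i : 'I_(2 ^ n) => igh n i (ltn_ord i)).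
  rewrite (ig_fin mV i1) lee_fin i2; apply: (@le_trans _ _ L); last by rewrite lerDl ltW.
  apply: le_trans (colsum n); apply: ler_sum => i _; rewrite -RintegralT.
  have [_ q2] := suQ n i (ltn_ord i).
 have mQ : pmeasurable (Q n i) := measurable_bxf _ _ _ _ _ _.
  exact: (Rint_subset mQ (measurableI _ _ mV mQ) (@subIsetr _ _ _) q2 (fun x _ => sqr_ge0 _)).
Qed.

Lemma bounded_closure_compact Om : bounded_set Om -> compact (closure Om).
Proof.
move=> [M [Mr hM]]; pose m := `|M| + 1.
have sub : Om `<=` cbx true (- m) m (- m) m.
  move=> x Ox; have := hM m _ x Ox; rewrite (le_lt_trans (ler_norm M)) ?ltrDl// => /(_ isT).
  move=> h; split; rewrite -ler_norml; exact: le_trans (co_norm_le _ _) h.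
apply: (@subclosed_compact _ _ (cbx true (- m) m (- m) m)); [exact: closed_closure|exact: compact_cbx|].
by rewrite [X in _ `<=` X](closure_id _).1; [exact: closure_subset|exact: closed_cbx].
Qed.

(** The closure is covered by finitely many boxes, each either inside the domain or meeting
    the domain inside a region above a graph. *)
Lemma boundary_L2 Om u (g : bool -> R * R -> R) : open Om -> bounded_set Om -> smooth_boundary Om ->
  L2loc Om u -> (forall s, sqi mu Om (g s)) -> (forall s, weak_derivative Om (ev s) u (g s)) ->
  sqi mu Om u.
Proof.
move=> oO bO sb lu sgO wd; have mO := open_pmeasurable oO.
pose Gd m := sqi mu (ratbox m `&` Om) u.
have [||r gr cov] := @compact_cover_ratbox _ Gd (closure Om).
- exact: bounded_closure_compact.
- move=> x0 cx; have [Ox|nOx] := pselect (Om x0).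
    have [n [gn [h1 h2]]] := good_nbhd oO Ox; exists n; split => //.
    exact: (sqiS (measurable_ratbox n) (measurableI _ _ (measurable_ratbox n) mO) (@subIsetl _ _ _) (lu n gn)).
  have [|r [gam [sw [fl [r0 sgam hr]]]]] := sb x0; first by rewrite (_ : Om° = Om); [split|exact/interior_id].
  pose s := ~~ sw; pose s0 := co (~~ s) x0; pose t0 := sg fl (co s x0); pose rho := r / 2.
  have rho0 : 0 < rho by rewrite divr_gt0.
  have cg : continuous gam by move=> z; apply: differentiable_continuous; exact: (sgam [::]).
  have hr' x : `|co (~~ s) x - s0| < r -> `|sg fl (co s x) - t0| < r ->
      (Om x <-> gam (co (~~ s) x) < sg fl (co s x)).
    move=> h1 h2; have -> : gam (co (~~ s) x) < sg fl (co s x) = (gam (relabel sw fl x).1 < (relabel sw fl x).2).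
      by rewrite /s /relabel; case: sw {hr s s0 t0 h1 h2}.
    apply: hr; have h3 : `|co s x - co s x0| < r.
      by move: h2; rewrite /t0 !sgE; case: ifP => _ //; rewrite -opprD normrN.
    have hb : `|x0.1 - x.1| < r /\ `|x0.2 - x.2| < r.
      by rewrite (distrC x0.1) (distrC x0.2); move: h1 h3; rewrite /s0 /s; case: (sw) => /= ? ?; split.
    exact: hb.
  have csg : continuous (fun x : R * R => sg fl (co s x)).
    by move=> x; apply: cvgM; [exact: cvg_cst|exact: continuous_co].
  have cga : continuous (fun x : R * R => gam (co (~~ s) x)).
    by move=> x; apply: (@continuous_comp _ _ _ (co (~~ s)) gam); [exact: continuous_co|exact: cg].
  have g0 : gam s0 = t0.
    apply/eqP; rewrite eq_le; apply/andP; split; last first.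
      rewrite leNgt; apply/negP => h; apply: nOx; apply/hr' => //; by rewrite subrr normr0.
    rewrite leNgt; apply/negP => h.
    have d0 : 0 < (gam s0 - t0) / 2 by rewrite divr_gt0// subr_gt0.
    have n1 : \forall x \near x0, `|gam (co (~~ s) x) - gam s0| < (gam s0 - t0) / 2.
      by have /cvgrPdist_lt /(_ _ d0) := cga x0; apply: filterS => x; rewrite distrC.
    have n2' : \forall x \near x0, `|sg fl (co s x) - t0| < (gam s0 - t0) / 2.
      by have /cvgrPdist_lt /(_ _ d0) := csg x0; apply: filterS => x; rewrite distrC.
    have n3 : \forall x \near x0, `|sg fl (co s x) - t0| < r.
      by have /cvgrPdist_lt /(_ _ r0) := csg x0; apply: filterS => x; rewrite distrC.
    have n4 : \forall x \near x0, `|co (~~ s) x - s0| < r.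
      by have /cvgrPdist_lt /(_ _ r0) := @continuous_co _ (~~ s) x0; apply: filterS => x; rewrite distrC.
    have [x [Ox [[h1 h2] [h3 h4]]]] := cx _ (filterI (filterI n1 n2') (filterI n3 n4)).
    have /hr' := Ox => /(_ h4 h3).
    by move: h1 h2; rewrite !ltr_norml => /andP[? ?] /andP[? ?]; lra.
  have [dl [dl0 dlr hdl]] : exists dl, [/\ 0 < dl, dl <= rho & forall z, `|z - s0| <= dl -> `|gam z - t0| <= rho / 4].
    have r4 : 0 < rho / 4 by rewrite divr_gt0.
    have /cvgrPdist_lt /(_ _ r4) := cg s0; move=> /nbhs_ballP[et et0 h1].
    exists (Num.min (et / 2) rho); split; [by rewrite lt_min divr_gt0//|by rewrite ge_min lexx orbT|].
    move=> z; rewrite le_min => /andP[z1 z2]; rewrite -g0 distrC; apply/ltW/h1.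
    by rewrite /ball /= distrC (le_lt_trans z1)//; rewrite ltr_pdivrMr// mulr2n mulrDr mulr1 ltrDl.
  have hV := @graph_region Om s fl gam s0 t0 dl rho u (g s) oO lu (sgO s) (wd s) dl0 rho0 cg hdl.
  set V := [set x | _ /\ _] in hV.
  have [mV sV] : pmeasurable V /\ sqi mu V u.
    apply: hV => x h1 h2; apply: hr'.
      by apply: (le_lt_trans h1); apply: (le_lt_trans dlr); rewrite /rho; lra.
    by apply: (le_lt_trans h2); rewrite /rho; lra.
  pose N := [set x : R * R | co (~~ s) x - (s0 + dl) < 0] `&` [set x | (s0 - dl) - co (~~ s) x < 0] `&`
    [set x | (t0 - rho) - sg fl (co s x) < 0] `&` [set x | sg fl (co s x) - (t0 + rho) < 0].
  have oN : open N.
    do ?apply: openI; apply: open_lt0 => x.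
    - by apply: cvgB; [exact: continuous_co|exact: cvg_cst].
    - by apply: cvgB; [exact: cvg_cst|exact: continuous_co].
    - by apply: cvgB; [exact: cvg_cst|exact: csg].
    - by apply: cvgB; [exact: csg|exact: cvg_cst].
  have Nx0 : N x0 by rewrite /N /=; repeat split; rewrite -/s0 -/t0; lra.
  have [n [gn [h1 h2]]] := good_nbhd oN Nx0; exists n; split => //.
  have NV : ratbox n `&` Om `<=` V.
    move=> x [/(ratbox_sub gn) [[[k1 k2] k3] k4] Ox]; rewrite /= in k1 k2 k3 k4.
    have k5 : `|co (~~ s) x - s0| < dl by rewrite ltr_norml; lra.
    split => //; apply/andP; split; last lra.
    by apply/hr' => //; rewrite ?ltr_norml; move: k5; rewrite ltr_norml /rho => *; rewrite /rho in dlr k3 k4; lra.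
  exact: (sqiS mV (measurableI _ _ (measurable_ratbox n) mO) NV sV).
apply: (@sqi_cover _ _ _ r (fun m => ratbox m `&` Om)) => //.
- by move=> m _; exact: measurableI.
- by move=> x Ox; have [m mr bm] := cov _ (subset_closure Ox); exists m.
Qed.

End Boundary.

(** * Averages over rational boxes, and compactness *)

(** Along an ultrafilter finer than the cofinite one, every bounded sequence converges; a
    subsequence is then read off from the first [k] limits at each stage [k]. *)
Lemma diagonal_subseq {R : realType} (X : nat -> nat -> R) (B : nat -> R) :
  (forall j k, `|X j k| <= B j) ->
  exists2 s : nat -> nat, (forall k, (k <= s k)%N) & forall j, cvgn (fun k => X j (s k)).
Proof.
move=> XB; have [G [uG oG]] := @ultraFilterLemma nat \oo _.
have /choice[l hl] : forall j, exists l : R, forall e, 0 < e -> G [set k | `|l - X j k| < e].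
  move=> j; have cB : compact `[- B j, B j]%classic by exact: segment_compact.
  have GB : (X j @ G) `[- B j, B j]%classic.
    apply: oG; exists 0%N => // k _; rewrite /= in_itv/= -ler_norml; exact: XB.
  have [l [_ cl]] := cB (X j @ G) _ GB; exists l => e e0.
  have [//|nG] := in_ultra_setVsetC [set k | `|l - X j k| < e] uG.
  have [y []] := cl [set y | ~ `|l - y| < e] (ball l e) nG (nbhsx_ballx l e e0).
  by [].
have /choice[s hs] : forall k, exists m, (k <= m)%N /\ forall j, (j <= k)%N -> `|l j - X j m| < k.+1%:R^-1.
  move=> k; have h1 : G [set m | (k <= m)%N] by apply: oG; exists k.
  have h2 q : G [set m | forall j, (j < q)%N -> `|l j - X j m| < k.+1%:R^-1].
    elim: q => [|q IH]; first by apply: oG; exists 0%N.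
    have k0 : (0 : R) < k.+1%:R^-1 by rewrite invr_gt0.
    apply: filterS (filterI IH (hl q _ k0)) => m [m1 m2] j.
    by rewrite ltnS leq_eqVlt => /predU1P[->|/m1].
  by have [m [m1 m2]] := filter_ex (filterI h1 (h2 k.+1)); exists m.
exists s => [k|j]; first by case: (hs k).
apply/cvg_ex; exists (l j); apply/cvgrPdist_lt => e e0.
have [N _ hN] : \forall n \near \oo, (n.+1%:R^-1 : R) < e.
  have /cvgr0Pnorm_lt /(_ _ e0) := @cvg_harmonic R; apply: filterS => n; exact: le_lt_trans (ler_norm _).
exists (maxn j N) => // k /=; rewrite geq_max => /andP[jk Nk].
by apply: lt_trans (hN k Nk); apply: (hs k).2.
Qed.

Lemma cvgn_cauchy {R : realType} (v : nat -> R) (e : R) : 0 < e -> cvgn v ->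
  exists N, forall k l, (N <= k)%N -> (N <= l)%N -> `|v k - v l| <= e.
Proof.
move=> e0 /cvg_ex[l /cvgrPdist_lt /(_ (e / 2))]; rewrite divr_gt0// => /(_ isT)[N _ hN].
exists N => i j /hN h1 /hN h2; rewrite /= in h1 h2.
by have := ler_distD l (v i) (v j); rewrite (distrC (v i) l); lra.
Qed.

Section Averages.
Context {R : realType}.
Implicit Types (s : bool) (Om : set (R * R)) (u f : R * R -> R).
Local Notation mu := (@leb2 R).

Definition area n : R := (rb n - ra n) * (rd n - rc n).
Definition av n u : R := (\int[mu]_(x in ratbox n) u x) / area n.
Definition boxint n : set (R * R) := [set x | ra n < x.1 < rb n /\ rc n < x.2 < rd n].

Lemma area_gt0 Om n : good Om n -> 0 < area n.
Proof. by move=> [h1 h2 _]; rewrite mulr_gt0// subr_gt0. Qed.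

Lemma ratbox_lty n : (mu (ratbox n) < +oo)%E.
Proof. exact: leb2_rect_lty. Qed.

Lemma fine_ratbox Om n : good Om n -> fine (mu (ratbox n)) = area n.
Proof. by move=> [h1 h2 _]; rewrite leb2_rect ?ltW. Qed.

Lemma open_boxint n : open (boxint n).
Proof.
rewrite (_ : boxint n = [set x | ra n - co false x < 0] `&` [set x | co false x - rb n < 0] `&`
    [set x | rc n - co true x < 0] `&` [set x | co true x - rd n < 0]).
  do ?apply: openI; apply: open_lt0 => x; apply: cvgB; by [exact: cvg_cst|exact: continuous_co].
apply/seteqP; split => x; rewrite /boxint /= !subr_lt0.
  by move=> [/andP[? ?] /andP[? ?]].
by move=> [[[-> ->] ->] ->].
Qed.

(** The average of [u - av n u] over the smaller box is controlled by the Poincare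
    inequality on the larger one. The summand 1 avoids a square root, as
    [t <= 1 + t ^ 2]. *)
Lemma average_diff Om n m u (g : bool -> R * R -> R) M : open Om -> good Om n -> good Om m ->
  @ratbox R m `<=` ratbox n -> L2loc Om u -> (forall s, sqi mu Om (g s)) ->
  (forall s, weak_derivative Om (ev s) u (g s)) -> (forall s, n2 mu Om (g s) <= M) ->
  `|av m u - av n u| <= 1 + (2 * (rd n - rc n) ^+ 2 + 2 * (rb n - ra n) ^+ 2) * M / area m.
Proof.
move=> oO gn gm mn lu sgO wd gM; have [ab cd sO] := gn.
have mO := open_pmeasurable oO; have mN := @measurable_ratbox R n; have mM := @measurable_ratbox R m.
have am := area_gt0 gm.
have sg' s : sqi mu (ratbox n) (g s) by exact: (sqiS mO mN (ratbox_sub gn) (sgO s)).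
have gM' s : n2 mu (ratbox n) (g s) <= M.
  exact: le_trans (n2_subset mO mN (ratbox_sub gn) (sgO s)) (gM s).
have := poincare wd sO ab cd (lu n gn) sg'.
rewrite -/(area n) -/(av n u) -/(ratbox n) => hp.
have scn : sqi mu (ratbox n) (cst (av n u)) by apply: sqi_cst => //; exact: ratbox_lty.
have scm : sqi mu (ratbox m) (cst (av n u)) by apply: sqi_cst => //; exact: ratbox_lty.
have sw : sqi mu (ratbox n) (fun x => u x - av n u) by exact: (sqiB mN (lu n gn) scn).
have sw' : sqi mu (ratbox m) (fun x => u x - av n u) by exact: (sqiS mN mM mn sw).
have iu : ig mu (ratbox m) u by apply: sqi_ig (lu m gm) => //; exact: ratbox_lty.
have E : av m u - av n u = (\int[mu]_(x in ratbox m) (u x - av n u)) / area m.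
  rewrite RintegralB//; last by apply: ig_cst => //; exact: ratbox_lty.
  case: gm => h1 h2 _; rewrite Rint_cst_rect ?ltW// -/(area m) mulrBl mulfK// gt_eqF//.
have h2 := sq_Rint_le mM (ratbox_lty m) sw'; rewrite (fine_ratbox gm) in h2.
have h3 := n2_subset mN mM mn sw.
have h4 : n2 mu (ratbox n) (fun x => u x - av n u) <= (2 * (rd n - rc n) ^+ 2 + 2 * (rb n - ra n) ^+ 2) * M.
  apply: (le_trans hp); rewrite [leRHS]mulrDl; apply: lerD; apply: ler_wpM2l => //; by rewrite mulr_ge0 ?sqr_ge0.
set C := _ * M in h4 *.
have h5 : (av m u - av n u) ^+ 2 <= C / area m.
  rewrite E expr_div_n expr2 ler_pdivrMr ?exprn_gt0// expr2 mulrACA -expr2 [leRHS]mulrA divfK ?gt_eqF//.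
  by apply: (le_trans h2); rewrite mulrC ler_wpM2r ?(ltW am)// (le_trans h3).
set t := av m u - av n u in h5 *.
have : `|t| ^+ 2 <= C / area m by rewrite real_normK ?num_real.
by have := sqr_ge0 (`|t| - 1); nra.
Qed.

Section Chain.
Variables (Om : set (R * R)) (u : nat -> R * R -> R) (g : nat -> bool -> R * R -> R) (M : R).
Hypotheses (oO : open Om) (cO : connected Om) (lu : forall k, L2loc Om (u k)).
Hypotheses (sgO : forall k s, sqi mu Om (g k s)).
Hypotheses (wd : forall k s, weak_derivative Om (ev s) (u k) (g k s)).
Hypotheses (gM : forall k s, n2 mu Om (g k s) <= M).

(** Both averages are compared with the average over a common smaller box. *)
Lemma boxint_diff n n' x : good Om n -> good Om n' -> boxint n x -> boxint n' x ->
  exists B, forall k, `|av n (u k) - av n' (u k)| <= B.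
Proof.
move=> gn gn' nx nx'.
have [m [gm _]] := good_nbhd (openI (@open_boxint n) (@open_boxint n')) (conj nx nx').
have sub : @ratbox R m `<=` ratbox n /\ @ratbox R m `<=` ratbox n'.
  by split=> y /(ratbox_sub gm) [h1 h2]; apply/rectP; case: h1 h2 => ? ? [? ?]; split; lra.
have gm' : good Om m.
  case: gm => h1 h2 h3; split => // y /h3 [[y1 y2] _]; case: gn => _ _; apply.
  by split => /=; lra.
exists ((1 + (2 * (rd n - rc n) ^+ 2 + 2 * (rb n - ra n) ^+ 2) * M / area m) +
  (1 + (2 * (rd n' - rc n') ^+ 2 + 2 * (rb n' - ra n') ^+ 2) * M / area m)) => k.
apply: le_trans (ler_distD (av m (u k)) _ _) _; apply: lerD.
  by rewrite distrC; exact: (average_diff oO gn gm' sub.1 (lu k) (sgO k) (wd k) (gM k)).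
exact: (average_diff oO gn' gm' sub.2 (lu k) (sgO k) (wd k) (gM k)).
Qed.

(** The boxes whose averages stay at bounded distance from those of a given box cover a
    relatively clopen part of the domain. *)
Lemma averages_chain : exists c : nat -> R, forall n, good Om n ->
  exists B, forall k, `|av n (u k) - c k| <= B.
Proof.
have [[n0 gn0]|no] := pselect (exists n, good Om n); last first.
  by exists (fun=> 0) => n gn; case: no; exists n.
exists (fun k => av n0 (u k)).
pose bd n := exists B, forall k, `|av n (u k) - av n0 (u k)| <= B.
have tr n n' x : good Om n -> good Om n' -> boxint n x -> boxint n' x -> bd n' -> bd n.
  move=> gn gn' nx nx' [B hB]; have [B' hB'] := boxint_diff gn gn' nx nx'.
  exists (B' + B) => k; apply: le_trans (ler_distD (av n' (u k)) _ _) _.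
  by apply: lerD; [exact: hB'|exact: hB].
have mid n : good Om n -> exists2 x, Om x & boxint n x.
  move=> [ab cd sO]; exists ((ra n + rb n) / 2, (rc n + rd n) / 2).
    by apply: sO; split => /=; lra.
  by split => /=; lra.
pose W (P : Prop -> Prop) := \bigcup_(n in [set n | good Om n /\ P (bd n)]) boxint n.
have oW P : open (W P) by apply: bigcup_open => n _; exact: open_boxint.
pose W1 := Om `&` W id.
have W1E : W1 = Om.
  apply: cO.
  - by have [x Ox xn] := mid _ gn0; exists x; split => //; exists n0 => //; split => //; exists 0 => k; rewrite subrr normr0.
  - by exists (W id).
  - exists (~` W not); first by apply: open_closedC.
    apply/seteqP; split => x [Ox].
      move=> [n [gn bn] nx]; split => // -[n' [gn' nbn'] n'x]; apply: nbn'.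
      exact: (tr n' n x).
    move=> h; split => //; have [n [gn nx]] := good_nbhd oO Ox; exists n => //; split => //.
    by apply: contrapT => nb; apply: h; exists n.
move=> n gn; have [x Ox nx] := mid n gn; rewrite -W1E in Ox; case: Ox => _ [n' [gn' bn'] n'x].
exact: (tr n n' x).
Qed.

Lemma ratbox_cell n k i j : exists m, [/\ ra m = pt (ra n) (rb n) k i :> R, rb m = pt (ra n) (rb n) k i.+1 :> R,
  rc m = pt (rc n) (rd n) k j :> R & rd m = pt (rc n) (rd n) k j.+1 :> R].
Proof.
have pr (p q : rat) a : exists t : rat, pt (ratr p) (ratr q) k a = ratr t :> R.
  exists (p + (q - p) * (a%:R / 2 ^+ k)).
  by rewrite /pt !(rmorphD, rmorphM, rmorphN, fmorphV, rmorphXn, rmorph_nat, rmorph1).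
have [t1 e1] := pr (rats n).1.1.1 (rats n).1.1.2 i; have [t2 e2] := pr (rats n).1.1.1 (rats n).1.1.2 i.+1.
have [t3 e3] := pr (rats n).1.2 (rats n).2 j; have [t4 e4] := pr (rats n).1.2 (rats n).2 j.+1.
have [m [h1 h2 h3 h4]] := @ratboxP R t1 t2 t3 t4; exists m.
by rewrite h1 h2 h3 h4 -e1 -e2 -e3 -e4.
Qed.

(** By the Poincare inequality on the cells of a fine grid, each function is close to the
    step function of its averages over the cells, uniformly in the sequence; and the
    finitely many sequences of averages converge. *)
Lemma averages_compact n : (forall m, good Om m -> cvgn (fun k => av m (u k))) -> good Om n ->
  forall e : R, 0 < e -> exists N, forall k l, (N <= k)%N -> (N <= l)%N ->
    n2 mu (ratbox n) (fun x => u k x - u l x) <= e.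
Proof.
move=> hc gn e e0; have [ab cd sO] := gn.
have mO := open_pmeasurable oO; have mN := @measurable_ratbox R n.
pose a : R := ra n; pose b : R := rb n; pose c : R := rc n; pose d : R := rd n.
have M0 : 0 <= M by apply: le_trans (gM 0 true); exact: n2_ge0.
pose C : R := 16 * ((d - c) ^+ 2 + (b - a) ^+ 2) * M.
have C0 : 0 <= C by rewrite /C !mulr_ge0// addr_ge0 ?sqr_ge0.
have [q hq] : exists q, 2 * C * 2^-1 ^+ q <= e / 2.
  have : (fun q => 2 * C * 2^-1 ^+ q) @ \oo --> 2 * C * 0.
    by apply: cvgM; [exact: cvg_cst|apply: cvg_expr; rewrite ger0_norm// invf_lt1// ltr1n].
  rewrite mulr0 => /cvgr0Pnorm_lt /(_ (e / 2)); rewrite divr_gt0// => /(_ isT)[q _ hq]; exists q.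
  by apply/ltW/(le_lt_trans (ler_norm _))/hq => /=.
have /choice[m hm] : forall ij : 'I_(2 ^ q) * 'I_(2 ^ q), exists m, [/\ ra m = pt a b q ij.1 :> R,
    rb m = pt a b q ij.1.+1 :> R, rc m = pt c d q ij.2 :> R & rd m = pt c d q ij.2.+1 :> R].
  by move=> ij; exact: ratbox_cell.
have mE ij : @ratbox R (m ij) = cell a b c d q ij.1 ij.2.
  by rewrite /ratbox /cell; have [-> -> -> ->] := hm ij.
have gm ij : good Om (m ij).
  rewrite /good; have [-> -> -> ->] := hm ij; split; [by rewrite pt_lt|by rewrite pt_lt|].
  move=> x xc; apply: sO; move: x xc; apply: cbx_sub.
  - by case: (@pt_range R a b q ij.1 (ltW ab) (ltn_ord _)).
  - by case: (@pt_range R a b q ij.1 (ltW ab) (ltn_ord _)).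
  - by case: (@pt_range R c d q ij.2 (ltW cd) (ltn_ord _)).
  - by case: (@pt_range R c d q ij.2 (ltW cd) (ltn_ord _)).
pose A : R := area n; have A0 : 0 < A := area_gt0 gn.
have [N hN] : exists N, forall k l, (N <= k)%N -> (N <= l)%N ->
    forall ij, (av (m ij) (u k) - av (m ij) (u l)) ^+ 2 <= e / 4 / A.
  pose e' : R := Num.sqrt (e / 4 / A); have e'0 : 0 < e' by rewrite sqrtr_gt0 !divr_gt0.
  have /choice[N hN] : forall ij, exists N, forall k l, (N <= k)%N -> (N <= l)%N ->
      `|av (m ij) (u k) - av (m ij) (u l)| <= e'.
    by move=> ij; apply: cvgn_cauchy => //; exact: hc.
  exists (\max_ij N ij)%N => k l Nk Nl ij.
  have h := hN ij k l (leq_trans (leq_bigmax _) Nk) (leq_trans (leq_bigmax _) Nl).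
  rewrite -real_normK ?num_real// -[leRHS]sqr_sqrtr ?ler_pXn2r ?nnegrE ?(ltW e'0)//.
  by rewrite !divr_ge0 ?(ltW e0) ?(ltW A0).
exists N => k l Nk Nl; pose w x := u k x - u l x; pose h s x := g k s x - g l s x.
have lw : L2loc Om w by exact: L2locB.
have sh s : sqi mu Om (h s) by apply: sqiB.
have hh s : n2 mu Om (h s) <= 4 * M.
  apply: (le_trans (n2B_le mO (sgO k s) (sgO l s))); have := gM k s; have := gM l s; lra.
have wdh s : weak_derivative Om (ev s) w (h s).
  by apply: weak_derivativeB; auto; apply: sqi_L2loc.
have sub ij : @ratbox R (m ij) `<=` ratbox n.
  by rewrite mE; exact: (cell_sub ab cd (ltn_ord _) (ltn_ord _)).
have cellE f : ig mu (ratbox n) f ->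
    \int[mu]_(x in ratbox n) f x = \sum_(ij : 'I_(2 ^ q) * 'I_(2 ^ q)) \int[mu]_(x in ratbox (m ij)) f x.
  move=> i; rewrite /ratbox (Rint_cells ab cd q i) pair_bigA /=; apply: eq_bigr => ij _; by rewrite -mE.
pose r : R := 2^-1 ^+ q.
have r0 : 0 < r by rewrite exprn_gt0.
have r1 : r <= 1 by rewrite exprn_ile1// invf_le1// ler1n.
have sz ij : rb (m ij) - ra (m ij) = (b - a) * r /\ rd (m ij) - rc (m ij) = (d - c) * r.
  by have [-> -> -> ->] := hm ij; rewrite !ptB /r exprVn.
have one ij : n2 mu (ratbox (m ij)) w <= 2 * (A * r ^+ 2) * (e / 4 / A) +
    4 * r * ((d - c) ^+ 2 + (b - a) ^+ 2) * (n2 mu (ratbox (m ij)) (h true) + n2 mu (ratbox (m ij)) (h false)).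
  have mm := @measurable_ratbox R (m ij).
  have sw : sqi mu (ratbox (m ij)) w by exact: lw.
  have sc : sqi mu (ratbox (m ij)) (cst (av (m ij) w)) by apply: sqi_cst => //; exact: ratbox_lty.
  have [gm1 gm2 gm3] := gm ij.
  have shm s : sqi mu (ratbox (m ij)) (h s) by exact: (sqiS mO mm (ratbox_sub (gm ij)) (sh s)).
  set nt := n2 mu (ratbox (m ij)) (h true); set nf := n2 mu (ratbox (m ij)) (h false).
  have hp : n2 mu (ratbox (m ij)) (fun x => w x - cst (av (m ij) w) x) <=
      2 * (rd (m ij) - rc (m ij)) ^+ 2 * nt + 2 * (rb (m ij) - ra (m ij)) ^+ 2 * nf.
    exact: (poincare wdh gm3 gm1 gm2 sw shm).
  have wE : n2 mu (ratbox (m ij)) w =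
      n2 mu (ratbox (m ij)) (fun x => w x - cst (av (m ij) w) x + cst (av (m ij) w) x).
    by apply: eq_n2 => x _; rewrite /= subrK.
  rewrite wE; apply: (le_trans (n2D_le mm (sqiB mm sw sc) sc)).
  have -> : n2 mu (ratbox (m ij)) (cst (av (m ij) w)) = av (m ij) w ^+ 2 * (A * r ^+ 2).
    rewrite /n2 /= Rint_cst_rect ?ltW//; have [-> ->] := sz ij.
    by rewrite /A /area; ring.
  have avE : av (m ij) w = av (m ij) (u k) - av (m ij) (u l).
    rewrite /av -mulrBl -RintegralB//; by [apply: sqi_ig (lu _ (gm ij)); [|exact: ratbox_lty]].
  have h1 := hN k l Nk Nl ij; rewrite -avE in h1.
  have Ar : 0 <= A * r ^+ 2 by rewrite mulr_ge0 ?sqr_ge0// ltW.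
  have h2 := ler_wpM2r Ar h1.
  have [z1 z2] := sz ij; rewrite z1 z2 in hp.
  have r2 : r ^+ 2 <= r by rewrite expr2 ler_piMr// ltW.
  have nt0 : 0 <= nt by exact: n2_ge0.
  have nf0 : 0 <= nf by exact: n2_ge0.
  have h3 : n2 mu (ratbox (m ij)) (fun x => w x - cst (av (m ij) w) x) <=
      2 * r * ((d - c) ^+ 2 + (b - a) ^+ 2) * (nt + nf).
    apply: (le_trans hp).
    have d0 := sqr_ge0 (d - c); have b0 := sqr_ge0 (b - a).
    have k1 : ((d - c) * r) ^+ 2 <= (d - c) ^+ 2 * r by rewrite exprMn ler_wpM2l.
    have k2 : ((b - a) * r) ^+ 2 <= (b - a) ^+ 2 * r by rewrite exprMn ler_wpM2l.
    have k3 := ler_wpM2r nt0 k1; have k4 := ler_wpM2r nf0 k2.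
    have k5 : 0 <= (b - a) ^+ 2 * r * nt := mulr_ge0 (mulr_ge0 b0 (ltW r0)) nt0.
    have k6 : 0 <= (d - c) ^+ 2 * r * nf := mulr_ge0 (mulr_ge0 d0 (ltW r0)) nf0.
    by clear -k3 k4 k5 k6; lra.
  by clear -h2 h3; lra.
have sumh s : \sum_ij n2 mu (ratbox (m ij)) (h s) <= 4 * M.
  have sn : sqi mu (ratbox n) (h s) by exact: (sqiS mO mN (ratbox_sub gn) (sh s)).
  rewrite /n2 -cellE; last by case: sn.
  exact: le_trans (n2_subset mO mN (ratbox_sub gn) (sh s)) (hh s).
have snw : ig mu (ratbox n) (fun x => w x ^+ 2) by case: (lw n gn).
rewrite -/w {1}/n2 cellE//; have S : \sum_ij n2 mu (ratbox (m ij)) w <= \sum_ij (2 * (A * r ^+ 2) * (e / 4 / A) +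
    4 * r * ((d - c) ^+ 2 + (b - a) ^+ 2) * (n2 mu (ratbox (m ij)) (h true) + n2 mu (ratbox (m ij)) (h false))).
  by apply: ler_sum => ij _; exact: one.
apply: (le_trans S).
rewrite big_split /= -[X in _ + X]mulr_sumr big_split /= sumr_const card_prod card_ord.
have -> : 2 * (A * r ^+ 2) * (e / 4 / A) *+ (2 ^ q * 2 ^ q) = e / 2.
  rewrite -mulr_natr natrM natrX /r exprVn; field; rewrite ?gt_eqF// ?exprn_gt0//.
have k1 := sumh true; have k2 := sumh false.
have k3 : 0 <= 4 * r * ((d - c) ^+ 2 + (b - a) ^+ 2) by rewrite !mulr_ge0 ?addr_ge0 ?sqr_ge0// ltW.
have k4 := ler_wpM2l k3 (lerD k1 k2).
have k5 : 4 * r * ((d - c) ^+ 2 + (b - a) ^+ 2) * (4 * M + 4 * M) = 2 * C * r by rewrite /C; ring.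
by rewrite k5 in k4; move: hq; rewrite -/r; clear -k4; lra.
Qed.

End Chain.
End Averages.

(** * Compactness and closedness in the local Sobolev space *)

Section SobolevCompactness.
Context {R : realType}.
Implicit Types (s : bool) (Om : set (R * R)) (u f : R * R -> R).
Local Notation mu := (@leb2 R).

Lemma cvg_subseq (v : nat -> R) (t : nat -> nat) (l : R) : (forall k, (k <= t k)%N) ->
  v @ \oo --> l -> (fun k => v (t k)) @ \oo --> l.
Proof.
move=> ht /cvgrPdist_lt hv; apply/cvgrPdist_lt => e /hv[N _ hN].
by exists N => // k /= Nk; apply: hN; exact: leq_trans Nk (ht k).
Qed.

(** One subsequence serves countably many sequences of functions and of reals: the averages
    over all good boxes converge by a diagonal argument, so that the functions are Cauchy
    on each box, and a further subsequence converges almost everywhere. *)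
Lemma sobolev_family_compact (J J' : countType) Om (f : J -> nat -> R * R -> R)
  (g : J -> nat -> bool -> R * R -> R) (M : J -> R) (Y : J' -> nat -> R) (BY : J' -> R) :
  open Om -> (forall j k, L2loc Om (f j k)) -> (forall j k s, sqi mu Om (g j k s)) ->
  (forall j k s, weak_derivative Om (ev s) (f j k) (g j k s)) ->
  (forall j k s, n2 mu Om (g j k s) <= M j) ->
  (forall j n, good Om n -> exists B, forall k, `|av n (f j k)| <= B) ->
  (forall j k, `|Y j k| <= BY j) ->
  exists (t : nat -> nat) (fs : J -> R * R -> R),
  [/\ forall k, (k <= t k)%N, forall j, cvgn (fun k => Y j (t k)), forall j, L2loc Om (fs j),
      forall j n, good Om n ->
        (fun k => n2 mu (ratbox n) (fun x => f j (t k) x - fs j x)) @ \oo --> (0 : R) &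
      forall j, {ae mu, forall x, Om x -> (fun k => f j (t k) x) @ \oo --> fs j x}].
Proof.
move=> oO lf sg wd gM avB YB.
pose X m k := match (unpickle m : option ((J * nat) + J')) with
  | Some (inl (j, n)) => if `[< good Om n >] then av n (f j k) else 0
  | Some (inr y) => Y y k
  | None => 0 end.
have /choice[B XB] : forall m, exists B, forall k, `|X m k| <= B.
  move=> m; rewrite /X; case: (unpickle m) => [[[j n]|y]|].
  - case: asboolP => [/avB|_]; first exact.
    by exists 0 => k; rewrite normr0.
  - by exists (BY y).
  - by exists 0 => k; rewrite normr0.
have [t1 ht1 ct1] := diagonal_subseq XB.
have ct1av j n : good Om n -> cvgn (fun k => av n (f j (t1 k))).
  move=> gn; have := ct1 (pickle (inl (j, n) : (J * nat) + J')); rewrite /X pickleK.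
  by case: asboolP.
have cauchy j n : good Om n -> forall e : R, 0 < e -> exists N, forall k l, (N <= k)%N -> (N <= l)%N ->
    n2 mu (ratbox n) (fun x => f j (t1 k) x - f j (t1 l) x) <= e.
  move=> gn; apply: (@averages_compact _ Om (fun k => f j (t1 k)) (fun k => g j (t1 k)) (M j)) => //.
  by move=> m; exact: ct1av.
pose F m k := match (unpickle m : option (J * nat)) with
  | Some (j, n) => if `[< good Om n >] then f j (t1 k) else cst 0
  | None => cst 0 end.
pose Q m := match (unpickle m : option (J * nat)) with Some (j, n) => @ratbox R n | None => set0 end.
have mQ m : pmeasurable (Q m) by rewrite /Q; case: unpickle => [[j n]|//]; exact: measurable_ratbox.
have sqi0 (A : set (R * R)) : pmeasurable A -> sqi mu A (cst 0).
  move=> mA; split; first exact: measurable_cst.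
  by rewrite /ig (_ : EFin \o _ = cst 0%E); [exact: integrable0|apply/funext => x /=; rewrite expr0n].
have [| |t2 ht2 ct2] := @ae_cvg_subseq _ _ _ mu F Q mQ.
- move=> m k; rewrite /F /Q; case: unpickle => [[j n]|]; last exact: sqi0.
  by case: asboolP => [gn|_]; [exact: lf|apply: sqi0; exact: measurable_ratbox].
- move=> m e e0; have zero (A : set (R * R)) : n2 mu A (fun x => cst 0 x - cst 0 x) <= e.
    rewrite /n2 /Rintegral (eq_integral (cst 0%E)) ?integral0 ?ltW// => x _.
    by rewrite /= subrr expr0n.
  rewrite /F /Q; case: unpickle => [[j n]|]; last by exists 0%N.
  by case: asboolP => [gn|_]; [exact: cauchy|exists 0%N].
pose t k := t1 (t2 k); pose fs j := limfun (fun k => f j (t k)).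
have ht k : (k <= t k)%N by exact: leq_trans (ht2 k) (ht1 _).
have aen j n : good Om n -> {ae mu, forall x, ratbox n x -> (fun k => f j (t k) x) @ \oo --> fs j x}.
  move=> gn; have := ct2 (pickle (j, n)); rewrite /F /Q pickleK; case: asboolP => // _.
  by apply: aeS => x h /h; exact: limfunE.
have key j n : good Om n -> sqi mu (ratbox n) (fs j) /\
    (fun k => n2 mu (ratbox n) (fun x => f j (t k) x - fs j x)) @ \oo --> (0 : R).
  move=> gn; have mn := @measurable_ratbox R n.
  have [] := @L2_limit _ _ _ mu (ratbox n) (fun k => f j (t1 k)) t2 (fs j) mn.
  - by move=> k; exact: lf.
  - by apply: measurable_limfun => k; case: (lf j (t k) n gn).
  - exact: cauchy.
  - exact: ht2.
  - exact: aen.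
  - move=> s1 hc; split => //; apply: (@cvg_subseq (fun k => n2 mu (ratbox n) (fun x => f j (t1 k) x - fs j x)) t2) => //.
    apply/cvgrPdist_le => e /hc[N hN]; exists N => // k /= /hN.
    by rewrite sub0r normrN ger0_norm// n2_ge0.
exists t, fs; split => //.
- move=> y; have := ct1 (pickle (inr y : (J * nat) + J')); rewrite /X pickleK => /cvg_ex[l hl].
  apply/cvg_ex; exists l; exact: (@cvg_subseq (fun k => Y y (t1 k)) t2).
- by move=> j n /(key j)[].
- by move=> j n /(key j)[].
- move=> j; have : forall n, {ae mu, forall x, good Om n -> ratbox n x -> (fun k => f j (t k) x) @ \oo --> fs j x}.
    move=> n; have [gn|ngn] := pselect (good Om n); first by apply: aeS (aen j n gn).
    by apply: aeW.
  move=> /ae_foralln; apply: aeS => x hx Ox.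
  have := Ox; rewrite {1}(open_bigcup oO) => -[n gn nx]; exact: (hx n).
Qed.

(** The functionals [h |-> \int h phi] of the derivatives converge, because the
    functions do; the weak limit along them is again a weak derivative. *)
Lemma weak_derivative_closed Om s (F h : nat -> R * R -> R) f (L : R) : open Om -> (mu Om < +oo)%E ->
  (forall k, L2loc Om (F k)) -> L2loc Om f ->
  (forall n, good Om n -> (fun k => n2 mu (ratbox n) (fun x => F k x - f x)) @ \oo --> (0 : R)) ->
  (forall k, sqi mu Om (h k)) -> (forall k, weak_derivative Om (ev s) (F k) (h k)) ->
  (fun k => n2 mu Om (h k)) @ \oo --> L ->
  exists g, [/\ sqi mu Om g, n2 mu Om g <= L & weak_derivative Om (ev s) f g].
Proof.
move=> oO fO lF lf hc sh wd hL; have mO := open_pmeasurable oO.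
have [|g [sg gL hg]] := @weak_compactness _ _ _ mu Om h L mO sh.
  move=> e e0; have /cvgrPdist_le /(_ _ e0) [N _ hN] := hL; exists N => k /hN /=.
  by rewrite ler_norml => /andP[]; lra.
exists g; split => //; apply/(weak_derivativeP _ oO lf (sqi_L2loc oO sg)) => phi tp.
have sphi : sqi mu Om phi.
  have [C C0 hC] := cc_bound (cc_test tp).
  apply: (@sqi_le _ _ _ _ _ _ (cst (C ^+ 2))) => //; last exact: ig_cst.
    apply: measurable_funTS; apply: continuous_pmeasurable; by case: (cc_test tp).
  move=> x _; rewrite -real_normK ?num_real// ler_pXn2r ?nnegrE//.
rewrite (hg phi (- \int[mu]_(x in Om) (f x * 'D_(ev s) phi x)) sphi) ?opprK//.
rewrite (_ : (fun k => _) = fun k => - \int[mu]_(x in Om) (F k x * 'D_(ev s) phi x)).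
  by apply: cvgN; exact: (L2loc_cvg_test oO (cc_derive (ev s) tp) lF lf hc).
apply/funext => k.
by rewrite ((weak_derivativeP (ev s) oO (lF k) (sqi_L2loc oO (sh k))).1 (wd k) phi tp) opprK.
Qed.

Lemma weak_derivative_shift Om s u g (c : R) : open Om -> L2loc Om u -> L2loc Om g ->
  weak_derivative Om (ev s) u g -> weak_derivative Om (ev s) (fun x => u x - c) g.
Proof.
move=> oO lu lg wd.
have := weak_derivativeB oO lu lg (@L2loc_cst _ Om c) (@L2loc_cst _ Om 0) wd (@weak_derivative_cst _ Om s c oO).
by rewrite [X in weak_derivative _ _ _ X](_ : _ = g)//; apply/funext => x /=; rewrite subr0.
Qed.

End SobolevCompactness.

(** * The energy of an admissible pair *)

Section Energy.
Context {R : realType}.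
Implicit Types (s : bool) (Om : set (R * R)) (u v f p I : R * R -> R).
Local Notation mu := (@leb2 R).

Lemma leb2_bounded Om : pmeasurable Om -> bounded_set Om -> (mu Om < +oo)%E.
Proof.
move=> mO [M [Mr hM]]; pose m := `|M| + 2.
have sub : Om `<=` bx true (- m) m (- m) m.
  move=> x Ox; have h : `|x| <= `|M| + 1.
    by apply: (hM (`|M| + 1)) => //; rewrite (le_lt_trans (ler_norm M)) ?ltrDl.
  have k s : - m < co s x <= m.
    by have := le_trans (co_norm_le s x) h; rewrite ler_norml /m => /andP[? ?]; apply/andP; split; lra.
  by apply/bxP.
apply: le_lt_trans (leb2_bx_lty true (- m) m (- m) m).
by apply: le_measure => //; rewrite inE//; exact: measurable_bx.
Qed.

Lemma L2P Om f : pmeasurable Om -> L2 Om f <-> sqi mu Om f.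
Proof.
move=> mO.
have E : (\int[mu]_x (`|(EFin \o (f \_ Om)) x| `^ 2%R))%E = (\int[mu]_(x in Om) (f x ^+ 2)%:E)%E.
  rewrite [RHS]integral_mkcond; apply: eq_integral => x _.
  have -> : (`|(EFin \o (f \_ Om)) x| `^ 2%R)%E = (`|(f \_ Om) x| ^+ 2)%:E.
    by rewrite -powR_mulrn.
  rewrite !patchE; case: ifPn => _; first by rewrite real_normK// num_real.
  by rewrite normr0 expr0n.
have mE : measurable_fun setT (f \_ Om) <-> measurable_fun (Om : set (plane R)) f.
  by symmetry; exact: measurable_restrictT.
split.
  move=> /andP[/set_mem /mE mf]; rewrite inE /finite_norm /= => h; split => //.
  apply/integrableP; split; first by apply/measurable_EFinP; exact: measurable_sq.
  apply: (@le_lt_trans _ _ (\int[mu]_(x in Om) (f x ^+ 2)%:E)%E); last first.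
    by rewrite -E -poweR_Lnorm// poweR_lty.
  rewrite le_eqVlt; apply/orP; left; apply/eqP; apply: eq_integral => x _.
  by rewrite /= ger0_norm// sqr_ge0.
move=> [mf igf]; apply/andP; split; first by rewrite inE; exact/mE.
rewrite inE /finite_norm /= unlock E poweR_lty// ig_fin//; exact: ltry.
Qed.

Lemma H1_wderive Om f : open Om -> H1 Om f -> sqi mu Om f /\
  forall s, sqi mu Om (wderive Om (ev s) f) /\ weak_derivative Om (ev s) f (wderive Om (ev s) f).
Proof.
move=> oO [/(L2P _ (open_pmeasurable oO)) sf h1 h2]; split => // s.
have : exists g, L2 Om g /\ weak_derivative Om (ev s) f g.
  by case: s; [case: h2|case: h1] => g g1 g2; exists g.
by move=> /(xgetPex (fun=> 0)) [/(L2P _ (open_pmeasurable oO))].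
Qed.

(** The choice made in [wderive] is irrelevant for norms, since weak derivatives are unique
    almost everywhere. *)
Lemma H1_intro Om f (g : bool -> R * R -> R) : open Om -> sqi mu Om f -> (forall s, sqi mu Om (g s)) ->
  (forall s, weak_derivative Om (ev s) f (g s)) ->
  H1 Om f /\ forall s, n2 mu Om (wderive Om (ev s) f) = n2 mu Om (g s).
Proof.
move=> oO sf sg wd; have mO := open_pmeasurable oO.
have H : H1 Om f.
  split; first exact/L2P.
    by exists (g false); [exact/L2P|exact: (wd false)].
  by exists (g true); [exact/L2P|exact: (wd true)].
split => // s; have [_ /(_ s)[sw ww]] := H1_wderive oO H.
apply: ae_n2_eq => //; [by case: sw|by case: (sg s)|].
exact: (weak_derivative_unique oO ww (wd s)).
Qed.

(** Truncation to the unit interval turns constraints that hold almost everywhere into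
    ones that hold everywhere. *)
Definition clip (t : R) : R := Num.max 0 (Num.min 1 t).

Lemma clip_ge0 t : 0 <= clip t.
Proof. by rewrite le_max lexx. Qed.

Lemma clip_le1 t : clip t <= 1.
Proof. by rewrite ge_max ler01 ge_min lexx. Qed.

Lemma clip_id t : 0 <= t <= 1 -> clip t = t.
Proof. by move=> /andP[t0 t1]; rewrite /clip (min_idPr t1) (max_idPr t0). Qed.

Lemma continuous_clip : continuous clip.
Proof.
move=> t; apply: (@continuous_max _ R (fun=> 0) (fun t => Num.min 1 t) t); first exact: cvg_cst.
by apply: (@continuous_min _ R (fun=> 1) (fun t => t) t); [exact: cvg_cst|exact: cvg_id].
Qed.

Lemma measurable_clip A p : measurable_fun (A : set (plane R)) p -> measurable_fun A (fun x => clip (p x)).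
Proof. by move=> mp; apply: measurable_maxr => //; apply: measurable_minr. Qed.

Definition data Om I u p : R := \int[mu]_(x in Om) ((u x - I x) ^+ 2 * clip (p x)).
Definition pot Om p : R := \int[mu]_(x in Om) ((clip (p x) * (1 - clip (p x))) ^+ 2).
Definition dirichlet Om f : R :=
  n2 mu Om (wderive Om (ev false) f) + n2 mu Om (wderive Om (ev true) f).

Definition real_energy K Om (lam alpha eps : R) I (P U : 'I_K -> R * R -> R) : R :=
  lam * (\sum_(i < K) data Om I (U i) (P i)) + alpha * (\sum_(i < K) dirichlet Om (U i)) +
  \sum_(i < K) (9 * eps * dirichlet Om (P i) + pot Om (P i) / eps).

Lemma ig_data Om I u p : pmeasurable Om -> sqi mu Om u -> sqi mu Om I ->
  measurable_fun (Om : set (plane R)) p -> ig mu Om (fun x => (u x - I x) ^+ 2 * clip (p x)).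
Proof.
move=> mO su sI mp; have [ms is'] := sqiB mO su sI.
apply: ig_le is' => //.
  by apply: measurable_funM; [exact: measurable_sq|exact: measurable_clip].
move=> x _; rewrite ger0_norm; last exact: mulr_ge0 (sqr_ge0 _) (clip_ge0 _).
by apply: ler_piMr; [exact: sqr_ge0|exact: clip_le1].
Qed.

Lemma pot_le1 t : 0 <= (clip t * (1 - clip t)) ^+ 2 <= 1.
Proof.
rewrite sqr_ge0/=; have h0 := clip_ge0 t; have h1 := clip_le1 t.
by apply: exprn_ile1; nra.
Qed.

Lemma measurable_pot Om p : measurable_fun (Om : set (plane R)) p ->
  measurable_fun (Om : set (plane R)) (fun x => (clip (p x) * (1 - clip (p x))) ^+ 2).
Proof.
move=> mp; apply: measurable_sq; apply: measurable_funM; first exact: measurable_clip.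
by apply: measurable_funB => //; exact: measurable_clip.
Qed.

Lemma ig_pot Om p : pmeasurable Om -> (mu Om < +oo)%E -> measurable_fun (Om : set (plane R)) p ->
  ig mu Om (fun x => (clip (p x) * (1 - clip (p x))) ^+ 2).
Proof.
move=> mO fO mp; apply: ig_le (ig_cst 1 mO fO) => //; first exact: measurable_pot.
by move=> x _; have /andP[h0 h1] := pot_le1 (p x); rewrite ger0_norm.
Qed.

Lemma Rint_ge0 Om f : (forall x, Om x -> 0 <= f x) -> 0 <= \int[mu]_(x in Om) f x.
Proof. by move=> f0; apply: Rintegral_ge0 => x; exact: f0. Qed.

Lemma data_ge0 Om I u p : 0 <= data Om I u p.
Proof. by apply: Rint_ge0 => x _; rewrite mulr_ge0 ?sqr_ge0 ?clip_ge0. Qed.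

Lemma pot_ge0 Om p : 0 <= pot Om p.
Proof. by apply: Rint_ge0 => x _; exact: sqr_ge0. Qed.

Lemma ae_clip K Om (P : 'I_K -> R * R -> R) i : {ae mu, forall x, Om x -> simplex (fun i => P i x)} ->
  {ae mu, forall x, Om x -> P i x = clip (P i x)}.
Proof.
apply: aeS => x h /h [p0 p1]; rewrite clip_id// p0/=.
by rewrite -p1 (bigD1 i)//= lerDl sumr_ge0.
Qed.

Lemma Rint_sqD A u v : pmeasurable A -> ig mu A (fun x => u x ^+ 2) -> ig mu A (fun x => v x ^+ 2) ->
  ig mu A (fun x => u x ^+ 2 + v x ^+ 2) /\
  \int[mu]_(x in A) (u x ^+ 2 + v x ^+ 2) = n2 mu A u + n2 mu A v.
Proof. by move=> mA h1 h2; split; [exact: igD|exact: RintegralD]. Qed.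

(** All terms are finite for an admissible pair, whose weights [clip] changes on a null set
    only. *)
Lemma energyE K Om (lam alpha eps : R) I (P U : 'I_K -> R * R -> R) : open Om -> (mu Om < +oo)%E ->
  L2 Om I -> adm Om P U -> energy Om lam alpha eps I P U = (real_energy Om lam alpha eps I P U)%:E.
Proof.
move=> oO fO lI [hP hU hs]; have mO := open_pmeasurable oO.
have sI := (L2P I mO).1 lI.
have HP i := H1_wderive oO (hP i); have HU i := H1_wderive oO (hU i).
have igg f : (forall s, sqi mu Om (wderive Om (ev s) f) /\ weak_derivative Om (ev s) f (wderive Om (ev s) f)) ->
    ig mu Om (grad_sq Om f) /\ \int[mu]_(x in Om) grad_sq Om f x = dirichlet Om f.
  move=> h; have [[_ h1] _] := h false; have [[_ h2] _] := h true.
  exact: (Rint_sqD mO h1 h2).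
rewrite /energy /real_energy !EFinD !EFinM; congr (_ * _ + _ * _ + _)%E.
- rewrite -sumEFin; apply: eq_bigr => i _.
  have [[mP _] _] := HP i; have [sU _] := HU i; have h := ig_data mO sU sI mP.
  rewrite /data -ig_fin//; apply: ae_eq_integral => //.
  + apply/measurable_EFinP; apply: measurable_funM => //; apply: measurable_sq.
    by case: (sqiB mO sU sI).
  + exact: measurable_int h.
  + by apply: aeS (ae_clip i hs) => x /= h' /h' <-.
- rewrite -sumEFin; apply: eq_bigr => i _.
  by have [h1 <-] := igg _ (HU i).2; rewrite ig_fin.
- rewrite -sumEFin; apply: eq_bigr => i _.
  have [h1 h2] := igg _ (HP i).2; have [[mP _] _] := HP i.
  have h3 := ig_pot mO fO mP.
  have h4 := igZ (9 * eps) mO h1; have h5 := igZ eps^-1 mO h3.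
  rewrite -h2 -RintZ// /pot [_ / eps]mulrC -RintZ// -RintegralD// -ig_fin//; last exact: igD.
  apply: ae_eq_integral => //.
  + apply/measurable_EFinP; apply: measurable_funD; first exact: ig_meas h4.
    apply: measurable_funM => //; apply: measurable_sq; apply: measurable_funM => //.
    exact: measurable_funB.
  + by apply: measurable_int; exact: (igD mO h4 h5).
  + by apply: aeS (ae_clip i hs) => x /= h' /h' <-; rewrite [_ / eps]mulrC.
Qed.

End Energy.

(** * Lower semicontinuity *)

Section Limits.
Context {R : realType}.
Implicit Types (s : bool) (Om : set (R * R)) (u v f p I : R * R -> R).
Local Notation mu := (@leb2 R).

Lemma ae_and (P Q : R * R -> Prop) : {ae mu, forall x, P x} -> {ae mu, forall x, Q x} ->
  {ae mu, forall x, P x /\ Q x}.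
Proof.
move=> [N [mN N0 sN]] [M [mM M0 sM]]; exists (N `|` M); split; [exact: measurableU|by rewrite -N0; exact: (measureU0 mN mM M0)|].
by move=> x /= /not_andP[h|h]; [left; exact: sN|right; exact: sM].
Qed.

Lemma fatou_cvg Om (h : nat -> R * R -> R) f (l : R) : pmeasurable Om ->
  (forall k, ig mu Om (h k)) -> measurable_fun (Om : set (plane R)) f ->
  (forall k x, Om x -> 0 <= h k x) -> (forall x, Om x -> 0 <= f x) ->
  {ae mu, forall x, Om x -> (fun k => h k x) @ \oo --> f x} ->
  (fun k => \int[mu]_(x in Om) h k x) @ \oo --> l ->
  ig mu Om f /\ \int[mu]_(x in Om) f x <= l.
Proof.
move=> mO ih mf h0 f0 hf hl.
have [||||||i1 i2] := @fatou_Rint _ _ _ mu Om h f l mO.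
- by move=> k; exact: ig_meas (ih k).
- exact: mf.
- exact: h0.
- exact: f0.
- apply: aeS hf => x h1 /h1 {}h1 e e0.
  have /cvgrPdist_le /(_ _ e0) [N _ hN] := h1; exists N => k /hN /=.
  by rewrite ler_norml => /andP[? ?]; lra.
- move=> e e0; have /cvgrPdist_le /(_ _ e0) [N _ hN] := hl; exists N => k /hN /=.
  by rewrite ler_norml ig_fin// lee_fin => /andP[? ?]; lra.
by split.
Qed.

Lemma cvg_clip (y : nat -> R) (z : R) : y @ \oo --> z -> (fun k => clip (y k)) @ \oo --> clip z.
Proof. by move=> h; apply: continuous_cvg => //; exact: continuous_clip. Qed.

Lemma pot_fatou Om (P : nat -> R * R -> R) p (l : R) : pmeasurable Om -> (mu Om < +oo)%E ->
  (forall k, measurable_fun (Om : set (plane R)) (P k)) -> measurable_fun (Om : set (plane R)) p ->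
  {ae mu, forall x, Om x -> (fun k => P k x) @ \oo --> p x} ->
  (fun k => pot Om (P k)) @ \oo --> l -> pot Om p <= l.
Proof.
move=> mO fO mP mp hp hl; apply: (fatou_cvg mO _ _ _ _ _ hl).2.
- by move=> k; exact: ig_pot.
- exact: measurable_pot.
- by move=> k x _; exact: sqr_ge0.
- by move=> x _; exact: sqr_ge0.
- apply: aeS hp => x h /h /cvg_clip hc.
  apply: (@cvgM _ _ _ _ (fun k => _) (fun k => _)); apply: cvgM => //; apply: cvgB => //; exact: cvg_cst.
Qed.

Lemma data_fatou Om I (U P : nat -> R * R -> R) u p (l : R) : pmeasurable Om -> sqi mu Om I ->
  (forall k, sqi mu Om (U k)) -> (forall k, measurable_fun (Om : set (plane R)) (P k)) ->
  measurable_fun (Om : set (plane R)) u -> measurable_fun (Om : set (plane R)) p ->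
  {ae mu, forall x, Om x -> (fun k => U k x) @ \oo --> u x} ->
  {ae mu, forall x, Om x -> (fun k => P k x) @ \oo --> p x} ->
  (fun k => data Om I (U k) (P k)) @ \oo --> l -> data Om I u p <= l.
Proof.
move=> mO sI sU mP mu' mp hu hp hl; have [mI _] := sI.
apply: (fatou_cvg mO _ _ _ _ _ hl).2.
- by move=> k; exact: ig_data.
- apply: measurable_funM; last exact: measurable_clip.
  by apply: measurable_sq; exact: measurable_funB.
- by move=> k x _; exact: mulr_ge0 (sqr_ge0 _) (clip_ge0 _).
- by move=> x _; exact: mulr_ge0 (sqr_ge0 _) (clip_ge0 _).
- apply: aeS (ae_and hu hp) => x [h1 h2] Ox; move: (h1 Ox) (h2 Ox) => {}h1 {}h2; apply: cvgM; last by apply: cvg_clip; exact: h2.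
  have h3 : (fun k => U k x - I x) @ \oo --> u x - I x by apply: cvgB; [exact: h1|exact: cvg_cst].
  exact: (cvgM h3 h3).
Qed.

(** If the averages of [U k] escape to infinity, the bounded data term forces the
    limiting weight to vanish: divide the integrand by the square of the averages. *)
Lemma data_escape Om I (U P : nat -> R * R -> R) v p (c : nat -> R) (l b : R) : pmeasurable Om -> sqi mu Om I ->
  (forall k, sqi mu Om (U k)) -> (forall k, measurable_fun (Om : set (plane R)) (P k)) ->
  measurable_fun (Om : set (plane R)) p ->
  {ae mu, forall x, Om x -> (fun k => U k x - c k) @ \oo --> v x} ->
  {ae mu, forall x, Om x -> (fun k => P k x) @ \oo --> p x} ->
  (fun k => data Om I (U k) (P k)) @ \oo --> l ->
  (fun k => (1 + `|c k|)^-1) @ \oo --> (0 : R) -> (fun k => c k * (1 + `|c k|)^-1) @ \oo --> b ->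
  data Om I (cst 0) p = 0.
Proof.
move=> mO sI sU mP mp hv hp hl ha hb; pose a k := (1 + `|c k|)^-1.
have b1 : b ^+ 2 = 1.
  have h1 : (fun k => (c k * a k) ^+ 2) @ \oo --> b ^+ 2 by exact: (cvgM hb hb).
  have h2 : (fun k => 1 - a k) @ \oo --> (1 - 0 : R) by apply: cvgB ha; exact: cvg_cst.
  have h3 : (fun k => (1 - a k) ^+ 2) @ \oo --> (1 - 0 : R) ^+ 2 by exact: (cvgM h2 h2).
  have E : (fun k => (1 - a k) ^+ 2) = fun k => (c k * a k) ^+ 2.
    apply/funext => k; have n0 : 1 + `|c k| != 0 by rewrite gt_eqF// ltr_pwDl.
    have -> : 1 - a k = `|c k| * a k.
      by rewrite /a; field.
    by rewrite !exprMn real_normK// num_real.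
  rewrite subr0 expr1n E in h3.
  by rewrite -(cvg_lim _ h1)// (cvg_lim _ h3).
have [ip p0] : ig mu Om (fun x => clip (p x)) /\ \int[mu]_(x in Om) clip (p x) <= 0.
  apply: (@fatou_cvg Om (fun k x => a k ^+ 2 * ((U k x - I x) ^+ 2 * clip (P k x)))) => //.
  - by move=> k; apply: igZ => //; exact: ig_data.
  - exact: measurable_clip.
  - by move=> k x _; apply: mulr_ge0 (sqr_ge0 _) _; exact: mulr_ge0 (sqr_ge0 _) (clip_ge0 _).
  - by move=> x _; exact: clip_ge0.
  - apply: aeS (ae_and hv hp) => x [h1 h2] Ox; move: (h1 Ox) (h2 Ox) => {}h1 {}h2.
    have -> : (fun k => a k ^+ 2 * ((U k x - I x) ^+ 2 * clip (P k x))) =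
       fun k => (a k * ((U k x - c k) - I x) + c k * a k) ^+ 2 * clip (P k x).
      by apply/funext => k; ring.
    have -> : clip (p x) = (0 * (v x - I x) + b) ^+ 2 * clip (p x) by rewrite mul0r add0r b1 mul1r.
    apply: cvgM; last by apply: cvg_clip; exact: h2.
    have h3 : (fun k => a k * ((U k x - c k) - I x) + c k * a k) @ \oo --> 0 * (v x - I x) + b.
      by apply: cvgD hb; apply: cvgM ha _; apply: cvgB; [exact: h1|exact: cvg_cst].
    exact: (cvgM h3 h3).
  - rewrite (_ : (fun k => _) = fun k => a k ^+ 2 * data Om I (U k) (P k)); last first.
      by apply/funext => k; rewrite RintZ//; exact: ig_data.
    by rewrite -[X in _ --> X](mul0r l) -[X in X * l](mul0r 0); apply: cvgM hl; exact: (cvgM ha ha).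
have ae0 : ae_eq mu Om (EFin \o (fun x => clip (p x))) (cst 0%E).
  apply/(ae_eq_integral_abs mu mO); first exact: measurable_int ip.
  apply/eqP; rewrite eq_le; apply/andP; split; last by apply: integral_ge0.
  rewrite (_ : (\int[mu]_(x in Om) _)%E = (\int[mu]_(x in Om) (clip (p x))%:E)%E).
    by rewrite ig_fin.
  by apply: eq_integral => x _; rewrite /= ger0_norm ?clip_ge0.
rewrite /data /Rintegral (@ae_eq_integral _ _ _ _ _ (cst 0%E)) ?integral0//.
- have s0 : sqi mu Om (cst 0).
    split; first exact: measurable_cst.
    by apply: eq_ig (igZ 0 mO ip) => // x _ /=; rewrite mul0r expr0n.
  by apply: measurable_int; exact: ig_data.
- by apply: aeS ae0 => x /= h /h [->]; rewrite mulr0.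
Qed.

(** The two sequences built from [c] are bounded, so that subsequences of them converge even
    where those of [c] do not. The limit of the first one decides between Fatou's lemma for
    [U k] and the escape of [c] to infinity, where zero is as good as any limit. *)
Lemma data_limit Om I (U P : nat -> R * R -> R) v p (c : nat -> R) (l : R) : pmeasurable Om -> sqi mu Om I ->
  (forall k, sqi mu Om (U k)) -> (forall k, measurable_fun (Om : set (plane R)) (P k)) ->
  measurable_fun (Om : set (plane R)) v -> measurable_fun (Om : set (plane R)) p ->
  {ae mu, forall x, Om x -> (fun k => U k x - c k) @ \oo --> v x} ->
  {ae mu, forall x, Om x -> (fun k => P k x) @ \oo --> p x} ->
  (fun k => data Om I (U k) (P k)) @ \oo --> l ->
  cvgn (fun k => (1 + `|c k|)^-1) -> cvgn (fun k => c k * (1 + `|c k|)^-1) ->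
  exists u, (u = cst 0 \/ exists z : R, u = fun x => v x - z) /\ data Om I u p <= l.
Proof.
move=> mO sI sU mP mv mp hv hp hl /cvg_ex[a /= ha] /cvg_ex[b /= hb].
have [a0|a0] := eqVneq a 0.
  rewrite a0 in ha; exists (cst 0); split; first by left.
  rewrite (data_escape mO sI sU mP mp hv hp hl ha hb).
  by rewrite -(cvg_lim _ hl)//; apply: limr_ge; [exact: (cvgP _ hl)|apply: nearW => k; exact: data_ge0].
have hc : c @ \oo --> b / a.
  rewrite (_ : c = fun k => (c k * (1 + `|c k|)^-1) / (1 + `|c k|)^-1).
    by apply: cvgM hb _; exact: cvgV.
  by apply/funext => k; rewrite mulfK// invr_neq0// gt_eqF// ltr_pwDl.
exists (fun x => v x - (- (b / a))); split; first by right; exists (- (b / a)).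
apply: (data_fatou mO sI sU mP _ mp _ hp hl); first exact: measurable_funB.
apply: aeS hv => x h /h {}h; rewrite opprK.
rewrite (_ : (fun k => U k x) = fun k => (U k x - c k) + c k); first exact: cvgD.
by apply/funext => k; rewrite subrK.
Qed.

Lemma sobolev_limit Om (F : nat -> R * R -> R) (h : nat -> bool -> R * R -> R) f (L : bool -> R) :
  open Om -> bounded_set Om -> smooth_boundary Om ->
  (forall k, L2loc Om (F k)) -> L2loc Om f ->
  (forall n, good Om n -> (fun k => n2 mu (ratbox n) (fun x => F k x - f x)) @ \oo --> (0 : R)) ->
  (forall k s, sqi mu Om (h k s)) -> (forall k s, weak_derivative Om (ev s) (F k) (h k s)) ->
  (forall s, (fun k => n2 mu Om (h k s)) @ \oo --> L s) ->
  exists g, [/\ sqi mu Om f, forall s, sqi mu Om (g s), forall s, n2 mu Om (g s) <= L s &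
    forall s, weak_derivative Om (ev s) f (g s)].
Proof.
move=> oO bO sb lF lf hc sh wd hL; have fO := leb2_bounded (open_pmeasurable oO) bO.
have /choice[g hg] : forall s, exists g, [/\ sqi mu Om g, n2 mu Om g <= L s & weak_derivative Om (ev s) f g].
  by move=> s; apply: (@weak_derivative_closed _ Om s F (fun k => h k s) f (L s)).
have sg s : sqi mu Om (g s) by case: (hg s).
have wg s : weak_derivative Om (ev s) f (g s) by case: (hg s).
by exists g; split => //; [exact: (boundary_L2 oO bO sb lf sg wg)|move=> s; case: (hg s)].
Qed.

Lemma H1_sum Om f g (L : bool -> R) : open Om -> sqi mu Om f -> (forall s, sqi mu Om (g s)) ->
  (forall s, n2 mu Om (g s) <= L s) -> (forall s, weak_derivative Om (ev s) f (g s)) ->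
  H1 Om f /\ dirichlet Om f <= L false + L true.
Proof.
move=> oO sf sg gL wd; have [hf e] := H1_intro oO sf sg wd.
split => //; have -> : dirichlet Om f = n2 mu Om (g false) + n2 mu Om (g true).
  exact: (f_equal2 +%R (e false) (e true)).
exact: (lerD (gL false) (gL true)).
Qed.

Lemma average_unit Om n p : open Om -> good Om n -> L2loc Om p ->
  {ae mu, forall x, Om x -> p x = clip (p x)} -> `|av n p| <= 1.
Proof.
move=> oO gn lp hp; have mn := @measurable_ratbox R n; have an := area_gt0 gn.
have [mp _] := lp n gn.
have ic : ig mu (ratbox n) (fun x => clip (p x)).
  apply: ig_le (ig_cst 1 mn (ratbox_lty n)) => //; first exact: measurable_clip.
  by move=> x _; rewrite ger0_norm ?clip_ge0// clip_le1.
have E : \int[mu]_(x in ratbox n) p x = \int[mu]_(x in ratbox n) clip (p x).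
  rewrite /Rintegral; congr fine; apply: ae_eq_integral => //; [exact/measurable_EFinP|exact: measurable_int ic|].
  by apply: aeS hp => x /= h /(ratbox_sub gn) /h <-.
have h0 : 0 <= \int[mu]_(x in ratbox n) clip (p x) by apply: Rint_ge0 => x _; exact: clip_ge0.
have h1 : \int[mu]_(x in ratbox n) clip (p x) <= area n.
  have -> : area n = \int[mu]_(x in ratbox n) 1.
    by case: gn => ab cd _; rewrite Rint_cst_rect ?ltW// mul1r.
  apply: le_Rintegral => //; [exact: ig_cst (ratbox_lty n)|by move=> x _; exact: clip_le1].
rewrite /av E ger0_norm; first by rewrite ler_pdivrMr// mul1r.
by rewrite divr_ge0// ltW.
Qed.

End Limits.

(** * The minimizing sequence *)

Section Minimizer.
Context {R : realType}.
Implicit Types (s : bool) (Om : set (R * R)) (u v f p I : R * R -> R).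
Local Notation mu := (@leb2 R).

Lemma dirichlet_ge0 Om f : 0 <= dirichlet Om f.
Proof. exact: (addr_ge0 (n2_ge0 _ _ _) (n2_ge0 _ _ _)). Qed.

Lemma summands_le (C x1 x2 y1 y2 w1 w2 z : R) : x1 <= x2 -> y1 <= y2 -> w1 + w2 <= z ->
  0 <= w1 -> 0 <= w2 -> 0 <= z -> 0 <= y2 -> 0 <= x2 -> x2 + y2 + z <= C ->
  [/\ x1 <= C, y1 <= C, w1 <= C & w2 <= C].
Proof. by move=> *; split; lra. Qed.

Lemma le_pdivr (a x C : R) : 0 < a -> a * x <= C -> x <= C / a.
Proof. by move=> a0; rewrite ler_pdivlMr// mulrC. Qed.

Section Bounds.
Variables (K : nat) (Om : set (R * R)) (lam alpha eps : R) (I : R * R -> R) (P U : 'I_K -> R * R -> R).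
Hypotheses (lam0 : 0 < lam) (alpha0 : 0 < alpha) (eps0 : 0 < eps).

Let D0 : 0 <= \sum_(i < K) data Om I (U i) (P i).
Proof. by apply: sumr_ge0 => i _; exact: data_ge0. Qed.
Let G0 : 0 <= \sum_(i < K) dirichlet Om (U i).
Proof. by apply: sumr_ge0 => i _; exact: dirichlet_ge0. Qed.
Let T0 i : 0 <= 9 * eps * dirichlet Om (P i) + pot Om (P i) / eps.
Proof.
have h1 := dirichlet_ge0 Om (P i); have h2 := pot_ge0 Om (P i).
have h3 : 0 <= eps^-1 by rewrite invr_ge0 ltW.
apply: addr_ge0; last exact: mulr_ge0 h2 h3.
by apply: mulr_ge0 h1; rewrite mulr_ge0 ?ltW.
Qed.

Lemma real_energy_ge0 : 0 <= real_energy Om lam alpha eps I P U.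
Proof.
apply: addr_ge0; last by apply: sumr_ge0.
by apply: addr_ge0; [exact: mulr_ge0 (ltW lam0) D0|exact: mulr_ge0 (ltW alpha0) G0].
Qed.

Lemma real_energy_bounds C i : real_energy Om lam alpha eps I P U <= C ->
  [/\ data Om I (U i) (P i) <= C / lam, dirichlet Om (U i) <= C / alpha,
      dirichlet Om (P i) <= C / (9 * eps) & pot Om (P i) <= C * eps].
Proof.
rewrite /real_energy.
have sum_le (F : 'I_K -> R) : (forall i, 0 <= F i) -> F i <= \sum_(i < K) F i.
  by move=> F0; rewrite (bigD1 i)//= lerDl sumr_ge0.
have hD := sum_le (fun i => data Om I (U i) (P i)) (fun i => data_ge0 _ _ _ _).
have hG := sum_le (fun i => dirichlet Om (U i)) (fun i => dirichlet_ge0 _ _).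
have hT := sum_le _ T0; rewrite /= in hD hG hT.
have := mulr_ge0 (ltW lam0) D0; have := mulr_ge0 (ltW alpha0) G0.
have := sumr_ge0 (index_enum 'I_K) (fun i (_ : true) => T0 i).
have hD' := ler_wpM2l (ltW lam0) hD; have hG' := ler_wpM2l (ltW alpha0) hG.
have h1 := dirichlet_ge0 Om (P i); have h2 := pot_ge0 Om (P i).
have h3 : 0 <= eps^-1 by rewrite invr_ge0 ltW.
have h4 := mulr_ge0 h2 h3; have h5 : 0 <= 9 * eps * dirichlet Om (P i) by apply: mulr_ge0 h1; rewrite mulr_ge0 ?ltW.
move=> k1 k2 k3 /(summands_le hD' hG' hT h5 h4 k1 k2 k3) [c1 c2 c3 c4].
have e9 : 0 < 9 * eps by rewrite mulr_gt0.
split; [exact: le_pdivr c1|exact: le_pdivr c2|exact: le_pdivr c3|].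
by have := c4; rewrite ler_pdivrMr.
Qed.

End Bounds.

Lemma cvg_sumr (T : Type) (r : seq T) (F : T -> nat -> R) (l : T -> R) :
  (forall i, F i @ \oo --> l i) -> (fun k => \sum_(i <- r) F i k) @ \oo --> \sum_(i <- r) l i.
Proof.
move=> h; elim: r => [|i r IH].
  by rewrite big_nil; under eq_fun do rewrite big_nil; exact: cvg_cst.
by rewrite big_cons; under eq_fun do rewrite big_cons; exact: cvgD.
Qed.

Lemma adm_nonempty K Om : (0 < K)%N -> open Om -> bounded_set Om ->
  exists P U : 'I_K -> R * R -> R, adm Om P U.
Proof.
move=> K0 oO bO; have mO := open_pmeasurable oO; have fO := leb2_bounded mO bO.
have hc (k : R) : H1 Om (cst k).
  apply: (H1_intro (g := fun=> cst 0) oO _ _ _).1; [exact: sqi_cst|by move=> _; exact: sqi_cst|].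
  by move=> s; exact: weak_derivative_cst.
exists (fun i => cst ((i == Ordinal K0)%:R : R)), (fun=> cst 0); split => //.
apply: aeW => x _; split => [i|]; first exact: ler0n.
by rewrite (bigD1 (Ordinal K0))//= ?eqxx big1 ?addr0// => i /negbTE ->.
Qed.

Lemma ae_simplex_limit K Om (P : nat -> 'I_K -> R * R -> R) (p : 'I_K -> R * R -> R) :
  (forall k, {ae mu, forall x, Om x -> simplex (fun i => P k i x)}) ->
  (forall i, {ae mu, forall x, Om x -> (fun k => P k i x) @ \oo --> p i x}) ->
  {ae mu, forall x, Om x -> simplex (fun i => p i x)}.
Proof.
move=> /ae_foralln hs hp.
have hp' : {ae mu, forall x, forall (n : nat) (i : 'I_K), val i = n -> Om x -> (fun k => P k i x) @ \oo --> p i x}.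
  apply: (@ae_foralln _ _ _ mu (fun n x => forall i : 'I_K, val i = n -> Om x -> (fun k => P k i x) @ \oo --> p i x)) => n.
  have [nK|nK] := boolP (n < K)%N.
    by apply: aeS (hp (Ordinal nK)) => x h i /= e; rewrite (_ : i = Ordinal nK)//; exact: val_inj.
  by apply: aeW => x i e; move: nK; rewrite -e ltn_ord.
apply: aeS (ae_and hs hp') => x [h1 h2] Ox.
have hi i : (fun k => P k i x) @ \oo --> p i x by exact: (h2 _ i erefl Ox).
split => [i|].
  rewrite -(cvg_lim _ (hi i))//; apply: limr_ge; first exact: (cvgP _ (hi i)).
  by apply: nearW => k; case: (h1 k Ox).
have : (fun k => \sum_(i < K) P k i x) @ \oo --> \sum_(i < K) p i x.
  by apply: cvg_sumr => i; exact: hi.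
rewrite (_ : (fun k => _) = cst 1); last by apply/funext => k; case: (h1 k Ox).
by move=> h; rewrite -(cvg_lim _ h)// lim_cst.
Qed.

Lemma H1_cst0 Om (g : bool -> R * R -> R) (L : bool -> R) : open Om -> (mu Om < +oo)%E ->
  (forall s, n2 mu Om (g s) <= L s) -> H1 Om (cst 0) /\ dirichlet Om (cst 0) <= L false + L true.
Proof.
move=> oO fO gL; have mO := open_pmeasurable oO.
apply: (@H1_sum _ Om (cst 0) (fun=> cst 0)) => //; [exact: sqi_cst|by move=> _; exact: sqi_cst| |].
  move=> s; apply: le_trans (gL s); rewrite {1}/n2 /Rintegral (eq_integral (cst 0%E)) ?integral0 ?n2_ge0//.
  by move=> x _; rewrite /= expr0n.
by move=> s; exact: weak_derivative_cst.
Qed.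

(** Each term of the energy is lower semicontinuous along a common subsequence. The values
    of the terms are made to converge as well, so that the separate bounds add up. *)
Lemma adm_limit K Om (lam alpha eps : R) I (P U : nat -> 'I_K -> R * R -> R) (C : R) :
  domain Om -> bounded_set Om -> smooth_boundary Om -> L2 Om I ->
  0 < lam -> 0 < alpha -> 0 < eps ->
  (forall k, adm Om (P k) (U k)) -> (forall k, real_energy Om lam alpha eps I (P k) (U k) <= C) ->
  exists (p u : 'I_K -> R * R -> R) (t : nat -> nat) (l : R),
  [/\ forall k, (k <= t k)%N, adm Om p u,
     (fun k => real_energy Om lam alpha eps I (P (t k)) (U (t k))) @ \oo --> l &
     real_energy Om lam alpha eps I p u <= l].
Proof.
move=> [oO cO] bO sb lI lam0 alpha0 eps0 ha hC.
have mO := open_pmeasurable oO; have fO := leb2_bounded mO bO; have sI := (L2P I mO).1 lI.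
have bd k i := real_energy_bounds lam0 alpha0 eps0 i (hC k).
have HP k i : H1 Om (P k i) by case: (ha k).
have HU k i : H1 Om (U k i) by case: (ha k).
have hs k : {ae mu, forall x, Om x -> simplex (fun i => P k i x)} by case: (ha k).
have sP k i := (H1_wderive oO (HP k i)).1; have wP k i := (H1_wderive oO (HP k i)).2.
have sU k i := (H1_wderive oO (HU k i)).1; have wU k i := (H1_wderive oO (HU k i)).2.
have dle f s : n2 mu Om (wderive Om (ev s) f) <= dirichlet Om f.
  by case: s; [exact: ler_wpDl (n2_ge0 _ _ _) (lexx _)|exact: ler_wpDr (n2_ge0 _ _ _) (lexx _)].
have /choice[c hc] : forall i, exists c : nat -> R, forall n, good Om n ->
    exists B, forall k, `|av n (U k i) - c k| <= B.
  move=> i; apply: (@averages_chain _ Om (fun k => U k i) (fun k s => wderive Om (ev s) (U k i)) (C / alpha)) => //.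
  - by move=> k; exact: sqi_L2loc.
  - by move=> k s; exact: (wU k i s).1.
  - by move=> k s; exact: (wU k i s).2.
  - by move=> k s; apply: le_trans (dle _ s) _; case: (bd k i).
(* The energy does not control the averages of [U k i] where [P k i] is small, so that
   [c i k] has to be subtracted; the averages of [P k i] are bounded anyway. *)
pose f (j : bool * 'I_K) k : R * R -> R := if j.1 then P k j.2 else fun x => U k j.2 x - c j.2 k.
pose g (j : bool * 'I_K) k s : R * R -> R := wderive Om (ev s) (if j.1 then P k j.2 else U k j.2).
pose M (j : bool * 'I_K) : R := if j.1 then C / (9 * eps) else C / alpha.
pose Y (y : (bool * 'I_K) * bool + ('I_K + 'I_K) + ('I_K + 'I_K)) k : R := match y with
  | inl (inl (j, s)) => n2 mu Om (g j k s)
  | inl (inr (inl i)) => data Om I (U k i) (P k i)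
  | inl (inr (inr i)) => pot Om (P k i)
  | inr (inl i) => (1 + `|c i k|)^-1
  | inr (inr i) => c i k * (1 + `|c i k|)^-1 end.
pose BY (y : (bool * 'I_K) * bool + ('I_K + 'I_K) + ('I_K + 'I_K)) : R := match y with
  | inl (inl (j, s)) => M j
  | inl (inr (inl i)) => C / lam
  | inl (inr (inr i)) => C * eps
  | inr _ => 1 end.
have lf j k : L2loc Om (f j k).
  case: j => -[] i; first exact: (sqi_L2loc oO (sP k i)).
  exact: (L2locB (sqi_L2loc oO (sU k i)) (@L2loc_cst _ Om (c i k))).
have sg j k s : sqi mu Om (g j k s).
  by case: j => -[] i; [exact: (wP k i s).1|exact: (wU k i s).1].
have wg j k s : weak_derivative Om (ev s) (f j k) (g j k s).
  case: j => -[] i; first exact: (wP k i s).2.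
  apply: weak_derivative_shift => //; [exact: sqi_L2loc|exact: (sqi_L2loc oO (wU k i s).1)|exact: (wU k i s).2].
have gM j k s : n2 mu Om (g j k s) <= M j.
  by case: j => -[] i; apply: le_trans (dle _ s) _; case: (bd k i).
have [||t [fs [ht cY lfs cfs aes]]] := @sobolev_family_compact _ _ _ Om f g M Y BY oO lf sg wg gM.
- case=> -[] i n gn.
    exists 1 => k; exact: (average_unit oO gn (lf (true, i) k) (ae_clip i (hs k))).
  have [B hB] := hc i n gn; exists B => k; rewrite /f /=.
  have iu : ig mu (ratbox n) (U k i).
    by apply: sqi_ig (sqi_L2loc oO (sU k i) gn); [exact: measurable_ratbox|exact: ratbox_lty].
  rewrite (_ : av n _ = av n (U k i) - c i k)//.
  have mn := @measurable_ratbox R n.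
  rewrite /av RintegralB//; last by apply: ig_cst => //; exact: ratbox_lty.
  case: (gn) => h1 h2 _; rewrite Rint_cst_rect ?ltW// -/(area n) mulrBl mulfK// gt_eqF//.
  exact: area_gt0 gn.
- have c0 i k : 0 < 1 + `|c i k| by rewrite ltr_pwDl.
  case=> [[[j s]|[i|i]]|[i|i]] k /=.
  + by rewrite ger0_norm ?n2_ge0.
  + by rewrite ger0_norm ?data_ge0//; case: (bd k i).
  + by rewrite ger0_norm ?pot_ge0//; case: (bd k i).
  + rewrite ger0_norm; last by rewrite invr_ge0; exact: ltW (c0 i k).
    by rewrite invf_le1// lerDl.
  + by rewrite normrM normfV (gtr0_norm (c0 i k)) ler_pdivrMr// mul1r lerDr.
pose l y := limn (fun k => Y y (t k)).
have hY y : (fun k => Y y (t k)) @ \oo --> l y by exact: cY.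
pose p i := fs (true, i); pose v i := fs (false, i).
have mfs j : measurable_fun (Om : set (plane R)) (fs j) by exact: L2loc_meas.
have lim j : exists h, [/\ sqi mu Om (fs j), forall s, sqi mu Om (h s),
    forall s, n2 mu Om (h s) <= l (inl (inl (j, s))) & forall s, weak_derivative Om (ev s) (fs j) (h s)].
  apply: (@sobolev_limit _ Om (fun k => f j (t k)) (fun k => g j (t k))) => //; first by move=> n; exact: cfs.
  by move=> s; exact: (hY (inl (inl (j, s)))).
have Hp i : H1 Om (p i) /\ dirichlet Om (p i) <= l (inl (inl ((true, i), false))) + l (inl (inl ((true, i), true))).
  have [h [h1 h2 h3 h4]] := lim (true, i).
  exact: (@H1_sum _ Om (p i) h (fun s => l (inl (inl ((true, i), s))))).
have /choice[u hu] : forall i, exists u, [/\ H1 Om u,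
    dirichlet Om u <= l (inl (inl ((false, i), false))) + l (inl (inl ((false, i), true))) &
    data Om I u (p i) <= l (inl (inr (inl i)))].
  move=> i; have [h [h1 h2 h3 h4]] := lim (false, i).
  have [|||||||||u [uE ud]] := @data_limit _ Om I (fun k => U (t k) i) (fun k => P (t k) i) (v i) (p i)
     (fun k => c i (t k)) (l (inl (inr (inl i)))) mO sI.
  - by move=> k; exact: sU.
  - by move=> k; case: (sP (t k) i).
  - exact: mfs.
  - exact: mfs.
  - exact: (aes (false, i)).
  - exact: (aes (true, i)).
  - exact: (hY (inl (inr (inl i)))).
  - exact: (cY (inr (inl i))).
  - exact: (cY (inr (inr i))).
  exists u; case: uE => [uE|[z uE]].
    have [k1 k2] := @H1_cst0 Om h (fun s => l (inl (inl ((false, i), s)))) oO fO h3.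
    by rewrite uE in ud *; split.
  have [||||k1 k2] := @H1_sum _ Om (fun x => v i x - z) h (fun s => l (inl (inl ((false, i), s)))) oO.
  - by apply: sqiB => //; exact: sqi_cst.
  - exact: h2.
  - exact: h3.
  - by move=> s; apply: weak_derivative_shift => //; exact: sqi_L2loc.
  by rewrite uE in ud *; split.
exists p, u, t, (lam * (\sum_(i < K) l (inl (inr (inl i)))) +
  alpha * (\sum_(i < K) (l (inl (inl ((false, i), false))) + l (inl (inl ((false, i), true))))) +
  \sum_(i < K) (9 * eps * (l (inl (inl ((true, i), false))) + l (inl (inl ((true, i), true)))) +
     l (inl (inr (inr i))) / eps)).
split => //.
- split; [by move=> i; case: (Hp i)|by move=> i; case: (hu i)|].
  by apply: (@ae_simplex_limit _ _ (fun k => P (t k))) => // i; exact: (aes (true, i)).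
- apply: cvgD; first apply: cvgD.
  + apply: cvgM; first exact: cvg_cst.
    by apply: cvg_sumr => i; exact: (hY (inl (inr (inl i)))).
  + apply: cvgM; first exact: cvg_cst.
    apply: cvg_sumr => i; apply: cvgD; exact: (hY (inl (inl ((false, i), _)))).
  + apply: cvg_sumr => i; apply: cvgD.
      apply: cvgM; first exact: cvg_cst.
      by apply: cvgD; exact: (hY (inl (inl ((true, i), _)))).
    by apply: cvgM; [exact: (hY (inl (inr (inr i))))|exact: cvg_cst].
- rewrite /real_energy; apply: lerD; first apply: lerD.
  + by apply: ler_wpM2l; [exact: ltW|apply: ler_sum => i _; case: (hu i)].
  + by apply: ler_wpM2l; [exact: ltW|apply: ler_sum => i _; case: (hu i)].
  + apply: ler_sum => i _; apply: lerD.
      by apply: ler_wpM2l; [rewrite mulr_ge0 ?ltW|case: (Hp i)].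
    apply: ler_wpM2r; first by rewrite invr_ge0 ltW.
    apply: (@pot_fatou _ Om (fun k => P (t k) i)) => //.
    * by move=> k; case: (sP (t k) i).
    * exact: mfs.
    * exact: (aes (true, i)).
    * exact: (hY (inl (inr (inr i)))).
Qed.

End Minimizer.

Unset Implicit Arguments.
Set Strict Implicit.

Theorem theorem3 (R : realType) (Om : set (R * R)) (K : nat)
    (I : R * R -> R) (lam alpha eps : R) :
  domain Om -> bounded_set Om -> smooth_boundary Om ->
  (0 < K)%N -> L2 Om I ->
  0 < lam -> 0 < alpha -> 0 < eps ->
  exists P U : 'I_K -> R * R -> R,
    adm Om P U /\
    (forall P' U' : 'I_K -> R * R -> R, adm Om P' U' ->
       (energy Om lam alpha eps I P U <= energy Om lam alpha eps I P' U')%E).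
Proof.
move=> dO bO sb K0 lI lam0 alpha0 eps0; have [oO _] := dO.
have fO := leb2_bounded (open_pmeasurable oO) bO.
pose S : set R := [set r | exists P U : 'I_K -> R * R -> R, adm Om P U /\ r = real_energy Om lam alpha eps I P U].
have S0 : lbound S 0 by move=> _ [P [U [_ ->]]]; exact: real_energy_ge0.
have iS : has_inf S.
  split; last by exists 0.
  have [P [U h]] := @adm_nonempty R K Om K0 oO bO.
  by exists (real_energy Om lam alpha eps I P U), P, U.
have /choice[PU hPU] : forall k : nat, exists PU : ('I_K -> R * R -> R) * ('I_K -> R * R -> R),
    adm Om PU.1 PU.2 /\ real_energy Om lam alpha eps I PU.1 PU.2 <= inf S + k.+1%:R^-1.
  move=> k; have k0 : (0 : R) < k.+1%:R^-1 by rewrite invr_gt0.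
  have [_ [P [U [h ->]]] h2] := inf_adherent k0 iS.
  by exists (P, U); split => //; exact: ltW.
have [||p [u [t [l [ht hpu hl pl]]]]] := @adm_limit R K Om lam alpha eps I (fun k => (PU k).1)
    (fun k => (PU k).2) (inf S + 1) dO bO sb lI lam0 alpha0 eps0.
- by move=> k; case: (hPU k).
- move=> k; apply: le_trans (hPU k).2 _; rewrite lerD2l.
  by rewrite invf_le1// ler1n.
have lS : l <= inf S.
  have h : (fun k => inf S + k.+1%:R^-1 : R) @ \oo --> inf S + 0.
    by apply: cvgD; [exact: cvg_cst|exact: cvg_harmonic].
  rewrite addr0 in h; rewrite -(cvg_lim _ hl)// -(cvg_lim _ h)//.
  apply: ler_lim; [exact: (cvgP _ hl)|exact: (cvgP _ h)|].
  apply: nearW => k; apply: le_trans (hPU (t k)).2 _.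
  by rewrite lerD2l lef_pV2 ?posrE// ler_nat ltnS.
exists p, u; split => // P' U' h'.
rewrite !energyE// lee_fin; apply: (le_trans pl); apply: (le_trans lS).
by apply: ge_inf; [exists 0|exists P', U'].
Qed.
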